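(* Let $G=\mathbb{Z}^d$ with $d\geq 1$, and let $V$ be a finite vector space. Let $\sigma_s\in \mathrm{LNUCA}_c(G,V)$, with configuration of local defining maps $s$. Then it is decidable whether: (i) $\sigma_s$ is nilpotent; (ii) $\sigma_s$ is periodic, resp. eventually periodic; (iii) $\sigma_s$ is Cayley-Hamilton; (iv) $\sigma_s$ is injective; (v) $\sigma_s$ is post-surjective.
   Context: For a group $G$ and a set $A$, $A^G$ is the set of maps (configurations) $G\to A$, and $G$ acts on it by $(gx)(h)=x(g^{-1}h)$. Let $M\subset G$ and $S=A^{A^M}$ be the set of all maps $A^M\to A$. For $s\in S^G$, the non-uniform cellular automaton (NUCA) $\sigma_s\colon A^G\to A^G$ with memory $M$ and configuration of local defining maps $s$ is $\sigma_s(x)(g)=s(g)((g^{-1}x)|_M)$ for $x\in A^G$, $g\in G$. For a vector space $V$ over a field $k$, $\mathcal{L}(V^M,V)$ is the set of linear maps $V^M\to V$; $\sigma_s$ with $s\in\mathcal{L}(V^M,V)^G$ is a linear NUCA. $\mathrm{LNUCA}_c(G,V)$ is the set of all maps $\tau\colon V^G\to V^G$ for which there exist finite subsets $M,E\subset G$ and $s\in\mathcal{L}(V^M,V)^G$ such that $\tau=\sigma_s$ and $s(g)=s(h)$ for all $g,h\in G\setminus E$. Such $\tau$ is specified by the finite data $M$, $E$, $s|_E$ and the common value of $s$ outside $E$; ''decidable'' means that there is an algorithm deciding the property from such data. A linear NUCA $\tau$ is: nilpotent if $\tau^n=0$ for some integer $n\ge1$; periodic if $\tau^n=\mathrm{Id}$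 for some $n\geq 1$; eventually periodic if $\tau^{m+n}=\tau^n$ for some integers $m,n\ge1$; Cayley-Hamilton if $P(\tau)=0$ for some nonzero polynomial $P\in k[z]$. Two configurations $x,y\in V^G$ are asymptotic if $x|_{G\setminus F}=y|_{G\setminus F}$ for some finite $F\subset G$. The NUCA $\sigma_s$ is post-surjective if for all $x,y\in V^G$ with $y$ asymptotic to $\sigma_s(x)$, there exists $z\in V^G$ asymptotic to $x$ such that $\sigma_s(z)=y$. *)

(* Defs.v *)
From mathcomp Require Import all_boot all_order all_algebra finmap.
Set Implicit Arguments. Unset Strict Implicit. Unset Printing Implicit Defensive.
Import GRing.Theory.
Local Open Scope ring_scope.

(* Algorithms are Kleene's mu-recursive functions: [recalg n] is the syntax of
   the n-ary ones and [eval f v y] means that f halts on v with output y. *)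
Inductive recalg : nat -> Type :=
| RZero n : recalg n
| RSucc : recalg 1
| RProj n (i : 'I_n) : recalg n
| RComp m n (f : recalg m) (gs : 'I_m -> recalg n) : recalg n
| RRec n (f : recalg n) (g : recalg n.+2) : recalg n.+1
| RMu n (f : recalg n.+1) : recalg n.

Fixpoint eval n (f : recalg n) : n.-tuple nat -> nat -> Prop :=
  match f in recalg n return n.-tuple nat -> nat -> Prop with
  | RZero _ => fun _ y => y = 0%N
  | RSucc => fun v y => y = (thead v).+1
  | RProj _ i => fun v y => y = tnth v i
  | RComp m _ f gs => fun v y =>
      exists2 w : m.-tuple nat,
        forall i, eval (gs i) v (tnth w i) & eval f w y
  | RRec n f g => fun v =>
      let p : n.-tuple nat := [tuple of behead v] in
      (fix rec (i y : nat) : Prop :=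
         if i is j.+1 then
           exists2 z, rec j z & eval g [tuple of j :: z :: p] y
         else eval f p y) (thead v)
  | RMu _ f => fun v y =>
      eval f [tuple of y :: v] 0%N /\
      forall i, (i < y)%N -> exists z, eval f [tuple of i :: v] z.+1
  end.

Lemma eval_functional n (f : recalg n) v y z : eval f v y -> eval f v z -> y = z.
Proof.
elim: f v y z => {n} [n|||m n f IHf gs IHg|n f IHf g IHg|n f IHf] /=.
- by move=> _ y z -> ->.
- by move=> v y z -> ->.
- by move=> n i v y z -> ->.
- move=> v y z [w1 Hw1 H1] [w2 Hw2 H2].
  have E : w1 = w2 by apply: eq_from_tnth => i; apply: IHg (Hw1 i) (Hw2 i).
  by move: H2; rewrite -E; apply: IHf.
- move=> v; elim: (thead v) => [|j IHj] y z /=; first exact: IHf.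
  move=> [a Ha H1] [b Hb H2]; move: H2; rewrite -(IHj _ _ Ha Hb).
  exact: IHg.
- move=> v y z [Hy Ly] [Hz Lz].
  case: (ltngtP y z) => // lt.
  + by have [u /(IHf _ _ _ Hy)] := Lz _ lt.
  + by have [u /(IHf _ _ _ Hz)] := Ly _ lt.
Qed.

Definition decides (c : recalg 1) (w : nat) (P : Prop) : Prop :=
  (P -> eval c [tuple w] 1%N) /\ (~ P -> eval c [tuple w] 0%N).

Notation Zd d := 'rV[int]_d.

Section NUCA.
Variables (d : nat) (k : fieldType) (V : finLmodType k).
Local Notation G := (Zd d).

Definition config : Type := G -> V.

Definition act (g : G) (x : config) : config := fun h => x (- g + h).

Definition restr (M : {fset G}) (x : config) : {ffun M -> V} :=
  [ffun m : M => x (val m)].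

Definition locmap (M : {fset G}) : Type := {linear {ffun M -> V} -> V}.

Definition nuca (M : {fset G}) (s : G -> locmap M) (x : config) : config :=
  fun g => s g (restr M (act (- g) x)).

Definition constant_off (M E : {fset G}) (s : G -> locmap M) : Prop :=
  forall g h, g \notin E -> h \notin E -> s g =1 s h.

Definition LNUCAc (tau : config -> config) : Prop :=
  exists (M E : {fset G}) (s : G -> locmap M),
    constant_off E s /\ tau = nuca s.

Definition nuca_nilpotent (tau : config -> config) : Prop :=
  exists2 n, (1 <= n)%N & iter n tau = (fun _ _ => 0).

Definition nuca_periodic (tau : config -> config) : Prop :=
  exists2 n, (1 <= n)%N & iter n tau = id.

Definition nuca_eventually_periodic (tau : config -> config) : Prop :=
  exists m n, [/\ (1 <= m)%N, (1 <= n)%N & iter (m + n)%N tau = iter n tau].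

Definition poly_op (P : {poly k}) (tau : config -> config) (x : config) : config :=
  fun g => \sum_(i < size P) P`_i *: iter i tau x g.

Definition nuca_Cayley_Hamilton (tau : config -> config) : Prop :=
  exists2 P : {poly k}, P != 0 & poly_op P tau = (fun _ _ => 0).

Definition asymptotic (x y : config) : Prop :=
  exists F : {fset G}, forall g, g \notin F -> x g = y g.

Definition post_surjective (tau : config -> config) : Prop :=
  forall x y, asymptotic y (tau x) -> exists2 z, asymptotic z x & tau z = y.

Definition int_code (z : int) : nat :=
  match z with Posz n => n.*2 | Negz n => n.*2.+1 end.

Definition Zd_code (g : G) : nat :=
  CodeSeq.code [seq int_code (g ord0 i) | i <- enum 'I_d].

Definition single (M : {fset G}) (m : M) (v : V) : {ffun M -> V} :=
  [ffun m' => if m' == m then v else 0].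

(* By linearity a local map is determined by its values on the patterns with at
   most one nonzero entry; vectors are numbered by the enumeration of V. *)
Definition locmap_code (M : {fset G}) (lM : seq M) (f : locmap M) : nat :=
  CodeSeq.code
    [seq CodeSeq.code [seq nat_of_ord (enum_rank (f (single m v))) | v <- enum V]
    | m <- lM].

(* [w] is a code of the finite data M, E, s|_E and common value of s outside E.
   M and E may be listed in any order, so the data have several codes. *)
Definition is_code (M E : {fset G}) (s : G -> locmap M) (w : nat) : Prop :=
  exists (lM : seq M) (lE : seq G) (c : locmap M),
    [/\ perm_eq lM (enum {: M}), perm_eq lE E,
        forall g, g \notin E -> s g =1 c
      & w = CodeSeq.code
              [:: CodeSeq.code [seq Zd_code (val m) | m <- lM];
                  CodeSeq.code [seq CodeSeq.code [:: Zd_code g; locmap_code lM (s g)]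
                               | g <- lE];
                  locmap_code lM c]].

Definition specified_by (w : nat) (tau : config -> config) : Prop :=
  exists (M E : {fset G}) (s : G -> locmap M),
    [/\ constant_off E s, tau = nuca s & is_code E s w].

Lemma LNUCAcP (tau : config -> config) :
  (0 < d)%N -> LNUCAc tau <-> exists w, specified_by w tau.
Proof.
move=> d_gt0; split=> [[M [E [s [sE ->]]]]|[w [M [E [s [sE -> _]]]]]]; last first.
  by exists M, E, s.
have [g gE] : exists g, g \notin E.
  pose N := (\max_(h <- enum_fset E) `|h ord0 (Ordinal d_gt0)|)%N.
  exists (const_mx N.+1%:Z); apply/negP => hE.
  have := @leq_bigmax_seq _ (enum_fset E) xpredT
    (fun h : G => `|h ord0 (Ordinal d_gt0)|%N) _ hE isT.
  by rewrite mxE absz_nat ltnn.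
eexists; exists M, E, s; split=> //.
exists (enum {: M}), (enum_fset E), (s g).
by split=> // h hE; apply: sE.
Qed.

(* d and V are fixed: the input of the algorithm is a code of the finite data. *)
Definition LNUCAc_decidable (P : (config -> config) -> Prop) : Prop :=
  exists A : recalg 1,
    forall w tau, specified_by w tau -> decides A w (P tau).

End NUCA.

(* Main.v *)
(** Let [p] be the characteristic, so that [V] is ['F_p^n] as an additive group, and let [tau_c] be
    the uniform operator with the generic local map of [tau]; both agree on the configurations
    that vanish on a fixed ball.

    Counting configurations on large boxes gives, for every finitely supported [x], a nontrivial
    relation between translates of [x, tau_c x, .., tau_c^(N-1) x] with [N = n 2^d + 1], and
    coefficients supported in a ball of controlled radius.  Raising such relations to a power [p^t]
    spreads their translates apart (Frobenius), so that their terms vanish separately.  This yields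
    - an exponent [K], depending on [d], [n], [p] only, such that [tau_c] is eventually periodic
      iff [tau_c^(2K) = tau_c^K];
    - a bound on the support of the preimages of [delta 0 v] when [tau_c] is bijective on finitely
      supported configurations.

    [tau] is eventually periodic iff [tau_c] is, and a search then finds [N > 0] such that
    [tau^(2N) = tau^N]: [tau] is nilpotent iff [tau^N = 0] and periodic iff [tau^N = Id].  Over a
    finite field, Cayley-Hamilton means eventually periodic.  By an index argument, [tau] is
    surjective on finitely supported configurations (that is, post-surjective) iff [tau_c] is, with
    a right inverse [Y] of bounded radius, and no nonzero [x] supported in the ball makes
    [Y (tau x)] vanish there.  Injectivity of [tau] is surjectivity of the transposed operator. *)
Require Import Defs.
From mathcomp Require Import all_boot all_order all_algebra finmap.
From mathcomp Require Import fingroup morphism cyclic pgroup abelian finalg mxabelem.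
From mathcomp Require Import finfield zify boolp classical_sets functions.
Set Implicit Arguments. Unset Strict Implicit. Unset Printing Implicit Defensive.

(** * Computable functions on coded data *)

(** In coordinates a uniform operator is a matrix over the Laurent polynomial ring of [Z^d] over
    ['F_p], acting on a free module. The relations between translates stand in for its
    characteristic polynomial: counting yields them without determinants, at the price of degree
    [n 2^d] instead of [n], where [2^d] bounds the growth of a box whose radius doubles. Over the
    prime field every scalar is fixed by Frobenius, so the powers of a relation keep its
    coefficients. Eventual periodicity can be confirmed by search; a negative answer needs a bound.
    Only the uniform operator gets an explicit one; the perturbed operator is searched without a
    bound, once the uniform test has guaranteed success. For surjectivity the danger is that
    preimages are arbitrarily large; a bounded radius makes the search for [Y] finite. Injectivity
    concerns infinite supports, and becomes a question about finite ones because all configurations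
    form the linear dual of the finitely supported ones. *)

Definition rcomp n (f : seq nat -> nat) : Prop :=
  exists A : recalg n, forall v : n.-tuple nat, eval A v (f v).

Lemma rcomp_ext n f g : (forall s, size s = n -> f s = g s) -> rcomp n f -> rcomp n g.
Proof. by move=> fg [A HA]; exists A => v; rewrite -fg ?size_tuple. Qed.

Lemma rcomp_proj n i : i < n -> rcomp n (fun s => nth 0 s i).
Proof. by move=> lt_in; exists (RProj (Ordinal lt_in)) => v /=; rewrite (tnth_nth 0). Qed.

Lemma rcomp_succ : rcomp 1 (fun s => (nth 0 s 0).+1).
Proof. by exists RSucc => v /=; rewrite [thead v](tnth_nth 0). Qed.

Lemma rcomp_comp n f (gs : seq (seq nat -> nat)) :
    rcomp (size gs) f -> (forall i, i < size gs -> rcomp n (nth (fun=> 0) gs i)) ->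
  rcomp n (fun s => f [seq g s | g <- gs]).
Proof.
move=> [A HA] Hg.
have /fin_all_exists[B HB] (i : 'I_(size gs)) := Hg i (ltn_ord i).
exists (RComp A B) => v /=.
have sz : size [seq g (v : seq nat) | g <- gs] == size gs by rewrite size_map.
exists (Tuple sz) => [i|]; last exact: (HA (Tuple sz)).
by rewrite (tnth_nth 0) /= (nth_map (fun=> 0)).
Qed.

Lemma rcomp_rec n f g : rcomp n f -> rcomp n.+2 g ->
  rcomp n.+1 (fun s => nat_rect _ (f (behead s))
                         (fun j z => g [:: j, z & behead s]) (head 0 s)).
Proof.
move=> [A HA] [B HB]; exists (RRec A B) => v /=.
have -> : head 0 v = thead v by rewrite [thead v](tnth_nth 0) nth0.
elim: (thead v) => [|j IHj] /=; first exact: (HA [tuple of behead v]).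
exists (nat_rect (fun=> nat) (f (behead v)) (fun j z => g [:: j, z & behead v]) j);
  first exact: IHj.
exact: (HB [tuple of [:: j, _ & [tuple of behead v]]]).
Qed.

Lemma rcomp_mu n f h : rcomp n.+1 f ->
    (forall s, size s = n ->
       f (h s :: s) = 0 /\ forall i, i < h s -> f (i :: s) <> 0) ->
  rcomp n h.
Proof.
move=> [A HA] Hh; exists (RMu A) => v /=.
have [h0 hlt] := Hh v (size_tuple v).
split=> [|i lt_i]; first by rewrite -[in X in eval _ _ X]h0; apply: HA.
exists (f (i :: v)).-1; rewrite prednK ?lt0n; last exact/eqP/hlt.
exact: (HA [tuple of i :: v]).
Qed.

Lemma rcomp_app1 F n g :
  rcomp 1 (fun s => F (nth 0 s 0)) -> rcomp n g -> rcomp n (fun s => F (g s)).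
Proof. by move=> HF Hg; apply: (@rcomp_comp n _ [:: g] HF); case. Qed.

Lemma rcomp_app2 F n g h :
    rcomp 2 (fun s => F (nth 0 s 0) (nth 0 s 1)) -> rcomp n g -> rcomp n h ->
  rcomp n (fun s => F (g s) (h s)).
Proof. by move=> HF Hg Hh; apply: (@rcomp_comp n _ [:: g; h] HF) => -[|[]]. Qed.

Lemma rcomp_S n g : rcomp n g -> rcomp n (fun s => (g s).+1).
Proof. exact/rcomp_app1/rcomp_succ. Qed.

Lemma rcomp_const n c : rcomp n (fun=> c).
Proof.
elim: c => [|c]; first by exists (RZero n).
exact: rcomp_S.
Qed.

Lemma rcomp_rec1 F a g : (F 0 = a) -> (forall j, F j.+1 = g j (F j)) ->
  rcomp 2 (fun s => g (nth 0 s 0) (nth 0 s 1)) -> rcomp 1 (fun s => F (nth 0 s 0)).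
Proof.
move=> F0 FS Hg; apply: rcomp_ext (rcomp_rec (rcomp_const 0 a) Hg) => -[|m [|//]] //= _.
by elim: m => [|m IHm] //=; rewrite FS IHm.
Qed.

Lemma rcomp_rec2 F f g :
    (forall y, F 0 y = f y) -> (forall j y, F j.+1 y = g j (F j y) y) ->
    rcomp 1 (fun s => f (nth 0 s 0)) ->
    rcomp 3 (fun s => g (nth 0 s 0) (nth 0 s 1) (nth 0 s 2)) ->
  rcomp 2 (fun s => F (nth 0 s 0) (nth 0 s 1)).
Proof.
move=> F0 FS Hf Hg; apply: rcomp_ext (rcomp_rec Hf Hg) => -[|m [|y [|//]]] //= _.
by elim: m => [|m IHm] //=; rewrite FS IHm.
Qed.

Lemma rcomp_swap F : rcomp 2 (fun s => F (nth 0 s 1) (nth 0 s 0)) ->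
  rcomp 2 (fun s => F (nth 0 s 0) (nth 0 s 1)).
Proof.
move=> H; apply: (@rcomp_app2 (fun x y => F y x) 2 (fun s => nth 0 s 1) (fun s => nth 0 s 0)) => //;
exact: rcomp_proj.
Qed.

Lemma rcomp_add n g h : rcomp n g -> rcomp n h -> rcomp n (fun s => g s + h s).
Proof.
apply: rcomp_app2; apply: (@rcomp_rec2 addn id (fun _ z _ => z.+1)) => //; first exact: rcomp_proj.
exact/rcomp_S/rcomp_proj.
Qed.

Lemma rcomp_mul n g h : rcomp n g -> rcomp n h -> rcomp n (fun s => g s * h s).
Proof.
apply: rcomp_app2; apply: (@rcomp_rec2 muln (fun=> 0) (fun _ z y => y + z)) => //.
  exact: rcomp_const.
by apply: rcomp_add; apply: rcomp_proj.
Qed.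

Lemma rcomp_pred n g : rcomp n g -> rcomp n (fun s => (g s).-1).
Proof. by apply: rcomp_app1; apply: (@rcomp_rec1 predn 0 (fun j _ => j)) => //;
  apply: rcomp_proj. Qed.

Lemma rcomp_sub n g h : rcomp n g -> rcomp n h -> rcomp n (fun s => g s - h s).
Proof.
apply: rcomp_app2; apply: (@rcomp_swap (fun x y => x - y)).
apply: (@rcomp_rec2 (fun y x => x - y) id (fun _ z _ => z.-1)) => [y|j y||].
- exact: subn0.
- exact: subnS.
- exact: rcomp_proj.
- exact/rcomp_pred/rcomp_proj.
Qed.

Lemma rcomp_pow2 n g : rcomp n g -> rcomp n (fun s => 2 ^ g s).
Proof.
apply: rcomp_app1; apply: (@rcomp_rec1 _ 1 (fun _ z => z + z)) => // [j|].
  by rewrite expnS mul2n addnn.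
by apply: rcomp_add; apply: rcomp_proj.
Qed.

Lemma rcomp_odd n g : rcomp n g -> rcomp n (fun s => nat_of_bool (odd (g s))).
Proof.
apply: (@rcomp_app1 (fun m => nat_of_bool (odd m)));
  apply: (@rcomp_rec1 (fun m => nat_of_bool (odd m)) 0 (fun _ z => 1 - z)) => // [j|].
  by rewrite oddS; case: (odd j).
by apply: rcomp_sub; [apply: rcomp_const | apply: rcomp_proj].
Qed.

Lemma rcomp_half n g : rcomp n g -> rcomp n (fun s => (g s)./2).
Proof.
apply: rcomp_app1; apply: (@rcomp_rec1 half 0 (fun j z => odd j + z)) => // [j|].
  by rewrite -uphalfE uphalf_half.
by apply: rcomp_add; [apply/rcomp_odd|]; apply: rcomp_proj.
Qed.

Lemma rcomp_iter_half n g h : rcomp n g -> rcomp n h ->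
  rcomp n (fun s => iter (g s) half (h s)).
Proof.
apply: (@rcomp_app2 (fun k m => iter k half m)).
apply: (@rcomp_rec2 (fun k => iter k half) id (fun _ z _ => z./2)) => //; first exact: rcomp_proj.
exact/rcomp_half/rcomp_proj.
Qed.

Lemma rcomp_eq0 n g : rcomp n g -> rcomp n (fun s => nat_of_bool (g s == 0)).
Proof.
move=> Hg; apply: rcomp_ext (rcomp_sub (rcomp_const n 1) Hg) => s _.
by case: (g s).
Qed.

Local Notation code := CodeSeq.code.
Local Notation decode := CodeSeq.decode.

Lemma iter_half_mul k m : iter k half (2 ^ k * m) = m.
Proof. by elim: k m => [|k IHk] m; rewrite ?mul1n // iterSr expnS -mulnA mul2n doubleK. Qed.

Definition cons_code n s := 2 ^ n * s.*2.+1.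
Definition head_code m := head 0 (decode m).
Definition behead_code m := code (behead (decode m)).

Lemma rcomp_cons n g h : rcomp n g -> rcomp n h -> rcomp n (fun s => cons_code (g s) (h s)).
Proof.
move=> Hg Hh; apply: rcomp_mul; first exact: rcomp_pow2.
by apply: rcomp_S; apply: rcomp_ext (rcomp_add Hh Hh) => s _; rewrite addnn.
Qed.

Lemma code_eq0 s : (code s == 0) = (s == [::]).
Proof. by case: s => //= n s; rewrite muln_eq0 expn_eq0. Qed.

(* The head of a nonempty code is its 2-adic valuation. *)
Lemma rcomp_head n g : rcomp n g -> rcomp n (fun s => head_code (g s)).
Proof.
apply: rcomp_app1.
(* [f] vanishes as soon as the halved number is odd. The summand for 0 stops the search at once on
   the empty code, which has no odd part, with the default head 0. *)
pose f s := 1 - (nat_of_bool (nth 0 s 1 == 0) + nat_of_bool (odd (iter (nth 0 s 0) half (nth 0 s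
  1)))).
apply: (@rcomp_mu 1 f).
  apply: rcomp_sub; [exact: rcomp_const | apply: rcomp_add].
  - exact/rcomp_eq0/rcomp_proj.
  - by apply/rcomp_odd/rcomp_iter_half; apply: rcomp_proj.
move=> [|m [|//]] //= _; rewrite /f /= /head_code.
case def_m: (decode m) => [|k s]; have := CodeSeq.decodeK m; rewrite def_m => /= <- //.
rewrite muln_eq0 expn_eq0 /= iter_half_mul /= odd_double; split=> // i lt_ik.
by rewrite -(subnKC (ltnW lt_ik)) expnD -mulnA iter_half_mul oddM oddX subn_eq0 leqNgt lt_ik.
Qed.

Lemma rcomp_behead n g : rcomp n g -> rcomp n (fun s => behead_code (g s)).
Proof.
apply: rcomp_app1.
(* One halving more than the head also removes the final bit 1 of [2 ^ n * s.*2.+1]. *)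
apply: (@rcomp_ext _ (fun s => iter (head_code (nth 0 s 0)).+1 half (nth 0 s 0))).
  move=> [|m [|//]] //= _; rewrite /head_code /behead_code -{2}(CodeSeq.decodeK m).
  by case: (decode m) => [|k s] //=; rewrite iter_half_mul /= uphalf_double.
by apply: rcomp_iter_half; [apply/rcomp_S/rcomp_head|]; apply: rcomp_proj.
Qed.

Lemma head_codeE x s : head_code (code (x :: s)) = x.
Proof. by rewrite /head_code CodeSeq.codeK. Qed.
Lemma behead_codeE s : behead_code (code s) = code (behead s).
Proof. by rewrite /behead_code CodeSeq.codeK. Qed.

(** * Encodings, and computable functions between encoded types *)

Class Enc (T : Type) := enc : T -> nat.
Global Instance enc_nat : Enc nat := id.
Global Instance enc_bool : Enc bool := nat_of_bool.
Global Instance enc_int : Enc int := int_code.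
Global Instance enc_pair T U {eT : Enc T} {eU : Enc U} : Enc (T * U) :=
  fun t => code [:: enc t.1; enc t.2].
Global Instance enc_seq T {eT : Enc T} : Enc (seq T) := fun s => code (map enc s).
(** Not an instance for all finite types, where it would compete with the encodings of [bool] and of
    pairs. *)
Definition enc_fin (T : finType) : Enc T := fun x => nat_of_ord (enum_rank x).

(** Only codes are tested: the algorithm may do anything on numbers outside the range of [enc]. *)
Definition computable T U {eT : Enc T} {eU : Enc U} (f : T -> U) : Prop :=
  exists A : recalg 1, forall t, eval A [tuple enc t] (enc (f t)).

Lemma computable_ext C T {eC : Enc C} {eT : Enc T} (f g : C -> T) :
  f =1 g -> computable f -> computable g.
Proof. by move=> fg [A HA]; exists A => t; rewrite -fg. Qed.

Lemma computable_raw T U {eT : Enc T} {eU : Enc U} F (f : T -> U) :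
  rcomp 1 (fun s => F (nth 0 s 0)) -> (forall t, F (enc t) = enc (f t)) -> computable f.
Proof. by move=> [A HA] Ff; exists A => t; rewrite -Ff; apply: (HA [tuple enc t]). Qed.

Lemma computable_comp C T U {eC : Enc C} {eT : Enc T} {eU : Enc U} (f : T -> U) (g : C -> T) :
  computable f -> computable g -> computable (fun c => f (g c)).
Proof.
move=> [A HA] [B HB]; exists (RComp A (fun _ : 'I_1 => B)) => c /=.
by exists [tuple enc (g c)] => // i; rewrite (tnth_nth 0) ord1.
Qed.

Lemma computable_id T {eT : Enc T} : computable (@id T).
Proof. by apply: (@computable_raw _ _ _ _ id) => //; apply: rcomp_proj. Qed.

Lemma computable_const C T {eC : Enc C} {eT : Enc T} (t : T) : computable (fun _ : C => t).
Proof. by apply: (@computable_raw _ _ _ _ (fun=> enc t)) => //; apply: rcomp_const. Qed.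

Lemma computable_enc C T {eC : Enc C} {eT : Enc T} (f : C -> T) :
  computable f -> computable (fun c => enc (f c)).
Proof. by []. Qed.

Lemma computable_raw2 C T U X {eC : Enc C} {eT : Enc T} {eU : Enc U} {eX : Enc X} F
    (h : T -> U -> X) (f : C -> T) (g : C -> U) :
    rcomp 2 (fun s => F (nth 0 s 0) (nth 0 s 1)) ->
    (forall t u, F (enc t) (enc u) = enc (h t u)) ->
  computable f -> computable g -> computable (fun c => h (f c) (g c)).
Proof.
move=> [A HA] HF [B HB] [D HD].
exists (RComp A (fun i : 'I_2 => if (i : nat) is 0 then B else D)) => c /=.
exists [tuple enc (f c); enc (g c)].
  by case=> -[|[|//]] i; rewrite (tnth_nth 0) /=; [apply: HB | apply: HD].
by rewrite -HF; apply: (HA [tuple _; _]).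
Qed.

Lemma computable_cons C T {eC : Enc C} {eT : Enc T} (f : C -> T) (g : C -> seq T) :
  computable f -> computable g -> computable (fun c => f c :: g c).
Proof.
apply: (@computable_raw2 _ _ _ _ _ _ _ _ cons_code cons) => //.
by apply: rcomp_cons; apply: rcomp_proj.
Qed.

Lemma computable_pair C T U {eC : Enc C} {eT : Enc T} {eU : Enc U} (f : C -> T) (g : C -> U) :
  computable f -> computable g -> computable (fun c => (f c, g c)).
Proof.
apply: (@computable_raw2 _ _ _ _ _ _ _ _ (fun x y => cons_code x (cons_code y 0)) pair) => //.
by apply: rcomp_cons; [|apply: rcomp_cons; [|exact: rcomp_const]]; apply: rcomp_proj.
Qed.

Lemma computable_fst C T U {eC : Enc C} {eT : Enc T} {eU : Enc U} (f : C -> T * U) :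
  computable f -> computable (fun c => (f c).1).
Proof.
apply: computable_comp; apply: (@computable_raw _ _ _ _ head_code).
  exact/rcomp_head/rcomp_proj.
by move=> t; rewrite head_codeE.
Qed.

Lemma computable_snd C T U {eC : Enc C} {eT : Enc T} {eU : Enc U} (f : C -> T * U) :
  computable f -> computable (fun c => (f c).2).
Proof.
apply: computable_comp; apply: (@computable_raw _ _ _ _ (fun x => head_code (behead_code x))).
  exact/rcomp_head/rcomp_behead/rcomp_proj.
by move=> t; rewrite behead_codeE head_codeE.
Qed.

Lemma computable_behead C T {eC : Enc C} {eT : Enc T} (f : C -> seq T) :
  computable f -> computable (fun c => behead (f c)).
Proof.
apply: computable_comp; apply: (@computable_raw _ _ _ _ behead_code).
  exact/rcomp_behead/rcomp_proj.
by move=> t; rewrite behead_codeE; case: t.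
Qed.

Lemma computable_nilp C T {eC : Enc C} {eT : Enc T} (f : C -> seq T) :
  computable f -> computable (fun c => nilp (f c)).
Proof.
apply: computable_comp; apply: (@computable_raw _ _ _ _ (fun x => nat_of_bool (x == 0))).
  exact/rcomp_eq0/rcomp_proj.
by move=> t; rewrite /enc /enc_seq code_eq0; case: t.
Qed.

Lemma computable_natrec C T {eC : Enc C} {eT : Enc T}
    (n : C -> nat) (f : C -> T) (g : C -> nat -> T -> T) :
    computable n -> computable f ->
    computable (fun p : C * (nat * T) => g p.1 p.2.1 p.2.2) ->
  computable (fun c => nat_rect _ (f c) (g c) (n c)).
Proof.
move=> [N HN] [A HA] [B HB].
(* [Q] packs the three arguments of a recursion step into the code of [(c, (j, z))]. *)
have [Q HQ] : rcomp 3 (fun s => cons_code (nth 0 s 2) (cons_code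
    (cons_code (nth 0 s 0) (cons_code (nth 0 s 1) 0)) 0)).
  by do ![apply: rcomp_cons]; (exact: rcomp_proj || exact: rcomp_const).
exists (RComp (RRec A (RComp B (fun _ : 'I_1 => Q)))
  (fun i : 'I_2 => if (i : nat) is 0 then N else RProj ord0)) => c /=.
exists [tuple enc (n c); enc c].
  by case=> -[|[|//]] i; rewrite (tnth_nth 0) /= ?(tnth_nth 0) //; apply: HN.
have -> : thead [tuple enc (n c); enc c] = n c by rewrite [thead _](tnth_nth 0).
set w := [tuple enc (n c); enc c]; have : behead w = [:: enc c] by [].
move: w => w Hw; elim: (n c) => [|j IHj] /=.
  by have -> : [tuple of behead w] = [tuple enc c] by exact/val_inj.
exists (enc (nat_rect (fun=> T) (f c) (g c) j)); first exact: IHj.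
exists [tuple enc (c, (j, nat_rect (fun=> T) (f c) (g c) j))] => [i|]; last first.
  exact: (HB (c, (j, nat_rect (fun=> T) (f c) (g c) j))).
rewrite (tnth_nth 0) ord1; set u := [tuple of _].
have -> : u = [tuple j; enc (nat_rect (fun=> T) (f c) (g c) j); enc c].
  by apply/val_inj; rewrite /= Hw.
exact: (HQ [tuple _; _; _]).
Qed.

Lemma computable_if C T {eC : Enc C} {eT : Enc T} (b : C -> bool) (f g : C -> T) :
  computable b -> computable f -> computable g ->
  computable (fun c => if b c then f c else g c).
Proof.
move=> Hb Hf Hg.
apply: (@computable_ext _ _ _ _ (fun c => nat_rect (fun=> T) (g c) (fun _ _ => f c) (b c))).
  by move=> c; case: (b c).
apply: computable_natrec => //.
apply: (computable_comp Hf); exact/computable_fst/computable_id.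
Qed.

Lemma computable_search C {eC : Enc C} (f : C -> nat -> bool)
    (ex_f : forall c, exists n, f c n) :
  computable (fun p : C * nat => f p.1 p.2) -> computable (fun c => ex_minn (ex_f c)).
Proof.
move=> Hf.
have [B HB] : computable (fun p : C * nat => ~~ f p.1 p.2).
  apply: (@computable_ext _ _ _ _ (fun p => if f p.1 p.2 then false else true)).
    by move=> p; case: (f p.1 p.2).
  by apply: computable_if => //; apply: computable_const.
have [Q HQ] : rcomp 2 (fun s => cons_code (nth 0 s 1) (cons_code (nth 0 s 0) 0)).
  by do ![apply: rcomp_cons]; (exact: rcomp_proj || exact: rcomp_const).
exists (RMu (RComp B (fun _ : 'I_1 => Q))) => c /=.
have HBc n : exists2 w : 1.-tuple nat,
    forall i : 'I_1, eval Q [tuple of n :: [tuple enc c]] (tnth w i) & eval B w (~~ f c n).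
  exists [tuple enc (c, n)] => [i|]; last exact: (HB (c, n)).
  by rewrite (tnth_nth 0) ord1; apply: (HQ [tuple _; _]).
case: ex_minnP => n fn min_n; split=> [|i lt_in]; first by have := HBc n; rewrite fn.
exists 0; have := HBc i; have [fi _|//] := boolP (f c i).
by have := min_n _ fi; rewrite leqNgt lt_in.
Qed.

Lemma computable_head C T {eC : Enc C} {eT : Enc T} (d : T) (f : C -> seq T) :
  computable f -> computable (fun c => head d (f c)).
Proof.
apply: (@computable_comp _ _ _ _ _ _ (fun s => head d s)).
apply: (@computable_raw _ _ _ _ (fun x => (x == 0) * enc d + (1 - (x == 0)) * head_code x)).
  by apply: rcomp_add; apply: rcomp_mul; (try apply: rcomp_sub); (try apply: rcomp_eq0);
     (try apply: rcomp_head); (exact: rcomp_proj || exact: rcomp_const).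
case=> [|x s]; first by rewrite /= mul1n addn0.
have -> : (enc (x :: s) == 0) = false by exact: (code_eq0 (map enc (x :: s))).
by rewrite mul0n add0n subn0 mul1n head_codeE.
Qed.

Lemma computable_iter C T {eC : Enc C} {eT : Enc T} (n : C -> nat) (g : C -> T -> T) (f : C -> T) :
    computable n -> computable f -> computable (fun p : C * T => g p.1 p.2) ->
  computable (fun c => iter (n c) (g c) (f c)).
Proof.
move=> Hn Hf Hg.
apply: (@computable_ext _ _ _ _ (fun c => nat_rect (fun=> T) (f c) (fun _ => g c) (n c))).
  by move=> c; elim: (n c) => //= j ->.
apply: computable_natrec => //.
apply: (@computable_comp _ _ _ _ _ _ _ (fun p : C * (nat * T) => (p.1, p.2.2)) Hg).
apply: computable_pair; last apply: computable_snd; try apply: computable_snd.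
  exact/computable_fst/computable_id.
exact: computable_id.
Qed.

Lemma computable_nth C T {eC : Enc C} {eT : Enc T} (d : T) (f : C -> seq T) (n : C -> nat) :
  computable f -> computable n -> computable (fun c => nth d (f c) (n c)).
Proof.
move=> Hf Hn.
apply: (@computable_ext _ _ _ _ (fun c => head d (iter (n c) behead (f c)))).
  move=> c; rewrite -nth0 -[n c in RHS]addn0 -nth_drop; congr (nth _ _ _).
  by elim: (n c) => [|j IHj] /=; rewrite ?drop0 // IHj -drop1 drop_drop add1n.
apply/computable_head/computable_iter => //.
exact/computable_behead/computable_snd/computable_id.
Qed.

Lemma size_le_code s : size s <= code s.
Proof.
elim: s => //= n s IHs; apply: (@leq_trans (code s).+1) => //.
by rewrite (leq_trans _ (leq_pmull _ _)) ?expn_gt0 // ltnS -addnn leq_addr.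
Qed.

(** The size of a list is itself computed by folding, so the loop runs as many times as the code of
    the list, which bounds the size; the surplus rounds leave the state unchanged. *)
Lemma computable_foldl C A B {eC : Enc C} {eA : Enc A} {eB : Enc B}
    (f : C -> B -> A -> B) (b : C -> B) (s : C -> seq A) :
    computable (fun p : C * (B * A) => f p.1 p.2.1 p.2.2) -> computable b -> computable s ->
  computable (fun c => foldl (f c) (b c) (s c)).
Proof.
move=> Hf Hb Hs; have [[x0]|noA] := EM (inhabited A); last first.
  apply: computable_ext Hb => c; case: (s c) => // a.
  by case: noA; exists.
pose st c (q : seq A * B) := if nilp q.1 then q else (behead q.1, f c q.2 (head x0 q.1)).
apply: (@computable_ext _ _ _ _ (fun c => (iter (enc (s c)) (st c) (s c, b c)).2)).
  move=> c; have : size (s c) <= enc (s c) by rewrite -(size_map enc) size_le_code.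
  move: (enc (s c)) => m; elim: (m : nat) (s c) (b c) => [|j IHj] [|a l] b0 //; rewrite iterSr.
    by move=> _; rewrite (IHj [::]).
  by rewrite ltnS; apply: IHj.
apply/computable_snd/computable_iter.
- exact: computable_enc.
- exact: computable_pair.
have H1 : computable (fun p : C * (seq A * B) => p.2.1).
  exact/computable_fst/computable_snd/computable_id.
apply: computable_if.
- exact: computable_nilp.
- exact/computable_snd/computable_id.
apply: computable_pair; first exact: computable_behead.
apply: (@computable_comp _ _ _ _ _ _ (fun p : C * (B * A) => f p.1 p.2.1 p.2.2)
  (fun p => (p.1, (p.2.2, head x0 p.2.1))) Hf).
apply: computable_pair; first exact/computable_fst/computable_id.
apply: computable_pair; last exact: computable_head.
exact/computable_snd/computable_snd/computable_id.
Qed.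

Lemma computable_rev C A {eC : Enc C} {eA : Enc A} (s : C -> seq A) :
  computable s -> computable (fun c => rev (s c)).
Proof.
move=> Hs; apply: (@computable_ext _ _ _ _ (fun c => foldl (fun l x => x :: l) [::] (s c))).
  move=> c; rewrite /rev; elim: (s c) [::] => //= a l IHl l'.
apply: computable_foldl => //; last exact: computable_const.
apply: computable_cons; first exact/computable_snd/computable_snd/computable_id.
exact/computable_fst/computable_snd/computable_id.
Qed.

Lemma computable_foldr C A B {eC : Enc C} {eA : Enc A} {eB : Enc B}
    (f : C -> A -> B -> B) (b : C -> B) (s : C -> seq A) :
    computable (fun p : C * (A * B) => f p.1 p.2.1 p.2.2) -> computable b -> computable s ->
  computable (fun c => foldr (f c) (b c) (s c)).
Proof.
move=> Hf Hb Hs.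
apply: (@computable_ext _ _ _ _ (fun c => foldl (fun y x => f c x y) (b c) (rev (s c)))).
  by move=> c; rewrite foldl_rev.
apply: computable_foldl => //; last exact: computable_rev.
apply: (@computable_comp _ _ _ _ _ _ _ (fun p : C * (B * A) => (p.1, (p.2.2, p.2.1))) Hf).
apply: computable_pair; first exact/computable_fst/computable_id.
by apply: computable_pair; [apply: computable_snd|apply: computable_fst];
  exact/computable_snd/computable_id.
Qed.

Lemma computable_map C A B {eC : Enc C} {eA : Enc A} {eB : Enc B}
    (f : C -> A -> B) (s : C -> seq A) :
    computable (fun p : C * A => f p.1 p.2) -> computable s ->
  computable (fun c => [seq f c x | x <- s c]).
Proof.
move=> Hf Hs; rewrite /map.
apply: (@computable_ext _ _ _ _ (fun c => foldr (fun x l => f c x :: l) [::] (s c))) => //.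
apply: computable_foldr => //; last exact: computable_const.
apply: computable_cons; last exact/computable_snd/computable_snd/computable_id.
apply: (@computable_comp _ _ _ _ _ _ _ (fun p : C * (A * seq B) => (p.1, p.2.1)) Hf).
apply: computable_pair; first exact/computable_fst/computable_id.
exact/computable_fst/computable_snd/computable_id.
Qed.

Lemma computable_cat C A {eC : Enc C} {eA : Enc A} (s t : C -> seq A) :
  computable s -> computable t -> computable (fun c => s c ++ t c).
Proof.
move=> Hs Ht; apply: (@computable_ext _ _ _ _ (fun c => foldr cons (t c) (s c))).
  by move=> c; elim: (s c) => //= x l ->.
apply: (@computable_foldr _ _ _ _ _ _ (fun=> cons)) => //.
by apply: computable_cons; [apply: computable_fst|apply: computable_snd];
  exact/computable_snd/computable_id.
Qed.

Lemma computable_flatten C A {eC : Enc C} {eA : Enc A} (s : C -> seq (seq A)) :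
  computable s -> computable (fun c => flatten (s c)).
Proof.
move=> Hs; apply: (@computable_foldr _ _ _ _ _ _ (fun=> cat) (fun=> [::]) s) => //;
  last exact: computable_const.
by apply: computable_cat; [apply: computable_fst|apply: computable_snd];
  exact/computable_snd/computable_id.
Qed.

Lemma computable_andb C {eC : Enc C} (a b : C -> bool) :
  computable a -> computable b -> computable (fun c => a c && b c).
Proof.
by move=> Ha Hb; apply: computable_if => //; apply: computable_const.
Qed.

Lemma computable_negb C {eC : Enc C} (a : C -> bool) :
  computable a -> computable (fun c => ~~ a c).
Proof. by move=> Ha; apply: computable_if => //; apply: computable_const. Qed.

Lemma computable_orb C {eC : Enc C} (a b : C -> bool) :
  computable a -> computable b -> computable (fun c => a c || b c).
Proof. by move=> Ha Hb; apply: computable_if => //; apply: computable_const. Qed.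

Lemma computable_all C A {eC : Enc C} {eA : Enc A} (f : C -> A -> bool) (s : C -> seq A) :
    computable (fun p : C * A => f p.1 p.2) -> computable s ->
  computable (fun c => all (f c) (s c)).
Proof.
move=> Hf Hs.
apply: (@computable_ext _ _ _ _ (fun c => foldr andb true [seq f c x | x <- s c])).
  by move=> c; elim: (s c) => //= x l ->.
apply: (@computable_foldr _ _ _ _ _ _ (fun=> andb) (fun=> true)); last exact: computable_map;
  last exact: computable_const.
by apply: computable_andb; [apply: computable_fst|apply: computable_snd];
  exact/computable_snd/computable_id.
Qed.

Lemma computable_has C A {eC : Enc C} {eA : Enc A} (f : C -> A -> bool) (s : C -> seq A) :
    computable (fun p : C * A => f p.1 p.2) -> computable s ->
  computable (fun c => has (f c) (s c)).
Proof.
move=> Hf Hs.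
apply: (@computable_ext _ _ _ _ (fun c => ~~ all (fun x => ~~ f c x) (s c))).
  by move=> c; rewrite -has_predC; apply/eq_has => x /=; rewrite negbK.
by apply/computable_negb/computable_all => //; apply: computable_negb.
Qed.

Lemma computable_eq C (T : eqType) {eC : Enc C} {eT : Enc T} (f g : C -> T) :
  injective (enc : T -> nat) -> computable f -> computable g ->
  computable (fun c => f c == g c).
Proof.
move=> enc_inj; apply: (@computable_raw2 _ _ _ _ _ _ _ _
  (fun x y => nat_of_bool ((x - y) + (y - x) == 0)) (fun x y => x == y)).
  by apply/rcomp_eq0/rcomp_add; apply: rcomp_sub; apply: rcomp_proj.
move=> x y; rewrite /(enc (_ == _)) /enc_bool addn_eq0 !subn_eq0 -eqn_leq.
by rewrite (inj_eq enc_inj).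
Qed.

Lemma computable_size C A {eC : Enc C} {eA : Enc A} (s : C -> seq A) :
  computable s -> computable (fun c => size (s c)).
Proof.
move=> Hs; apply: (@computable_ext _ _ _ _ (fun c => foldr (fun _ n => n.+1) 0 (s c))).
  by move=> c; elim: (s c) => //= x l ->.
apply: computable_foldr => //; last exact: computable_const.
apply: (@computable_comp _ _ _ _ _ _ succn); last exact/computable_snd/computable_snd/computable_id.
exact: (@computable_raw _ _ _ _ succn succn rcomp_succ).
Qed.

Lemma computable_iota C {eC : Enc C} (n : C -> nat) :
  computable n -> computable (fun c => iota 0 (n c)).
Proof.
move=> Hn.
apply: (@computable_ext _ _ _ _ (fun c => nat_rect (fun=> seq nat) [::] (fun j s => s ++ [:: j])
  (n c))).
  move=> c; elim: (n c) => // j IHj; rewrite -[in RHS]addn1 iotaD /= add0n -IHj //.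
apply: computable_natrec => //; first exact: computable_const.
apply: computable_cat; first exact/computable_snd/computable_snd/computable_id.
apply: computable_cons; last exact: computable_const.
exact/computable_fst/computable_snd/computable_id.
Qed.

(** On a finite type any function is a lookup in the list of its values, a constant of the
    algorithm. *)
Lemma computable_finfun C (T : finType) U {eC : Enc C} {eU : Enc U} (f : T -> U) (g : C -> T) :
  let eT : Enc T := @enc_fin T in
  computable g -> computable (fun c => f (g c)).
Proof.
move=> eT Hg; have [[x0]|noT] := EM (inhabited T); last first.
  exists (RZero 1) => c; by case: noT; exists; exact: g c.
apply: (@computable_ext _ _ _ _ (fun c => nth (f x0) [seq f x | x <- enum T] (enc (g c)))).
  move=> c; have -> : enc (g c) = enum_rank (g c) by [].
  by rewrite (nth_map x0) -?cardE ?ltn_ord // nth_enum_rank.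
by apply: computable_nth; [exact: computable_const | exact: computable_enc].
Qed.

Lemma computable_finfun2 C (T1 T2 : finType) U {eC : Enc C} {eU : Enc U} (f : T1 -> T2 -> U) g1 g2 :
  let eT1 : Enc T1 := @enc_fin T1 in let eT2 : Enc T2 := @enc_fin T2 in
  computable (g1 : C -> T1) -> computable (g2 : C -> T2) ->
  computable (fun c => f (g1 c) (g2 c)).
Proof.
move=> eT1 eT2 H1 H2; have [[x0]|noT] := EM (inhabited T2); last first.
  exists (RZero 1) => c; by case: noT; exists; exact: g2 c.
apply: (@computable_ext _ _ _ _ (fun c => nth (f (g1 c) x0) [seq f (g1 c) x | x <- enum T2] (enc
  (g2 c)))).
  move=> c; have -> : enc (g2 c) = enum_rank (g2 c) by [].
  by rewrite (nth_map x0) -?cardE ?ltn_ord // nth_enum_rank.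
have [[y0]|noT] := EM (inhabited T1); last first.
  exists (RZero 1) => c; by case: noT; exists; exact: g1 c.
apply: (@computable_ext _ _ _ _ (fun c => nth (f y0 x0) [seq f (g1 c) x | x <- enum T2] (enc (g2
  c)))).
  by move=> c; apply: set_nth_default; rewrite size_map -cardE; apply: ltn_ord.
apply: computable_nth; last exact: computable_enc.
exact: (@computable_finfun _ _ _ _ _ (fun y => [seq f y x | x <- enum T2]) g1 H1).
Qed.

Import GRing.Theory Order.TTheory Num.Theory FinRing.Theory.
Local Open Scope ring_scope.

(** * Iterates of commuting additive maps *)

Definition additive_map (U : zmodType) (f : U -> U) := {morph f : x y / x + y}.

Section Addf.
Variable U : zmodType.
Implicit Types f g : U -> U.

Lemma addf0 f : additive_map f -> f 0 = 0.
Proof. by move=> af; apply: (addrI (f 0)); rewrite -af !addr0. Qed.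

Lemma addfN f x : additive_map f -> f (- x) = - f x.
Proof. by move=> af; apply: (addrI (f x)); rewrite -af !subrr addf0. Qed.

Lemma addfB f x y : additive_map f -> f (x - y) = f x - f y.
Proof. by move=> af; rewrite af addfN. Qed.

Lemma addfMn f x m : additive_map f -> f (x *+ m) = f x *+ m.
Proof. by move=> af; elim: m => [|m IHm]; rewrite ?mulr0n ?addf0 // !mulrS af IHm. Qed.

Lemma addf_sum f I (s : seq I) (P : pred I) (F : I -> U) :
  additive_map f -> f (\sum_(i <- s | P i) F i) = \sum_(i <- s | P i) f (F i).
Proof. by move=> af; apply: (big_morph f af (addf0 af)). Qed.

Lemma addf_iter f m : additive_map f -> additive_map (iter m f).
Proof. by move=> af x y; elim: m => //= m ->; rewrite af. Qed.

Lemma addf_comp f g : additive_map f -> additive_map g -> additive_map (f \o g).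
Proof. by move=> af ag x y /=; rewrite ag af. Qed.

Lemma iter_comm f g m x : (forall x, f (g x) = g (f x)) -> iter m f (g x) = g (iter m f x).
Proof. by move=> fg; elim: m => //= m ->. Qed.

Lemma iter_comm2 f g m k x : (forall x, f (g x) = g (f x)) ->
  iter m f (iter k g x) = iter k g (iter m f x).
Proof. by move=> fg; apply: iter_comm => y; rewrite iter_comm. Qed.

Lemma iter_addf f g m x : additive_map f -> additive_map g -> (forall x, f (g x) = g (f x)) ->
  iter m (fun y => f y + g y) x = \sum_(i < m.+1) iter (m - i) f (iter i g x) *+ 'C(m, i).
Proof.
move=> af ag fg; elim: m => [|m IHm]; first by rewrite big_ord1.
rewrite iterS IHm /= (addf_sum (f := f)) // (addf_sum (f := g)) //.
rewrite [X in X + _]big_ord_recl [X in _ + X]big_ord_recr /= !subn0 subnn !bin0 !binn !mulr1n.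
rewrite [RHS]big_ord_recl [X in _ = _ + X]big_ord_recr /= ?subn0 ?subnn ?bin0 ?binn ?mulr1n
  -addrA; congr (_ + _).
rewrite addrA add0n; congr (_ + _); rewrite -big_split; apply: eq_bigr => i _ /=.
have bumpE : bump 0 i = i.+1 by [].
rewrite (addfMn (f := f)) // (addfMn (f := g)) // !bumpE binS subSS mulrnDr.
congr (_ *+ _ + _ *+ _); last by rewrite -iter_comm.
by rewrite -iterS subnSK.
Qed.

Lemma iterMp f k m x : iter k (iter m f) x = iter (k * m) f x.
Proof. by elim: k => //= k ->; rewrite mulSn iterD. Qed.

Lemma eq_iterf f g m x : f =1 g -> iter m f x = iter m g x.
Proof. by move=> fg; elim: m => //= m ->. Qed.

Variables (p : nat) (p_pr : prime p).
Hypothesis pU : forall u : U, u *+ p = 0.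

(** The Frobenius identity for commuting endomorphisms: the inner binomial coefficients are
    multiples of [p], which kills [U]. *)
Lemma frob_addf f g x : additive_map f -> additive_map g -> (forall x, f (g x) = g (f x)) ->
  iter p (fun y => f y + g y) x = iter p f x + iter p g x.
Proof.
move=> af ag fg; rewrite iter_addf //; case: p p_pr pU => // q q_pr qU.
rewrite big_ord_recl big_ord_recr /= ?subn0 ?subnn ?bin0 ?binn ?mulr1n big1 ?add0r // => i _.
have /dvdnP[k ->] : (q.+1 %| 'C(q.+1, bump 0 i))%N.
  by rewrite prime_dvd_bin //= /bump add1n ltnS ltn_ord.
by rewrite mulrnA qU.
Qed.

Lemma frob_sum I (s : seq I) (f : I -> U -> U) x :
    (forall i, additive_map (f i)) -> (forall i j x, f i (f j x) = f j (f i x)) ->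
  iter p (fun y => \sum_(i <- s) f i y) x = \sum_(i <- s) iter p (f i) x.
Proof.
move=> af fC; elim: s => [|i s IHs].
  rewrite big_nil; case: p p_pr => // q _ /=; exact: big_nil.
rewrite big_cons -IHs -frob_addf // => [|y z|y]; last 2 first.
- by rewrite -big_split; apply: eq_bigr => j _; apply: af.
- by rewrite addf_sum //; apply: eq_bigr.
by apply: eq_iterf => y; rewrite big_cons.
Qed.

Lemma frob_sumX t I (s : seq I) (f : I -> U -> U) x :
    (forall i, additive_map (f i)) -> (forall i j x, f i (f j x) = f j (f i x)) ->
  iter (p ^ t) (fun y => \sum_(i <- s) f i y) x = \sum_(i <- s) iter (p ^ t) (f i) x.
Proof.
elim: t f x => [|t IHt] f x af fC //.
rewrite expnSr -iterMp.
under eq_iterf do rewrite frob_sum //.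
rewrite IHt => [||i j y]; last by apply: iter_comm2 => z; apply: fC.
  by apply: eq_bigr => i _; rewrite iterMp.
by move=> i; apply: addf_iter.
Qed.

End Addf.

(** * Configurations on the lattice *)

Section Norm.
Variable d : nat.
Local Notation G := (Zd d).
Implicit Types g h : G.

Definition norm g : nat := (\max_(i < d) `|g ord0 i|)%N.

Lemma normP g r : reflect (forall i, (`|g ord0 i| <= r)%N) (norm g <= r)%N.
Proof.
rewrite /norm; apply: (iffP (bigmax_leqP _ _ _)) => H i; last by move=> _; apply: H.
exact: H.
Qed.

Lemma norm_coord g i : (`|g ord0 i| <= norm g)%N.
Proof. exact/normP. Qed.

Lemma normN g : norm (- g) = norm g.
Proof. by apply: eq_bigr => i _; rewrite mxE abszN. Qed.

Lemma norm0 : norm 0 = 0%N.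
Proof. by apply/eqP; rewrite -leqn0; apply/normP => i; rewrite mxE. Qed.

Lemma norm_eq0 g : norm g = 0%N -> g = 0.
Proof.
move=> g0; apply/rowP => i; rewrite mxE; apply/eqP; rewrite -absz_eq0 -leqn0.
by have := norm_coord g i; rewrite g0.
Qed.

Lemma normD g h : (norm (g + h) <= norm g + norm h)%N.
Proof.
apply/normP => i; rewrite mxE; have := norm_coord g i; have := norm_coord h i;
  move: (g ord0 i) (h ord0 i) (norm g) (norm h) => a b c e; lia.
Qed.

Lemma normB g h : (norm (g - h) <= norm g + norm h)%N.
Proof. by rewrite -(normN h) normD. Qed.

Lemma norm_distl g h : (norm g - norm h <= norm (g - h))%N.
Proof. by rewrite leq_subLR -{1}(subrK h g) addrC normD. Qed.

Lemma norm_distC g h : norm (g - h) = norm (h - g).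
Proof. by rewrite -normN opprB. Qed.

Lemma norm_le_dist g h r : (norm (h - g)%R <= r)%N -> (norm g <= norm h + r)%N.
Proof.
move=> hr; rewrite -leq_subLR; apply: leq_trans (norm_distl g h) _.
by rewrite norm_distC.
Qed.

Lemma normMn g m : (norm (g *+ m) = norm g * m)%N.
Proof.
case: m => [|m]; first by rewrite mulr0n norm0 muln0.
apply/eqP; rewrite eqn_leq; apply/andP; split.
  apply/normP => i; rewrite mulmxnE -mulr_natr natz abszM absz_nat leq_mul2r.
  by rewrite norm_coord orbT.
rewrite -leq_divRL //; apply/normP => i; rewrite leq_divRL //.
by have := norm_coord (g *+ m.+1) i; rewrite mulmxnE -mulr_natr natz abszM absz_nat.
Qed.

(** A finite type in bijection with the ball of radius [r] through [bx]; it serves for cardinals and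
    as an index of sums. *)
Definition box r := {ffun 'I_d -> 'I_(r.*2.+1)}.
Definition bx r (b : box r) : G := \row_i ((b i : nat)%:Z - r%:Z).

Lemma norm_bx r (b : box r) : (norm (bx b) <= r)%N.
Proof. by apply/normP => i; rewrite mxE; have := ltn_ord (b i); lia. Qed.

Lemma bx_inj r : injective (@bx r).
Proof.
move=> b c /rowP bc; apply/ffunP => i; apply: val_inj.
by have := bc i; rewrite !mxE /=; lia.
Qed.

Lemma bx_onto r g : (norm g <= r)%N -> exists b : box r, bx b = g.
Proof.
move=> /normP gr; exists [ffun i => inord `|g ord0 i + r%:Z|].
apply/rowP => i; rewrite -[0]/ord0 mxE ffunE inordK; have := gr i; move: (g ord0 i) => a; lia.
Qed.

Lemma card_box r : (#|{: box r}| = r.*2.+1 ^ d)%N.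
Proof. by rewrite card_ffun !card_ord. Qed.

End Norm.

Section Config.
Variables (d n p : nat).
Local Notation F := 'F_p.
Local Notation W := 'rV[F]_n.
Local Notation G := (Zd d).
Local Notation cfg := (G -> W).
Implicit Types (g h : G) (x y : cfg) (f : cfg -> cfg).

Definition supp r x := forall g, (r < norm g)%N -> x g = 0.
Definition finsupp x := exists r, supp r x.
Definition delta h v : cfg := fun g => if g == h then v else 0.
Definition shift a x : cfg := fun g => x (g - a).
(** Implied by [local] (see [local_spread]); it constrains supports only, which suffices for
    finitely supported configurations. *)
Definition spread r f := forall q x, supp q x -> supp (q + r) (f x).
(* [local r f]: the value of [f x] at [g] depends on [x] in the ball around [g]. *)
Definition local r f := forall x g, (forall h, (norm (h - g)%R <= r)%N -> x h = 0) -> f x g = 0.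
Definition equiv f := forall a x, f (shift a x) = shift a (f x).

Lemma cfgDE x y g : (x + y) g = x g + y g. Proof. by []. Qed.
Lemma cfgNE x g : (- x) g = - x g. Proof. by []. Qed.
Lemma cfgZE (c : F) x g : (c *: x) g = c *: x g. Proof. by []. Qed.
Lemma cfg_sumE I (s : seq I) (P : pred I) (X : I -> cfg) g :
  (\sum_(i <- s | P i) X i) g = \sum_(i <- s | P i) X i g.
Proof. exact: (big_morph (fun x : cfg => x g)). Qed.

Lemma cfgp (p_pr : prime p) x : x *+ p = 0.
Proof. by rewrite -scaler_nat pchar_Fp_0 ?scale0r. Qed.

Lemma addfZ f (c : F) x : additive_map f -> f (c *: x) = c *: f x.
Proof. by move=> af; rewrite -[c]natr_Zp !scaler_nat addfMn. Qed.

Lemma addf_shift a : additive_map (shift a). Proof. by []. Qed.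

Lemma shift0 x : shift 0 x = x. Proof. by apply/funext => g; rewrite /shift subr0. Qed.
Lemma shiftD a b x : shift a (shift b x) = shift (a + b) x.
Proof. by apply/funext => g; rewrite /shift opprD addrA. Qed.
Lemma shift_delta a h v : shift a (delta h v) = delta (h + a) v.
Proof. by apply/funext => g; rewrite /shift /delta subr_eq. Qed.

Lemma supp_le r q x : supp r x -> (r <= q)%N -> supp q x.
Proof. by move=> xr rq g gq; apply: xr; apply: leq_trans gq. Qed.
Lemma suppD r x y : supp r x -> supp r y -> supp r (x + y).
Proof. by move=> xr yr g gr; rewrite cfgDE xr ?yr ?addr0. Qed.
Lemma suppN r x : supp r x -> supp r (- x).
Proof. by move=> xr g gr; rewrite cfgNE xr ?oppr0. Qed.
Lemma suppZ r (c : F) x : supp r x -> supp r (c *: x).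
Proof. by move=> xr g gr; rewrite cfgZE xr ?scaler0. Qed.
Lemma supp_sum r I (s : seq I) (P : pred I) (X : I -> cfg) :
  (forall i, P i -> supp r (X i)) -> supp r (\sum_(i <- s | P i) X i).
Proof.
by move=> H g gr; rewrite cfg_sumE big1 // => i Pi; apply: H.
Qed.
Lemma supp_shift r a x : supp r x -> supp (r + norm a) (shift a x).
Proof.
by move=> xr g gr; apply: xr; have := norm_distl g a; lia.
Qed.
Lemma supp_delta h v : supp (norm h) (delta h v).
Proof. by move=> g; rewrite /delta; case: eqP => // ->; rewrite ltnn. Qed.

Lemma spread_iter r f m : spread r f -> spread (m * r) (iter m f).
Proof.
move=> fr q x xq; elim: m => [|m IHm]; first by rewrite mul0n addn0.
by rewrite mulSn addnCA addnC; apply: fr.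
Qed.

Lemma local_spread r f : local r f -> spread r f.
Proof.
move=> fr q x xq g gq; apply: fr => h hg; apply: xq.
by have := norm_le_dist hg; lia.
Qed.

Lemma local_comp r q f f' : local r f -> local q f' -> local (r + q) (f \o f').
Proof.
move=> fr fq x g H; apply: fr => h hg; apply: fq => k kh; apply: H.
have -> : k - g = (k - h) + (h - g) by rewrite addrA subrK.
by apply: leq_trans (normD _ _) _; rewrite addnC leq_add.
Qed.
Lemma local_iter r f m : local r f -> local (m * r) (iter m f).
Proof.
move=> fr; elim: m => [|m IHm] x g H.
  by apply: H; rewrite subrr norm0.
exact: (local_comp fr IHm).
Qed.
Lemma local_sub r f f' : local r f -> local r f' -> local r (fun x => f x - f' x).
Proof. by move=> H H' x g xg; rewrite cfgDE cfgNE H // H' // subr0. Qed.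
Lemma local_le r q f : local r f -> (r <= q)%N -> local q f.
Proof. by move=> fr rq x g H; apply: fr => h hr; apply: H; apply: leq_trans rq. Qed.

Lemma finsupp_sum x r : supp r x -> x = \sum_(b : box d r) delta (bx b) (x (bx b)).
Proof.
move=> xr; apply/funext => g; rewrite cfg_sumE.
have [/bx_onto[b <-]|gr] := leqP (norm g) r.
  rewrite (bigD1 b) //= big1 ?addr0 => [|c cb]; first by rewrite /delta eqxx.
  by rewrite /delta (inj_eq (@bx_inj d r)) eq_sym (negPf cb).
rewrite xr // big1 // => b _; rewrite /delta; case: eqP => // gb.
by have := norm_bx b; rewrite -gb leqNgt gr.
Qed.

Lemma addf_ext_fin f f' : additive_map f -> additive_map f' ->
  (forall h v, f (delta h v) = f' (delta h v)) -> forall x, finsupp x -> f x = f' x.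
Proof.
move=> af af' ff' x [r xr]; rewrite (finsupp_sum xr) !addf_sum //.
by apply: eq_bigr => b _.
Qed.

(** Additivity alone determines a map on finite supports only. Locality allows [x] to be cut off
    outside a ball around [g] without changing the value at [g]. *)
Lemma addf_ext r f f' : additive_map f -> additive_map f' -> local r f -> local r f' ->
  (forall h v, f (delta h v) = f' (delta h v)) -> f =1 f'.
Proof.
move=> af af' fr fr' ff' x; apply/funext => g.
pose y : cfg := fun h => if (norm (h - g)%R <= r)%N then x h else 0.
have yfin : finsupp y.
  exists (norm g + r)%N => h hr; rewrite /y ifF //; apply/negbTE; apply/negP;
    rewrite norm_distC => /norm_le_dist; lia.
have E q : additive_map q -> local r q -> q x g = q y g.
  move=> aq qr; apply/eqP; rewrite -subr_eq0 -cfgNE -cfgDE -addfB //; apply/eqP.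
  by apply: qr => h hg; rewrite cfgDE cfgNE /y hg subrr.
by rewrite E // (addf_ext_fin af af' ff' yfin) -E.
Qed.

Definition restrict r x : {ffun box d r -> W} := [ffun b => x (bx b)].
Definition extend r (u : {ffun box d r -> W}) : cfg := \sum_b delta (bx b) (u b).

Lemma supp_extend r u : supp r (@extend r u).
Proof. by apply: supp_sum => b _; exact: supp_le (@supp_delta (bx b) (u b)) (norm_bx b). Qed.
Lemma restrictK r x : supp r x -> extend (restrict r x) = x.
Proof. by move=> xr; rewrite [RHS](finsupp_sum xr); apply: eq_bigr => b _; rewrite ffunE. Qed.
Lemma restrict_inj r x y : supp r x -> supp r y -> restrict r x = restrict r y -> x = y.
Proof. by move=> xr yr E; rewrite -(restrictK xr) E restrictK. Qed.
Lemma restrictB r x y : restrict r (x - y) = restrict r x - restrict r y.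
Proof. by apply/ffunP => b; rewrite !ffunE. Qed.

End Config.

(** * Uniform linear operators *)

Lemma not_inj_card (T U : finType) (f : T -> U) : (#|U| < #|T|)%N ->
  exists t1 t2, t1 != t2 /\ f t1 = f t2.
Proof.
move=> cTU; apply: contrapT => H.
have inj_f : injective f.
  by move=> s t E; apply/eqP/negPn/negP => st; apply: H; exists s, t.
by have := leq_card f inj_f; rewrite leqNgt cTU.
Qed.

Lemma leq_expl a b m : (a <= b)%N -> (a ^ m <= b ^ m)%N.
Proof. by move=> ab; elim: m => // m IHm; rewrite !expnS leq_mul. Qed.

(** Distinct multiples of [m] are at distance at least [m], so the balls of radius [q] around them
    are disjoint. *)
Lemma bx_sep d L (b b' : box d L) m q (h : Zd d) : b != b' -> (q.*2 < m)%N -> (norm h <= q)%N ->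
  (q < norm (bx b *+ m + h - bx b' *+ m))%N.
Proof.
move=> bb' qm hq; rewrite addrAC -mulrnBl; apply: contraNltn bb' => le_q.
have m0 : (0 < m)%N by apply: leq_ltn_trans qm.
have : (norm (bx b - bx b') * m < m)%N.
  rewrite -normMn; apply: leq_ltn_trans qm; rewrite -addnn.
  rewrite -[X in norm X](addrK h); apply: leq_trans (normB _ _) _.
  by rewrite leq_add.
rewrite -{2}[m]mul1n ltn_pmul2r // ltnS leqn0 => /eqP/norm_eq0/eqP.
by rewrite subr_eq0 (inj_eq (@bx_inj d L)).
Qed.

Lemma exists_pow_gt p q (p_pr : prime p) : exists t, (q < p ^ t)%N.
Proof. by exists q; apply: ltn_expl; apply: prime_gt1. Qed.

Section Uniform.
Variables (d n p : nat).
Local Notation F := 'F_p.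
Local Notation W := 'rV[F]_n.
Local Notation G := (Zd d).
Local Notation cfg := (G -> W).
Implicit Types (g h : G) (x y : cfg) (f : cfg -> cfg).
Local Notation N := ((n * 2 ^ d).+1).

Lemma iter_scale_shift (a : F) h f m x : additive_map f -> equiv f ->
  iter m (fun x : cfg => a *: shift h (f x)) x = a ^+ m *: shift (h *+ m) (iter m f x).
Proof.
move=> af fe; elim: m => [|m IHm]; first by rewrite mulr0n shift0 scale1r.
by rewrite iterS IHm addfZ // fe mulrS -shiftD exprS -scalerA.
Qed.

Lemma comm_terms (a a' : F) b b' f f' x : additive_map f -> equiv f -> additive_map f' ->
  equiv f' ->
    (forall y, f (f' y) = f' (f y)) ->
  a *: shift b (f (a' *: shift b' (f' x))) = a' *: shift b' (f' (a *: shift b (f x))).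
Proof.
move=> af fe af' fe' ff'; rewrite (addfZ _ _ af) (addfZ _ _ af') fe fe' ff'.
apply/funext => g; rewrite !cfgZE /shift !cfgZE !scalerA [a' * _]mulrC.
by rewrite addrAC.
Qed.

Section Combination.
Variables (L : nat) (c : box d L -> F).
Definition comb x : cfg := \sum_b c b *: shift (bx b) x.

Lemma comb_term_addf b : additive_map (fun x : cfg => c b *: shift (bx b) x).
Proof. by move=> x y; rewrite addf_shift scalerDr. Qed.

Lemma addf_comb : additive_map comb.
Proof. by move=> x y; rewrite -big_split; apply: eq_bigr => b _; apply: comb_term_addf. Qed.

Lemma comb_spread : spread L comb.
Proof.
move=> q x xq; apply: supp_sum => b _; apply: suppZ; apply: supp_le (supp_shift xq) _.
by rewrite leq_add2l norm_bx.
Qed.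

End Combination.

Hypothesis p_pr : prime p.

(** All terms live in the ball of radius [2 L], at most [2 ^ d] times as large as that of radius
    [L]. The coefficients, [N] per translation, therefore outnumber the [n] coordinates per site of
    the large ball, because [N > n * 2 ^ d]. Two families of coefficients with the same image are
    subtracted. *)
Lemma translate_relation f r q x : spread r f -> supp q x ->
  exists c : box d (q + N * r) * 'I_N -> F, (exists t, c t != 0) /\
    \sum_t c t *: shift (bx t.1) (iter t.2 f x) = 0.
Proof.
move=> fr xq; set L := (q + N * r)%N.
pose Phi (c : {ffun box d L * 'I_N -> F}) : cfg := \sum_t c t *: shift (bx t.1) (iter t.2 f x).
have PhiB c c' : Phi (c - c') = Phi c - Phi c'.
  rewrite /Phi -sumrB; apply: eq_bigr => t _; by rewrite !ffunE scalerBl.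
have Phi_supp c : supp (L + L) (Phi c).
  apply: supp_sum => t _; apply: suppZ; apply: (supp_le (supp_shift (spread_iter fr xq))).
  by rewrite leq_add ?norm_bx // leq_add2l leq_mul2r ltnW ?orbT // ltnW.
have [c [c' [cc' E]]] : exists c c',
  c != c' /\ restrict (L + L) (Phi c) = restrict (L + L) (Phi c').
  apply: not_inj_card; rewrite !card_ffun card_prod card_mx !card_Fp // [#|'I_N|]card_ord !card_box.
  rewrite -expnM ltn_exp2l ?prime_gt1 // mul1n !card_ord.
  have le1 : ((L + L).*2.+1 ^ d <= 2 ^ d * L.*2.+1 ^ d)%N.
    by rewrite -expnMn; apply: leq_expl; lia.
  apply: leq_ltn_trans (leq_mul (leqnn n) le1) _.
  by rewrite mulnA [X in (_ < X)%N]mulnC ltn_mul2r ltnSn expn_gt0.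
exists (c - c'); split.
  apply: contrapT => H; case/eqP: cc'; apply/ffunP => t.
  apply/eqP; rewrite -subr_eq0; apply/negPn/negP => ct; apply: H; exists t.
  by rewrite !ffunE.
rewrite -[LHS]/(Phi (c - c')) PhiB (restrict_inj (Phi_supp c) (Phi_supp c') E).
exact: subrr.
Qed.

Lemma Fp_pow (a : F) t : a ^+ (p ^ t) = a.
Proof.
elim: t => [|t IHt]; first by rewrite expr1.
by rewrite expnS exprM -[X in a ^+ X](card_Fp p_pr) expf_card IHt.
Qed.

(** Shifts and powers of [f] commute, so the power [p ^ t] acts term by term, and it fixes the
    scalars by [Fp_pow]. *)
Lemma frob_comb I (s : seq I) (a : I -> F) (h : I -> G) (k : I -> nat) f t x :
    additive_map f -> equiv f ->
  iter (p ^ t) (fun x : cfg => \sum_(i <- s) a i *: shift (h i) (iter (k i) f x)) x =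
  \sum_(i <- s) a i *: shift (h i *+ p ^ t) (iter (p ^ t * k i) f x).
Proof.
move=> af fe; have ke m b y : iter m f (shift b y) = shift b (iter m f y).
  by apply: iter_comm => w; rewrite fe.
rewrite (frob_sumX p_pr (cfgp p_pr)) => [|i|i j y]; last 2 first.
- move=> y z; rewrite (addf_iter _ af) -scalerDr; congr (_ *: _).
- apply: comm_terms; try exact: addf_iter; try by move=> b w; apply: ke.
  by move=> w; apply: iter_comm2.
apply: eq_bigr => i _; rewrite (iter_scale_shift _ _ _ _ (addf_iter _ af)) ?Fp_pow ?iterMp //.
Qed.

Section CombinationFrobenius.
Variables (L : nat) (c : box d L -> F).
Lemma comb_frob t x : iter (p ^ t) (comb c) x = \sum_b c b *: shift (bx b *+ p ^ t) x.
Proof.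
rewrite -[LHS]/(iter _ (fun x => \sum_b c b *: shift (bx b) (iter 0 id x)) x) frob_comb //.
by apply: eq_bigr => b _; congr (_ *: shift _ _); elim: (_ * _)%N.
Qed.

(* The translates of [y] by [p ^ t] times the points of the box are disjoint for large [t]. *)
Lemma comb_frob_at t b h q y : supp q y -> (q.*2 < p ^ t)%N -> (norm h <= q)%N ->
  iter (p ^ t) (comb c) y (bx b *+ p ^ t + h) = c b *: y h.
Proof.
move=> yq qt hq; rewrite comb_frob cfg_sumE (bigD1 b) //= big1 ?addr0 => [|b' bb'].
  by rewrite cfgZE /shift addrAC subrr add0r.
rewrite cfgZE /shift yq ?scaler0 //; apply: bx_sep => //; by rewrite eq_sym.
Qed.

Hypothesis c_neq0 : exists b, c b != 0.

(** Finitely supported configurations have no torsion over Laurent polynomials: a high Frobenius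
    power of [comb c] shows a separate copy of [c b *: y] for each [b]. *)
Lemma comb_eq0 y : finsupp y -> (comb c) y = 0 -> y = 0.
Proof.
move=> [q yq] y0; have [t qt] := exists_pow_gt q.*2 p_pr; have [b cb] := c_neq0.
apply/funext => h; have [hq|hq] := leqP (norm h) q; last exact: yq.
have := comb_frob_at b yq qt hq.
have -> : iter (p ^ t) (comb c) y = 0.
  have : (0 < p ^ t)%N by apply: leq_ltn_trans qt.
  case: (p ^ t)%N => // m _; rewrite iterSr y0 addf0 //.
  exact: addf_iter (addf_comb c).
by move=> /esym/eqP; rewrite scaler_eq0 (negPf cb) => /eqP.
Qed.

(* In each coordinate, the largest one of a point of [c] times [p ^ t] plus that of a
   point of [y] is reached in the support of [(comb c) ^ (p ^ t) y = (comb c) ^ (p ^ t - 1) z]. *)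
Lemma comb_supp_inv z q y : finsupp y -> (comb c) y = z -> supp q z -> supp (q + L) y.
Proof.
move=> [r yr] cyz zq h0 gth0; apply: contrapT => /eqP yh0.
have [i gti] : exists i, (q + L < `|h0 ord0 i|)%N.
  apply: contrapT => H; move: gth0; rewrite ltnNge; apply/negP/negPn/normP => i.
  by rewrite leqNgt; apply/negP => ?; apply: H; exists i.
(* The [i]-th coordinate, with the sign that makes it positive at [h0], so that only maxima have to
   be followed. *)
pose sg g : int := (if 0 <= h0 ord0 i then g ord0 i else - g ord0 i).
have sgD g g' : sg (g + g') = sg g + sg g' by rewrite /sg mxE; case: ifP => _; rewrite ?opprD.
have sgMn g m : sg (g *+ m) = sg g * m%:Z.
  by rewrite /sg mulmxnE -[_ *+ m]mulr_natr natz; case: ifP => _; rewrite ?mulNr.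
have sg_norm g : `|sg g| <= (norm g)%:Z.
  by have := norm_coord g i; rewrite /sg; move: (g ord0 i) (norm g) => a m; case: ifP; lia.
have [b0 cb0] := c_neq0.
case: (@Order.TotalTheory.arg_maxP _ int _ b0 (fun b => c b != 0) (fun b => sg (bx b)) cb0) => b
  cb maxb.
have Hm m g : iter m (comb c) z g != 0 -> sg g <= m%:Z * sg (bx b) + q%:Z.
  elim: m g => [|m IHm] g /=.
    move=> zg; have gq : (norm g <= q)%N by rewrite leqNgt; apply: contra_neqN zg => /zq.
    by have := sg_norm g; rewrite mul0r add0r; lia.
  rewrite {1}/comb cfg_sumE => H.
  have [b' cb'] : exists b', c b' *: shift (bx b') (iter m (comb c) z) g != 0.
    apply: contrapT => H'; move/eqP: H; apply; rewrite big1 // => b' _.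
    by apply/eqP/negPn/negP => ?; apply: H'; exists b'.
  have cb0' : c b' != 0 by apply: contra_neq cb' => ->; rewrite scale0r.
  have : shift (bx b') (iter m (comb c) z) g != 0 by apply: contra_neq cb' => ->; rewrite scaler0.
  move/IHm => E; have := maxb b' cb0'; rewrite -[g](subrK (bx b')) sgD.
  move: E; rewrite /= intS mulrDl mul1r.
  by move: (sg _) (sg _) (sg _) (_ * _) => u1 u2 u3 u4; lia.
have [t qt] := exists_pow_gt r.*2 p_pr.
have h0r : (norm h0 <= r)%N by rewrite leqNgt; apply/negP => /yr y0; rewrite y0 eqxx in yh0.
have := comb_frob_at b yr qt h0r.
case: (p ^ t)%N qt => // m _; rewrite iterSr cyz => E.
have /Hm : iter m (comb c) z (bx b *+ m.+1 + h0) != 0.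
  by rewrite E scaler_eq0 negb_or cb.
(* The bound reads [m.+1 * sg (bx b) + sg h0 <= m * sg (bx b) + q], hence [sg h0 <= q + L], against
   the choice of [i]. *)
rewrite sgD sgMn intS mulrDr mulr1 [sg _ * _]mulrC.
have := sg_norm (bx b); have := norm_bx b.
have : sg h0 = `|h0 ord0 i| by rewrite /sg; case: ifP; move: (h0 ord0 i) => a; lia.
move: (m%:Z * sg (bx b)) (sg h0) (sg (bx b)) (norm (bx b)) gti => u1 u v w.
by move: (h0 ord0 i) => a; lia.
Qed.
End CombinationFrobenius.

(* Let [i] be the least exponent in a relation from [translate_relation] and apply [f ^ (m - i)] to it. *)
Lemma iter_eq0_step f r x m : additive_map f -> spread r f -> equiv f -> finsupp x ->
  iter m.+1 f x = 0 -> (N <= m.+1)%N -> iter m f x = 0.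
Proof.
move=> af fr fe [q xq] fm1 Nm; have [c [[t0 ct0] E]] := translate_relation fr xq.
case: (@arg_minnP _ t0 (fun t => c t != 0) (fun t => t.2 : nat) ct0) => -[b i] /= cbi mini.
have im : (i <= m)%N by rewrite -ltnS; apply: leq_trans (ltn_ord i) Nm.
apply: (@comb_eq0 _ (fun b => c (b, i))); first by exists b.
  by exists (q + m * r)%N; apply: spread_iter.
have := congr1 (iter (m - i) f) E.
have af' := addf_iter (m - i) af; rewrite addf_sum // (addf0 af') => <-.
rewrite /comb (eq_bigr (fun t => c (t.1, t.2) *: shift (bx t.1) (iter (m - i + t.2) f x)));
  last first.
  move=> -[b' j] _ /=; rewrite addfZ // iterD; congr (_ *: _).
  by elim: (m - i)%N => //= k ->; rewrite fe.
rewrite -(pair_bigA _ (fun b j => c (b, j) *: shift (bx b) (iter (m - i + j) f x))) /=.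
apply: eq_bigr => b' _; rewrite (bigD1 i) //= subnK // big1 ?addr0 // => j ji.
have [->|cj] := eqVneq (c (b', j)) 0; first by rewrite scale0r.
have ij : (i < j)%N by rewrite ltn_neqAle eq_sym ji; apply: (mini (b', j)).
have -> : (m - i + j = (j - i).-1 + m.+1)%N by lia.
by rewrite iterD fm1 addf0 ?scaler0 //; apply: addf_iter.
Qed.

(** The exponent [N] depends on neither [f], nor its radius, nor the support of [x]; this is what
    makes the final period explicit. *)
Lemma iter_eq0_bound f r x m : additive_map f -> spread r f -> equiv f -> finsupp x ->
  iter m f x = 0 -> iter N f x = 0.
Proof.
move=> af fr fe xf; elim: m => [/= x0|m IHm fm1]; first by rewrite x0;
  apply: (addf0 (addf_iter N af)).
have [mN|Nm] := ltnP m N; last exact: IHm (iter_eq0_step af fr fe xf fm1 (leqW Nm)).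
by rewrite -(subnK mN) iterD fm1; apply: (addf0 (addf_iter _ af)).
Qed.

(** In the relation for [delta 0 v = f y], cancelling [f ^ (i + 1)], with [i] the least exponent,
    expresses a combination of translates of [y] by iterates of [delta 0 v], supported within
    [2 N r]. Undoing the combination costs another [N r], whence the factor 3. *)
Lemma inverse_bound f r y v : additive_map f -> spread r f -> equiv f ->
    (forall z, finsupp z -> f z = 0 -> z = 0) ->
  finsupp y -> f y = delta 0 v -> supp (3 * (N * r)) y.
Proof.
move=> af fr fe finj yfin fy;
  have [c [[t0 ct0] E]] := translate_relation fr (@supp_delta d n p 0 v).
move: c t0 ct0 E; rewrite norm0 add0n => c t0 ct0 E.
case: (@arg_minnP _ t0 (fun t => c t != 0) (fun t => t.2 : nat) ct0) => -[b i] /= cbi mini.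
pose z : cfg := - \sum_(t :
  box d (N * r) * 'I_N) (if (i < t.2)%N then c t *: shift (bx t.1) (iter (t.2 - i.+1) f (delta 0
    v)) else 0).
have zs : supp (2 * (N * r)) z.
  apply: suppN; apply: supp_sum => t _; case: ifP => // _; apply: suppZ.
  apply: supp_le (supp_shift (spread_iter fr (@supp_delta d n p 0 v))) _.
  rewrite norm0 mul2n -addnn leq_add ?norm_bx // leq_mul2r.
  by apply/orP; right; apply: leq_trans (leq_subr _ _) _; apply: ltnW.
have -> : (3 * (N * r) = 2 * (N * r) + N * r)%N by rewrite -mulSnr.
apply: (@comb_supp_inv _ (fun b => c (b, i)) _ z) => //; first by exists b.
apply/eqP; rewrite -subr_eq0; apply/eqP.
have comb_fin : finsupp (comb (fun b => c (b, i)) y).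
  by have [q yq] := yfin; exists (q + N * r)%N; apply: comb_spread.
(* [f ^ i] is injective, so it can be cancelled in the relation *)
have inj_iter m x : finsupp x -> iter m f x = 0 -> x = 0.
  elim: m => // m IHm xfin fx; apply: IHm => //; apply: finj => //.
  by have [q xq] := xfin; exists (q + m * r)%N; apply: spread_iter.
apply: (inj_iter i.+1).
  have [q yq] := comb_fin; exists (maxn q (2 * (N * r))).
  by apply: suppD; [apply: supp_le yq (leq_maxl _ _) | apply: suppN;
    apply: supp_le zs (leq_maxr _ _)].
have af' := addf_iter i.+1 af; rewrite (addfB _ _ af') -[RHS]E /z (addfN _ af') opprK.
have -> : iter i.+1 f (comb (fun b => c (b, i)) y) =
    \sum_(b : box d (N * r)) c (b, i) *: shift (bx b) (iter i f (delta 0 v)).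
  rewrite addf_sum //; apply: eq_bigr => b' _; rewrite addfZ // iterSr fe fy; congr (_ *: _).
  by elim: (i : nat) => //= k ->; rewrite fe.
rewrite (addf_sum _ _ _ af').
pose R b j := c (b, j) *: shift (bx b) (iter j f (delta 0 v)).
pose Q b (j : 'I_N) := iter i.+1 f (if (i < j)%N
  then c (b, j) *: shift (bx b) (iter (j - i.+1) f (delta 0 v)) else 0).
have -> : \sum_t c t *: shift (bx t.1) (iter t.2 f (delta 0 v)) = \sum_b \sum_j R b j.
  by rewrite pair_bigA; apply: eq_bigr => -[].
rewrite [X in _ + X = _](_ : _ = \sum_b \sum_j Q b j); last first.
  by rewrite pair_bigA; apply: eq_bigr => -[].
rewrite -big_split /R /Q.
apply: eq_bigr => b' _; rewrite [in LHS](bigD1 i) // [in RHS](bigD1 i) // ltnn.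
rewrite (addf0 af') -[LHS]/(_ + (_ + _)) -[RHS]/(_ + _) add0r; congr (_ + _);
  apply: eq_bigr => j ji; case: ltnP => ij.
  rewrite (addfZ _ _ af'); congr (_ *: _); rewrite -[in RHS](subnKC ij) iterD.
  by apply: iter_comm => w; rewrite fe.
rewrite (addf0 af'); have [->|cj] := eqVneq (c (b', j)) 0; first by rewrite scale0r.
by have := mini (b', j) cj; rewrite /= => ij'; case/eqP: ji; apply/val_inj/eqP;
  rewrite eqn_leq ij ij'.
Qed.

End Uniform.

(** * Eventually periodic uniform operators *)

Lemma iter_period (T : Type) (f : T -> T) x i e a k :
  iter (i + e) f x = iter i f x -> (i <= a)%N -> iter (a + k * e) f x = iter a f x.
Proof.
move=> E ia; elim: k => [|k IHk]; first by rewrite addn0.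
rewrite mulSn (_ : a + (e + k * e) = (k * e + (a - i)) + (i + e))%N; last by lia.
by rewrite iterD E -iterD -IHk; congr (iter _ _ _); lia.
Qed.

(** [m!] is a multiple of the period [j - i] and at least the preperiod [i], whichever [i] and [j]
    below the bound occur. *)
Lemma orbit_fact (T : Type) (f : T -> T) x i j m :
  iter i f x = iter j f x -> (i < j <= m)%N -> iter (2 * m`!) f x = iter m`! f x.
Proof.
move=> E /andP[ij jm]; have /dvdnP[k mk] : (j - i %| m`!)%N.
  by rewrite dvdn_fact // subn_gt0 ij; apply: leq_trans jm; apply: leq_subr.
rewrite mul2n -addnn {2}mk; apply: (@iter_period _ _ _ i); first by rewrite subnKC // ltnW.
by apply: leq_trans (fact_geq _); apply: leq_trans jm; apply: ltnW.
Qed.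

Section Bound.
Variables (d n p : nat).
Local Notation F := 'F_p.
Local Notation W := 'rV[F]_n.
Local Notation G := (Zd d).
Local Notation cfg := (G -> W).
Implicit Types (g h : G) (x y : cfg) (f : cfg -> cfg).
Local Notation N := ((n * 2 ^ d).+1).

Lemma delta_ext r m k f : additive_map f -> local r f -> equiv f ->
  (forall v, iter m f (delta 0 v) = iter k f (delta 0 v)) -> iter m f =1 iter k f.
Proof.
move=> af fr fe E; apply: (addf_ext (r := ((m + k) * r)%N)); try exact: addf_iter.
- by apply: (local_le (local_iter (m := m) fr)); rewrite leq_mul2r leq_addr orbT.
- by apply: (local_le (local_iter (m := k) fr)); rewrite leq_mul2r leq_addl orbT.
have ke l b y : iter l f (shift b y) = shift b (iter l f y).
  by apply: iter_comm => w; rewrite fe.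
by move=> h v; rewrite -[h]add0r -shift_delta !ke E.
Qed.

Hypothesis p_pr : prime p.

(** Here the coefficients are scalars, without translations: the whole orbit lies in the span of its
    first [m] terms, which has at most [p ^ m] elements. *)
Lemma orbit_bound m f x (a : 'I_m -> F) : additive_map f -> (exists i, a i != 0) ->
    \sum_i a i *: iter i f x = 0 ->
  exists i j, (i < j <= p ^ m)%N /\ iter i f x = iter j f x.
Proof.
move=> af [i0 ai0] E.
pose S y := exists c : {ffun 'I_m -> F}, y = \sum_i c i *: iter i f x.
have S_sum (I : finType) (b : I -> F) (y : I -> cfg) : (forall i, S (y i)) -> S (\sum_i b i *: y i).
  move=> /fin_all_exists[C HC]; exists [ffun k => \sum_i b i * C i k].
  under [RHS]eq_bigr do rewrite ffunE scaler_suml.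
  rewrite exchange_big; apply: eq_bigr => i _; rewrite HC scaler_sumr.
  by apply: eq_bigr => k _; rewrite scalerA.
have S_iter (i : 'I_m) : S (iter i f x).
  exists [ffun k => (k == i)%:R]; rewrite (bigD1 i) //= ffunE eqxx scale1r big1 ?addr0 // => k ki.
  by rewrite ffunE (negPf ki) scale0r.
(* Solving for the largest exponent [D] with a nonzero coefficient and applying [f ^ (m - D)] turns
   [f ^ m x] into a combination of lower powers; the tests [i < D] drop terms with coefficient 0. *)
case: (@arg_maxnP _ i0 (fun i => a i != 0) (fun i => i : nat) ai0) => D aD maxD.
have S_m : S (iter m f x).
  have -> : iter m f x = \sum_(i < m) (if (i < D)%N then - (a D)^-1 * a i else 0) *:
      (if (i < D)%N then iter (m - D + i) f x else 0).
    have := congr1 (iter (m - D) f) E;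
      rewrite (addf_sum _ _ _ (addf_iter _ af)) (addf0 (addf_iter _ af)).
    rewrite (bigD1 D) //= addfZ; last exact: addf_iter.
    rewrite -iterD subnK; last exact: ltnW.
    move=> /eqP; rewrite addr_eq0 => /eqP/(congr1 (fun y => (a D)^-1 *: y)).
    rewrite scalerA mulVf // scale1r => ->.
    rewrite scalerN scaler_sumr -sumrN [RHS](bigD1 D) //= ltnn scaler0 add0r.
    apply: eq_bigr => i iD; rewrite addfZ; last exact: addf_iter.
    case: ltnP => [_|Di]; first by rewrite -iterD scalerA mulNr scaleNr.
    have [->|ai] := eqVneq (a i) 0; first by rewrite !scale0r scaler0 oppr0.
    have iD' : (i <= D)%N := maxD i ai.
    by case/eqP: iD; apply/val_inj/eqP; rewrite /= eqn_leq iD' Di.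
  apply: S_sum => i; case: ltnP => iD; last first.
    by exists 0; rewrite big1 // => k _; rewrite ffunE scale0r.
  have lt : (m - D + i < m)%N by have := ltn_ord D; lia.
  exact: (S_iter (Ordinal lt)).
have S_all k : S (iter k f x).
  have [l] := ubnP k; elim: l k => // l IHl k; rewrite ltnS => kl.
  have [km|mk] := ltnP k m; first exact: (S_iter (Ordinal km)).
  rewrite -(subnK mk) iterD; have [c ->] := S_m.
  rewrite (addf_sum _ _ _ (addf_iter _ af)).
  under eq_bigr do rewrite (addfZ _ _ (addf_iter _ af)) -iterD.
  by apply: S_sum => i; apply: IHl; have := ltn_ord i; lia.
have /fin_all_exists[C HC] (k : 'I_(p ^ m).+1) := S_all k.
have [i [j [ij Cij]]] : exists i j, i != j /\ C i = C j.
  apply: (@not_inj_card 'I_(p ^ m).+1 {ffun 'I_m -> F} C).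
  by rewrite card_ffun card_Fp // !card_ord.
have E' : iter i f x = iter j f x by rewrite HC Cij -HC.
have := ltn_ord i; have := ltn_ord j; rewrite !ltnS => jm im.
move: ij; rewrite neq_ltn => /orP[ij|ji]; first by exists i, j; rewrite ij jm.
by exists j, i; rewrite ji im.
Qed.

(** The factorial is a common period for the orbits of [orbit_bound] with [m = N]; the factor
    [p ^ N] is a Frobenius power exceeding the nilpotency order [N]. *)
Definition per_const := (p ^ N * (p ^ N)`!)%N.

Lemma per_const_gt0 : (0 < per_const)%N.
Proof. by rewrite muln_gt0 fact_gt0 expn_gt0 prime_gt0. Qed.

Section Periodic.
Variables (f : cfg -> cfg) (r : nat).
Hypotheses (af : additive_map f) (fr : local r f) (fe : equiv f).
Variables (i j : nat).
Hypotheses (ij : (i < j)%N) (fij : iter i f =1 iter j f).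

Lemma iter_bounded m q x : supp q x -> supp (q + j * r) (iter m f x).
Proof.
move=> xq; have [l] := ubnP m; elim: l m => // l IHl m; rewrite ltnS => ml.
have [mj|jm] := ltnP m j.
  apply: supp_le (spread_iter (local_spread fr) xq) _.
  by rewrite leq_add2l leq_mul2r ltnW ?orbT.
by rewrite -(subnK jm) iterD -fij -iterD; apply: IHl; lia.
Qed.

(** The iterates have uniformly bounded supports, so in a large Frobenius power of the relation the
    translates separate, and a scalar relation remains between powers of [f ^ (p ^ t)]. The unknown
    [j] enters only through [t], not through [(p ^ N)!]. *)
Lemma pow_orbit t v : ((j * r).*2 < p ^ t)%N ->
  iter (p ^ t * (2 * (p ^ N)`!)) f (delta 0 v) = iter (p ^ t * (p ^ N)`!) f (delta 0 v).
Proof.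
move=> tj; have s0 : supp 0 (@delta d n p 0 v) by move=> g g0; apply: supp_delta; rewrite norm0.
have [c [[t0 ct0] E]] := translate_relation p_pr (local_spread fr) s0.
have := frob_comb p_pr (index_enum _) c (fun t => bx t.1) (fun t => t.2 : nat) t (delta 0 v) af fe.
have -> : iter (p ^ t) (fun x : cfg => \sum_u c u *: shift (bx u.1) (iter u.2 f x)) (delta 0 v) = 0.
  have : (0 < p ^ t)%N by apply: leq_ltn_trans tj.
  case: (p ^ t)%N => // m _; rewrite iterSr E; apply: (addf0 (addf_iter m _)) => y z.
  rewrite -big_split; apply: eq_bigr => u _.
  by rewrite (addf_iter _ af); apply: scalerDr.
move=> /esym E0; rewrite ![(p ^ t * _)%N]mulnC -!iterMp.
have [|||k [l [kl E1]]] := @orbit_bound N (iter (p ^ t) f) (delta 0 v) (fun k => c (t0.1, k)).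
- exact: addf_iter.
- by exists t0.2; rewrite -surjective_pairing.
(* Around [p ^ t] times the point [bx t0.1], only the terms with that translation contribute. *)
- apply/funext => h; have [hj|hj] := leqP (norm h) (j * r); last first.
    apply: (supp_sum (r := (j * r)%N)) => // k _; apply: suppZ; rewrite iterMp.
    by have := iter_bounded (k * p ^ t)%N s0; rewrite add0n.
  have := congr1 (fun x : cfg => x (bx t0.1 *+ p ^ t + h)) E0.
  rewrite (eq_bigr (fun u => c (u.1,
    u.2) *: shift (bx u.1 *+ p ^ t) (iter (p ^ t * u.2) f (delta 0 v)))); last by case.
  rewrite -(pair_bigA _ (fun b (k :
    'I_N) => c (b, k) *: shift (bx b *+ p ^ t) (iter (p ^ t * k) f (delta 0 v)))) /=.
  rewrite (bigD1 t0.1) //= cfgDE [X in _ + X]cfg_sumE [X in _ + X]big1 ?addr0.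
    rewrite cfg_sumE => E2; rewrite cfg_sumE; apply: etrans E2; apply: eq_bigr => k _;
      rewrite !cfgZE /shift addrAC subrr add0r iterMp.
    by rewrite [(k * _)%N]mulnC.
  move=> b bt; rewrite cfg_sumE big1 // => k _; rewrite cfgZE /shift.
  rewrite (iter_bounded _ s0) ?scaler0 // add0n.
  by apply: bx_sep => //; rewrite eq_sym.
by rewrite iterMp; apply: orbit_fact E1 kl.
Qed.

(* [D = iter (2 M) f - iter M f] with [M = (p ^ N)!] is nilpotent, so [iter N D = 0], and raising it
   to the power [p ^ N] gives [iter (p ^ N * 2 M) f = iter (p ^ N * M) f]. *)
Theorem per_bound : iter (2 * per_const) f =1 iter per_const f.
Proof.
pose M := (p ^ N)`!; pose C x := iter (2 * M)%N f x - iter M f x.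
have ke l b y : iter l f (shift b y) = shift b (iter l f y).
  by apply: iter_comm => w; rewrite fe.
have iterC t x : iter (p ^ t) C x = iter (p ^ t * (2 * M)) f x - iter (p ^ t * M) f x.
  have := frob_comb p_pr (index_enum _) (fun b : bool => if b then 1 else -1) (fun=> 0)
    (fun b : bool => if b then 2 * M else M)%N t x af fe.
  rewrite big_bool /= mul0rn shift0 shift0 scale1r scaleN1r => <-.
  by apply: eq_iterf => y; rewrite big_bool /= !shift0 scale1r scaleN1r.
have aC : additive_map C by move=> x y; rewrite /C !(addf_iter _ af) opprD addrACA.
have lC : local (2 * M * r)%N C.
  apply: local_sub; first exact: local_iter.
  by apply: (local_le (local_iter (m := M) fr)); rewrite leq_mul2r leq_pmull ?orbT.
have eC : equiv C by move=> b x; rewrite /C !ke.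
(* Frobenius and [pow_orbit] give [C ^ (p ^ t) = 0] on [delta 0 v], with [t] depending on [j];
   [iter_eq0_bound] lowers this exponent to [N]. *)
have C0 v : iter N C (delta 0 v) = 0.
  have [t tj] := exists_pow_gt (j * r).*2 p_pr.
  apply: (iter_eq0_bound p_pr (m := (p ^ t)%N) aC (local_spread lC) eC); first by eexists;
    apply: supp_delta.
  by rewrite iterC pow_orbit // subrr.
apply: (delta_ext af fr fe) => v; apply/eqP; rewrite -subr_eq0; apply/eqP.
have := iterC N (delta 0 v); rewrite mulnCA => <-.
have /ltnW/subnK <- : (N < p ^ N)%N by apply: ltn_expl; apply: prime_gt1.
by rewrite iterD C0; apply: (addf0 (addf_iter _ aC)).
Qed.
End Periodic.
End Bound.

(** * Finite perturbations of uniform operators *)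

Lemma finsuppD d n p (x y : Zd d -> 'rV['F_p]_n) : finsupp x -> finsupp y -> finsupp (x + y).
Proof.
move=> [q xq] [s ys]; exists (maxn q s).
by apply: suppD; [apply: supp_le xq (leq_maxl _ _) | apply: supp_le ys (leq_maxr _ _)].
Qed.

Lemma finsuppN d n p (x : Zd d -> 'rV['F_p]_n) : finsupp x -> finsupp (- x).
Proof. by move=> [q xq]; exists q; apply: suppN. Qed.

Lemma finsuppB d n p (x y : Zd d -> 'rV['F_p]_n) : finsupp x -> finsupp y -> finsupp (x - y).
Proof. by move=> xf yf; apply: finsuppD => //; apply: finsuppN. Qed.

Lemma finsupp_shift d n p a (x : Zd d -> 'rV['F_p]_n) : finsupp x -> finsupp (shift a x).
Proof. by move=> [q xq]; exists (q + norm a)%N; apply: supp_shift. Qed.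

Lemma finsupp_bigsum d n p (I : Type) (s : seq I) (X : I -> Zd d -> 'rV['F_p]_n) :
  (forall i, finsupp (X i)) -> finsupp (\sum_(i <- s) X i).
Proof.
move=> Xf; elim: s => [|i s IHs]; first by rewrite big_nil; exists 0%N.
by rewrite big_cons; apply: finsuppD.
Qed.

Lemma norm_const d m : (0 < d)%N -> norm (const_mx m%:Z : Zd d) = m.
Proof.
move=> d_gt0; apply/eqP; rewrite eqn_leq; apply/andP; split; first by apply/normP => i; rewrite mxE.
by have := norm_coord (const_mx m%:Z : Zd d) (Ordinal d_gt0); rewrite mxE.
Qed.

Lemma idem_pow (U : Type) (f : U -> U) i j : (i < j)%N -> iter i f =1 iter j f ->
  iter (2 * j`!) f =1 iter j`! f.
Proof. by move=> ij E x; apply: (orbit_fact (E x)); rewrite ij leqnn. Qed.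

Lemma finsupp_delta d n p h v : @finsupp d n p (delta h v).
Proof. by exists (norm h); apply: supp_delta. Qed.

Section FiniteSupport.
Variables (d n p : nat).
Local Notation F := 'F_p.
Local Notation W := 'rV[F]_n.
Local Notation G := (Zd d).
Local Notation cfg := (G -> W).
Implicit Types (g h : G) (x y : cfg) (f : cfg -> cfg).

Definition vanish q x := forall g, (norm g <= q)%N -> x g = 0.
Definition surj f := forall u, finsupp u -> exists x, finsupp x /\ f x = u.

Lemma finsupp_spread r f x : spread r f -> finsupp x -> finsupp (f x).
Proof. by move=> fr [q xq]; exists (q + r)%N; apply: fr. Qed.

Lemma iter_equiv f m a x : equiv f -> iter m f (shift a x) = shift a (iter m f x).
Proof. by move=> fe; apply: iter_comm => w; rewrite fe. Qed.

Lemma vanish_delta q h v : (q < norm h)%N -> vanish q (delta h v : cfg).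
Proof.
by move=> qh g gq; rewrite /delta; case: eqP => // gh; move: gq; rewrite gh leqNgt qh.
Qed.

Lemma restrict_extend q (u : {ffun box d q -> W}) : restrict q (extend u) = u.
Proof.
apply/ffunP => b; rewrite ffunE /extend cfg_sumE (bigD1 b) //= {1}/delta eqxx big1 ?addr0 // => b'
  bb'.
by rewrite /delta (inj_eq (@bx_inj d q)) eq_sym (negPf bb').
Qed.

Lemma vanishP q x y : restrict q x = restrict q y -> vanish q (x - y).
Proof.
move=> E g /bx_onto[b <-].
by have := congr1 (fun u : {ffun _} => u b) E; rewrite !ffunE cfgDE cfgNE => ->; rewrite subrr.
Qed.

Lemma supp_finite_orbit x a q : supp q x -> (0 < norm a)%N -> (forall m, shift (a *+ m) x = x) ->
  x = 0.
Proof.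
move=> xq a0 xa; apply/funext => g; rewrite -(xa (q + norm g).+1) /shift xq //.
rewrite norm_distC; apply: leq_trans (norm_distl _ _).
by rewrite normMn ltn_subRL addnC leq_pmull.
Qed.

Lemma image_sum f (I : finType) (X : I -> cfg) : additive_map f ->
    (forall i, exists y, finsupp y /\ f y = X i) ->
  exists y, finsupp y /\ f y = \sum_i X i.
Proof.
move=> af /fin_all_exists[Y HY]; exists (\sum_i Y i); split.
  by apply: finsupp_bigsum => i; have [] := HY i.
by rewrite addf_sum //; apply: eq_bigr => i _; have [] := HY i.
Qed.

End FiniteSupport.

Section ColumnOperator.
Variables (d n p : nat).
Local Notation F := 'F_p.
Local Notation W := 'rV[F]_n.
Local Notation Mx := 'M[F]_n.
Local Notation G := (Zd d).
Local Notation cfg := (G -> W).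

(* The operator sending [delta h v] to the sum of the [delta (h + O_i) (v *m A h i)]. *)
Definition colop (O : seq G) (A : G -> nat -> Mx) (x : cfg) : cfg :=
  fun g => \sum_(i < size O) x (g - O`_i) *m A (g - O`_i) i.

Lemma addf_colop O A : additive_map (colop O A).
Proof.
move=> x y; apply/funext => g; rewrite cfgDE /colop -big_split; apply: eq_bigr => i _.
by rewrite cfgDE mulmxDl.
Qed.

Lemma colop_local O A r : (forall i : 'I_(size O), (norm O`_i <= r)%N) -> local r (colop O A).
Proof.
move=> Or x g xg; rewrite /colop big1 // => i _; rewrite xg ?mul0mx //.
by rewrite addrAC subrr add0r normN.
Qed.

Lemma colop_equiv O c : equiv (colop O (fun _ i => c i)).
Proof.
move=> a x; apply/funext => g; rewrite /shift /colop; apply: eq_bigr => i _.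
by rewrite addrAC.
Qed.

Lemma colop_delta O A h v :
  colop O A (delta h v) = \sum_(i < size O) delta (h + O`_i) (v *m A h i).
Proof.
apply/funext => g; rewrite cfg_sumE /colop; apply: eq_bigr => i _.
by rewrite /delta subr_eq; case: eqP => [->|_]; rewrite ?addrK ?mul0mx.
Qed.

Lemma eq_colop O A B x : (forall h, x h != 0 -> forall i, A h i = B h i) ->
  colop O A x = colop O B x.
Proof.
move=> AB; apply/funext => g; apply: eq_bigr => i _.
have [->|xg] := eqVneq (x (g - O`_i)) 0; first by rewrite !mul0mx.
by rewrite AB.
Qed.
End ColumnOperator.

(** * Comparison of a perturbed operator with its uniform part *)

Section NearUniform.
Variables (d n p : nat).
Local Notation F := 'F_p.
Local Notation W := 'rV[F]_n.
Local Notation G := (Zd d).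
Local Notation cfg := (G -> W).
Implicit Types (g h : G) (x y : cfg) (f : cfg -> cfg).
Local Notation N := ((n * 2 ^ d).+1).

Variables (T Tc : cfg -> cfg) (r : nat).
Hypotheses (aT : additive_map T) (aTc : additive_map Tc) (lT : local r T) (lTc :
  local r Tc) (eTc : equiv Tc).
Hypothesis T_vanish : forall x, vanish r x -> T x = Tc x.

(** The bridge from [T] to [Tc]: once the pigeonhole principle provides two configurations that
    agree on the ball, their difference no longer sees the perturbation. *)
Lemma T_sub x y : restrict r x = restrict r y -> T x - T y = Tc (x - y).
Proof.
move=> E; rewrite -addfB //; apply: T_vanish => g /bx_onto[b <-].
by have := congr1 (fun u : {ffun _} => u b) E; rewrite !ffunE cfgDE cfgNE => ->; rewrite subrr.
Qed.

Lemma vanish_iter q m x : vanish (q + m * r) x -> vanish q (iter m Tc x).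
Proof.
move=> xv g gq; apply: (local_iter lTc) => h hg; apply: xv.
have := norm_le_dist (r := m * r) (g := h) (h := g); rewrite norm_distC => /(_ hg).
by move/leq_trans; apply; rewrite leq_add2r.
Qed.

Lemma iter_far m x : vanish (r + m * r) x -> iter m T x = iter m Tc x.
Proof.
move=> xv; elim: m xv => // m IHm xv; rewrite !iterS IHm.
  by apply: T_vanish; apply: vanish_iter => g gr; apply: xv; apply: leq_trans gr _;
    rewrite leq_add2l leq_mul2r leqnSn orbT.
by move=> g gr; apply: xv; apply: leq_trans gr _; rewrite leq_add2l leq_mul2r leqnSn orbT.
Qed.

Hypotheses (d_gt0 : (0 < d)%N) (p_pr : prime p).

(** Far from the exceptional ball, [T] and [Tc] agree for [j] steps; equivariance carries the
    identity from a far site to the origin. Positivity of [d] provides the far site. *)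
Lemma evp_uniform i j : (i < j)%N -> iter i T =1 iter j T ->
  iter (2 * per_const d n p) Tc =1 iter (per_const d n p) Tc.
Proof.
move=> ij Tij; apply: (per_bound p_pr aTc lTc eTc ij).
apply: (delta_ext aTc lTc eTc) => v.
pose h : G := const_mx (r + j * r).+1%:Z.
have hj : vanish (r + j * r) (delta h v : cfg) by apply: vanish_delta; rewrite norm_const //.
have hi : vanish (r + i * r) (delta h v : cfg).
  by move=> g gi; apply: hj; apply: leq_trans gi _; rewrite leq_add2l leq_mul2r ltnW ?orbT.
have := Tij (delta h v); rewrite !iter_far // -[h]add0r -shift_delta !iter_equiv //.
by move/(congr1 (shift (- h))); rewrite !shiftD addNr !shift0.
Qed.

(* With [g = iter I T], the differences [g (g x) - g x] lie in a finite [g]-invariant set, so the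
   sequence of the [iter k g x] eventually has periodic increments, and [p] periods cancel. *)
Lemma evp_near I : (0 < I)%N -> iter (2 * I) Tc =1 iter I Tc ->
  exists i j, (i < j)%N /\ iter i T =1 iter j T.
Proof.
move=> I0 TcI; pose R := (r + 2 * I * r)%N; pose R' := (R + 2 * I * r)%N.
pose g := iter I T; pose rho x := g (g x) - g x.
have ag : additive_map g by apply: addf_iter.
have agm m : additive_map (iter m g) by apply: addf_iter.
have rhoE x : rho x = iter (2 * I) T x - iter I T x by rewrite /rho /g -iterD addnn mul2n.
have arho : additive_map rho by move=> x y; rewrite /rho !ag opprD addrACA.
have rho0 x : vanish R x -> rho x = 0.
  move=> xv; rewrite rhoE !iter_far // ?TcI ?subrr // => h hg; apply: xv.
  by apply: leq_trans hg _; rewrite leq_add2l leq_mul2r leq_pmull ?orbT.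
have rho_supp x : supp R' (rho x).
  rewrite -[x](subrK (extend (restrict R x))) arho rho0 ?add0r; last first.
    by apply: vanishP; rewrite restrict_extend.
  rewrite rhoE; have xs : supp R (extend (restrict R x)) by apply: supp_extend.
  apply: suppD.
    exact: spread_iter (local_spread lT) _ _ xs.
  apply: suppN; apply: supp_le (spread_iter (local_spread lT) xs) _.
  by rewrite leq_add2l leq_mul2r leq_pmull ?orbT.
have rho_iter m x : iter m g (rho x) = rho (iter m g x).
  by rewrite /rho (addfB _ _ (agm m)) -!iterS -!iterSr.
pose Q := #|{ffun box d R' -> W}|; pose K := Q`!.
(* Every [iter m g (rho x)] is again a value of [rho], hence supported in the ball of radius [R'].
   With only [Q] such patterns, the orbit repeats within [Q] steps and [K = Q!] is a period. *)
have per x a : (Q <= a)%N -> iter (a + K) g (rho x) = iter a g (rho x).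
  move=> Qa; have [i [j [ij E]]] := @not_inj_card 'I_Q.+1 _
    (fun m => restrict R' (iter m g (rho x))) (etrans (congr1 (leq _) (card_ord _)) (leqnn _)).
  wlog {ij} ij : i j E / (i < j)%N.
    by move=> H; move: ij; rewrite neq_ltn => /orP[|]; [apply: H E|apply: H (esym E)].
  have E' : iter i g (rho x) = iter j g (rho x).
    by apply: restrict_inj E; rewrite rho_iter; apply: rho_supp.
  have jQ : (j <= Q)%N by have := ltn_ord j; rewrite ltnS.
  have /dvdnP[k Kk] : (j - i %| K)%N.
    by rewrite dvdn_fact // subn_gt0 ij; apply: leq_trans (leq_subr _ _) jQ.
  rewrite Kk; apply: (@iter_period _ _ _ i); first by rewrite subnKC // ltnW.
  by apply: leq_trans (ltnW ij) (leq_trans jQ Qa).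
pose D x a := iter (a + K) g (g x) - iter a g (g x).
(* Consecutive increments differ by [iter (a + K) g (rho x) - iter a g (rho x)], which vanishes from
   [Q] on. *)
have D_const x a : D x (Q + a)%N = D x Q.
  elim: a => [|a IHa]; first by rewrite addn0.
  rewrite -IHa addnS /D; apply/eqP; rewrite -subr_eq0 opprD opprK addrACA.
  rewrite addSn !iterSr -(addfB _ _ (agm _)) -/(rho x) [- iter _ _ _ + _]addrC -opprB -(addfB _ _
    (agm _)).
  by rewrite -/(rho x) per ?subrr // leq_addr.
have iterK x a : iter (Q + a * K) g (g x) = iter Q g (g x) + D x Q *+ a.
  elim: a => [|a IHa]; first by rewrite addn0 addr0.
  by rewrite mulSnr addnA mulrSr addrA -IHa -(D_const x (a * K)%N) /D addrC subrK.
(* [iterK] starts from [g x], whence the successors; after [p * K] steps the accumulated increment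
   is [D x Q *+ p = 0]. *)
exists (Q.+1 * I)%N, ((Q + p * K).+1 * I)%N; split.
  by rewrite ltn_pmul2r // ltnS -[X in (X < _)%N]addn0 ltn_add2l muln_gt0 prime_gt0 // fact_gt0.
by move=> x; rewrite -!iterMp !iterSr -/g iterK cfgp // addr0.
Qed.

(* By pigeonhole, [S = shift (a *+ K) - id] maps every finitely supported configuration into the
   image of [Tc]; a nonzero [z] in the kernel would yield [y] with [iter N Tc y = iter N S z <> 0]
   and [iter N.+1 Tc y = 0]. *)
Lemma surj_uniform_inj z : surj T -> finsupp z -> Tc z = 0 -> z = 0.
Proof.
move=> sT zf Tcz; pose a : G := const_mx 1%:Z.
have na : norm a = 1%N by apply: norm_const.
pose Q := #|{ffun box d r -> W}|; pose K := Q`!.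
pose S x := shift (a *+ K) x - x.
have aS : additive_map S by move=> x y; rewrite /S opprD addrACA.
(* Two preimages [u i], [u j] of translates agree on the ball, so [T_sub] and a translation solve
   [Tc y = shift (a *+ e) (delta 0 v) - delta 0 v] with [e = j - i]. Translates of [y] by multiples
   of [e] telescope to the step [K], which is the same for all [v]. *)
have S_delta v : exists y, finsupp y /\ Tc y = S (delta 0 v).
  have Tu m : exists u, finsupp u /\ T u = shift (a *+ m) (delta 0 v).
    by apply: sT; apply: finsupp_shift; eexists; apply: supp_delta.
  have /choice[u Hu] := Tu.
  have [i [j [ij E]]] := @not_inj_card 'I_Q.+1 _
    (fun m => restrict r (u m)) (etrans (congr1 (leq _) (card_ord _)) (leqnn _)).
  wlog {ij} ij : i j E / (i < j)%N.
    by move=> H; move: ij; rewrite neq_ltn => /orP[|]; [apply: H E|apply: H (esym E)].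
  have jQ : (j <= Q)%N by have := ltn_ord j; rewrite ltnS.
  have /dvdnP[k Kk] : (j - i %| K)%N.
    by rewrite dvdn_fact // subn_gt0 ij; apply: leq_trans (leq_subr _ _) jQ.
  pose y := shift (- (a *+ i)) (u j - u i); pose e := (j - i)%N.
  have yf : finsupp y.
    by apply: finsupp_shift; apply: finsuppB; [have [] := Hu j|have [] := Hu i].
  have Ty : Tc y = shift (a *+ e) (delta 0 v) - delta 0 v.
    rewrite /y eTc -T_sub //; have [_ ->] := Hu j; have [_ ->] := Hu i.
    rewrite -[shift _ (_ - _)]/(shift _ _ - shift _ _) !shiftD addNr shift0.
    by rewrite [- _ + _]addrC -mulrnBr // ltnW.
  have [y' [y'f Ty']] : exists y', finsupp y' /\
      Tc y' = \sum_(l < k) shift (a *+ (l * e)) (shift (a *+ e) (delta 0 v) - delta 0 v).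
    apply: image_sum => // l; exists (shift (a *+ (l * e)) y).
    by split; [apply: finsupp_shift | rewrite eTc Ty].
  exists y'; split=> //; rewrite Ty' /S Kk -/e.
  elim: k {Kk y' y'f Ty'} => [|k IHk]; first by rewrite big_ord0 mulr0n shift0 subrr.
  rewrite big_ord_recr /= IHk -[shift _ (_ - _)]/(shift _ _ - shift _ _) shiftD -mulrnDr.
  by rewrite addrC addrA subrK addnC mulSn.
have S_img u : finsupp u -> exists y, finsupp y /\ Tc y = S u.
  move=> [q uq]; rewrite (finsupp_sum uq) (addf_sum _ _ _ aS).
  apply: image_sum => // b; have [y [yf Ty]] := S_delta (u (bx b)).
  exists (shift (bx b) y); split; first exact: finsupp_shift.
  have -> : delta (bx b) (u (bx b)) = shift (bx b) (delta 0 (u (bx b))) by rewrite shift_delta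
    add0r.
  by rewrite eTc Ty /S -[shift _ (_ - _)]/(shift _ _ - shift _ _) !shiftD [bx b + _]addrC.
have S_fin x : finsupp x -> finsupp (S x).
  by move=> xf; apply: finsuppB => //; apply: finsupp_shift.
have S_inj x : finsupp x -> S x = 0 -> x = 0.
  move=> [q xq] /eqP; rewrite subr_eq0 => /eqP Sx.
  apply: (@supp_finite_orbit d n p _ (a *+ K) q) => // [|m].
    by rewrite normMn na mul1n fact_gt0.
  by elim: m => [|m IHm]; rewrite ?mulr0n ?shift0 // mulrS -shiftD IHm.
have iterS_inj m x : finsupp x -> iter m S x = 0 -> x = 0.
  elim: m x => // m IHm x xf; rewrite iterSr => /(IHm _ (S_fin _ xf)); exact: S_inj.
have TcS x : Tc (S x) = S (Tc x) by rewrite /S addfB // eTc.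
have chain m : exists y, finsupp y /\ iter m Tc y = iter m S z.
  elim: m => [|m [y [yf Ey]]]; first by exists z.
  have [y' [y'f Ey']] := S_img y yf; exists y'; split=> //.
  by rewrite iterSr Ey' iterS -Ey; apply: iter_comm => w; rewrite TcS.
have [y [yf Ey]] := chain N.
apply: (iterS_inj N) => //; rewrite -Ey.
apply: (iter_eq0_bound p_pr (m := N.+1) aTc (local_spread lTc) eTc yf).
rewrite iterS Ey -(iter_comm (f := S) (g := Tc)) => [|w]; last by rewrite TcS.
by rewrite Tcz; apply: (addf0 (addf_iter N aS)).
Qed.

(* The index of [Tc] is that of [T]: sending [k] to the restriction of a [T]-preimage of
   [Tc (extend k)] is an injective self-map of a finite set. *)
Lemma surj_uniform : surj T -> surj Tc.
Proof.
move=> sT; have injTc z := @surj_uniform_inj z sT.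
have /choice[u Hu] (k : {ffun box d r -> W}) : exists u, finsupp u /\ T u = Tc (extend k).
  by apply: sT; apply: finsupp_spread (local_spread lTc) _; exists r; apply: supp_extend.
pose f k := restrict r (u k).
have TcE x k : finsupp x -> restrict r x = k -> T x = Tc (x - extend k) + T (extend k).
  move=> xf xk; rewrite -[Tc _](addrK (T (extend k))) -T_sub ?subrK //.
  by rewrite restrict_extend.
(* If [u k] and [u l] agree on the ball, then [Tc (u k - u l) = Tc (extend k - extend l)];
   injectivity of [Tc] and restriction to the ball give [k = l]. *)
have f_inj : injective f.
  move=> k l E; have Eu : restrict r (u k) = restrict r (u l) by exact: E.
  have : extend k - extend l - (u k - u l) = 0.
    have [[ukf Tuk] [ulf Tul]] := (Hu k, Hu l).
    apply: injTc; last by rewrite (addfB _ _ aTc) -(T_sub Eu) (addfB _ _ aTc) -Tuk -Tul subrr.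
    by apply: finsuppB; apply: finsuppB => //; exists r; apply: supp_extend.
  move/eqP; rewrite subr_eq0 => /eqP/(congr1 (restrict r)).
  by rewrite !restrictB !restrict_extend Eu subrr => /eqP; rewrite subr_eq0 => /eqP.
move=> w wf; have [x [xf Tx]] := sT w wf.
have [k xk] : exists k, restrict r x = f k.
  by have [g _ fg] := injF_bij f_inj; exists (g (restrict r x)); rewrite fg.
have [ukf Tuk] := Hu k.
exists (x - u k + extend k); split.
  by apply: finsuppD; [apply: finsuppB | exists r; apply: supp_extend].
by rewrite aTc -T_sub // Tuk Tx subrK.
Qed.

(* [Y T] is the identity plus an operator depending only on the restriction to the ball. *)
Section Criterion.
Variable Y : cfg -> cfg.
Hypotheses (aY : additive_map Y) (Yfin : forall u, finsupp u -> finsupp (Y u)).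
Hypothesis YK : forall u, finsupp u -> Tc (Y u) = u.

Let ext_fin (k : {ffun box d r -> W}) : finsupp (extend k).
Proof. by exists r; apply: supp_extend. Qed.

Let psi (k : {ffun box d r -> W}) := restrict r (Y (T (extend k))).

Let extendB (k l : {ffun box d r -> W}) : extend (k - l) = extend k - extend l.
Proof.
apply: (restrict_inj (r := r)); last by rewrite restrictB !restrict_extend.
  exact: supp_extend.
by apply: suppD; [|apply: suppN]; apply: supp_extend.
Qed.

Let psiB k l : psi (k - l) = psi k - psi l.
Proof. by rewrite /psi extendB (addfB _ _ aT) (addfB _ _ aY) restrictB. Qed.

(** The assumption says that the additive self-map [psi] of a finite group has trivial kernel, hence
    that it is onto. *)
Lemma crit_surj : (forall x, supp r x -> vanish r (Y (T x)) -> x = 0) -> surj T.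
Proof.
move=> crit w wf.
have psi_inj : injective psi.
  move=> k l E; apply/eqP; rewrite -subr_eq0; apply/eqP.
  rewrite -(restrict_extend (k - l)) (crit (extend (k - l))) => [||g gr].
  - by apply/ffunP => b; rewrite !ffunE.
  - exact: supp_extend.
  have [b <-] := bx_onto gr; have := congr1 (fun u : {ffun _} => u b) (psiB k l).
  by rewrite E subrr !ffunE.
have [k xk] : exists k, restrict r (Y w) = psi k.
  by have [g _ fg] := injF_bij psi_inj; exists (g (restrict r (Y w))); rewrite fg.
(* By the choice of [k] the second summand vanishes on the ball, so [T] acts on it as [Tc], which
   undoes [Y]. *)
exists (extend k + (Y w - Y (T (extend k)))); split.
  apply: finsuppD => //; apply: finsuppB; first exact: Yfin.
  by apply: Yfin; apply: finsupp_spread (local_spread lT) _.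
rewrite aT [T (_ - _)]T_vanish; last by apply: vanishP; rewrite xk.
rewrite (addfB _ _ aTc) !YK //; last by apply: finsupp_spread (local_spread lT) _.
by rewrite addrC subrK.
Qed.

(** Injectivity of [Tc] makes [Y] a two-sided inverse. If [T x = Tc (extend k0)], then [psi] sends
    the restriction of [x] to [k0]; so [psi] is onto, and injective by finiteness. *)
Lemma surj_crit : surj T -> forall x, supp r x -> vanish r (Y (T x)) -> x = 0.
Proof.
move=> sT; have injTc z := @surj_uniform_inj z sT.
have TcK u : finsupp u -> Y (Tc u) = u.
  move=> uf; have Tcuf : finsupp (Tc u) by apply: finsupp_spread (local_spread lTc) _.
  apply/eqP; rewrite -subr_eq0; apply/eqP; apply: injTc.
    by apply: finsuppB => //; apply: Yfin.
  by rewrite (addfB _ _ aTc) YK // subrr.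
have psi_surj k0 : exists k, psi k = k0.
  have [|x [xf Tx]] := sT (Tc (extend k0)).
    exact: finsupp_spread (local_spread lTc) _.
  exists (restrict r x); have := T_sub (x := x) (y := extend (restrict r x)).
  rewrite restrict_extend => /(_ erefl)/eqP; rewrite subr_eq addrC -subr_eq Tx => /eqP/(congr1 Y).
  rewrite (addfB _ _ aY) !TcK // => [E|]; last exact: finsuppB.
  by rewrite /psi -E !restrictB !restrict_extend subrr subr0.
have /choice[q qK] := psi_surj.
have [q' q'K q'K'] := injF_bij (can_inj qK).
have psi_inj : injective psi.
  by move=> k l E; rewrite -[k]q'K' -[l]q'K' -[q' k]qK -[q' l]qK !q'K' E.
move=> x xr vx; rewrite -(restrictK xr).
have -> : restrict r x = 0.
  apply: psi_inj; rewrite -[X in _ = psi X](subrr 0) psiB subrr.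
  by apply/ffunP => b; rewrite !ffunE restrictK // vx // norm_bx.
by apply: (restrict_inj (r := r)) => //; [apply: supp_extend | rewrite restrict_extend;
  apply/ffunP => b; rewrite !ffunE].
Qed.
End Criterion.

Lemma right_inv_fin f : additive_map f -> equiv f -> (forall v, Tc (f (delta 0 v)) = delta 0 v) ->
  forall u, finsupp u -> Tc (f u) = u.
Proof.
move=> af fe fK u uf; apply: (addf_ext_fin (f := Tc \o f) (f' := id)) => //.
  exact: addf_comp.
by move=> h v /=; rewrite -[h]add0r -shift_delta fe eTc fK.
Qed.

(** The rows of [B] are the preimages of the basis vectors placed at the origin, which
    [inverse_bound] confines to the radius [3 N r]. Repetition-free offsets ensure that each site is
    counted once. *)
Lemma right_inv_exists (L : seq G) : surj T -> uniq L ->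
    (forall g, (norm g <= 3 * (N * r))%N -> g \in L) ->
  exists B : G -> 'M[F]_n, forall v,
    Tc (colop L (fun _ i => B L`_i) (delta 0 v)) = delta 0 v.
Proof.
move=> sT uL Lbox; have injTc z := @surj_uniform_inj z sT.
have sTc := surj_uniform sT.
have /fin_all_exists[y Hy] (j : 'I_n) : exists y, finsupp y /\ Tc y = delta 0 (delta_mx 0 j).
  by apply: sTc; eexists; apply: supp_delta.
have ys j : supp (3 * (N * r)) (y j).
  by have [yf Ty] := Hy j; apply: (inverse_bound p_pr aTc (local_spread lTc) eTc injTc yf Ty).
exists (fun g => \matrix_(j, i) y j g ord0 i) => v.
have -> : colop L (fun _ i => \matrix_(j, i0) y j L`_i ord0 i0) (delta 0 v) =
    \sum_j v ord0 j *: y j.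
  rewrite colop_delta; apply/funext => g; rewrite !cfg_sumE.
  have E h : v *m \matrix_(j, i) y j h ord0 i = \sum_j (v ord0 j *: y j) h.
    rewrite mulmx_sum_row; apply: eq_bigr => j _; rewrite cfgZE; congr (_ *: _).
    by apply/rowP => i; rewrite !mxE.
  have [gL|gL] := boolP (g \in L).
    have lt := gL; rewrite -index_mem in lt.
    rewrite (bigD1 (Ordinal lt)) //= add0r nth_index // E [X in _ + X]big1 ?addr0.
      by rewrite /delta eqxx.
    move=> i ig; rewrite /delta add0r; case: eqP => // gi.
    by case/eqP: ig; apply/val_inj; rewrite /= gi index_uniq.
  rewrite [LHS]big1 => [|i _].
    rewrite big1 // => j _; rewrite cfgZE ys ?scaler0 // ltnNge.
    by apply: contra gL => /Lbox.
  by rewrite /delta add0r; case: eqP => // gi; case/negP: gL; rewrite gi mem_nth.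
rewrite addf_sum //; under eq_bigr do rewrite addfZ //.
apply/funext => g; rewrite cfg_sumE.
rewrite (eq_bigr (fun j => if g == 0 then v ord0 j *: delta_mx 0 j else 0)) => [|j _]; last first.
  by have [_ ->] := Hy j; rewrite cfgZE /delta; case: eqP; rewrite ?scaler0.
by rewrite /delta; case: eqP => _; [rewrite -row_sum_delta | rewrite big1].
Qed.

End NearUniform.

(** * The algorithms on coded data *)

Lemma computable_app2 C T U X {eC : Enc C} {eT : Enc T} {eU : Enc U} {eX : Enc X}
    (h : T -> U -> X) (f : C -> T) (g : C -> U) :
    computable (fun p : T * U => h p.1 p.2) ->
  computable f -> computable g -> computable (fun c => h (f c) (g c)).
Proof.
move=> Hh Hf Hg; exact: (computable_comp (g := fun c => (f c, g c)) Hh (computable_pair Hf Hg)).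
Qed.

Ltac comp := repeat (lazymatch goal with
  | |- computable (fun c => c) => exact: computable_id
  | |- computable snd => exact: (computable_snd (@computable_id _ _))
  | |- computable fst => exact: (computable_fst (@computable_id _ _))
  | |- computable (fun c => fst _) => apply: computable_fst
  | |- computable (fun c => snd _) => apply: computable_snd
  | |- computable (fun c => (_, _)) => apply: computable_pair
  | |- computable (fun c => _ :: _) => apply: computable_cons
  | |- computable (fun c => _ ++ _) => apply: computable_cat
  | |- computable (fun c => _ && _) => apply: computable_andb
  | |- computable (fun c => _ || _) => apply: computable_orb
  | |- computable (fun c => ~~ _) => apply: computable_negb
  | |- computable (fun c => if _ then _ else _) => apply: computable_if
  | |- computable (fun c => map _ _) => apply: computable_map
  | |- computable (fun c => flatten _) => apply: computable_flatten
  | |- computable (fun c => foldr _ _ _) => apply: computable_foldr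
  | |- computable (fun c => all _ _) => apply: computable_all
  | |- computable (fun c => has _ _) => apply: computable_has
  | |- computable (fun c => nth _ _ _) => apply: computable_nth
  | |- computable (fun c => iota 0 _) => apply: computable_iota
  | |- computable (fun c => size _) => apply: computable_size
  | |- computable (fun c => iter _ _ _) => apply: computable_iter
  | |- computable (fun c => enc _) => apply: computable_enc
  | |- computable (fun _ => ?t) => exact: computable_const
  | H : computable ?f |- computable (fun c => ?f _) => apply: (computable_comp H)
  | H : computable ?f |- computable ?f => exact: H
  end).

(** * Computability on integers, sites and finite configurations *)

Lemma int_code_inj : injective int_code.
Proof.
case=> m [] k /= E; [congr Posz | exfalso | exfalso | congr Negz]; lia.
Qed.

Section IntCode.
(** A code is split into the positive and negative parts of its integer, so that the arithmetic of
    integers becomes that of natural numbers with truncated subtraction; [idiff] recodes a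
    difference. *)
Let ipos m : nat := ((1 - odd m) * m./2)%N.
Let ineg m : nat := (odd m * m./2.+1)%N.
Let idiff (x y : nat) : nat :=
  ((y - x == 0) * (x - y).*2 + (1 - (y - x == 0)) * (y - x).-1.*2.+1)%N.

Let idiffE x y : idiff x y = int_code (x%:Z - y%:Z).
Proof.
rewrite /idiff; have [yx|xy] := leqP y x.
  have -> : x%:Z - y%:Z = Posz (x - y) by lia.
  by rewrite (eqP yx) /=; lia.
have -> : x%:Z - y%:Z = Negz (y - x).-1 by lia.
have -> : (y - x == 0)%N = false by apply/negbTE; rewrite -lt0n subn_gt0.
by rewrite /=; lia.
Qed.

Let iposE z : (ipos (int_code z))%:Z - (ineg (int_code z))%:Z = z.
Proof.
by case: z => m; rewrite /ipos /ineg /= ?odd_double ?uphalf_double ?doubleK /=; lia.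
Qed.

Let rcomp_ipos n f : rcomp n f -> rcomp n (fun s => ipos (f s)).
Proof.
move=> Hf; apply: rcomp_mul; last exact: rcomp_half.
by apply: rcomp_sub; [exact: rcomp_const | exact: rcomp_odd].
Qed.
Let rcomp_ineg n f : rcomp n f -> rcomp n (fun s => ineg (f s)).
Proof.
by move=> Hf; apply: rcomp_mul; [exact: rcomp_odd | apply: rcomp_S; exact: rcomp_half].
Qed.
Let rcomp_double n f : rcomp n f -> rcomp n (fun s => (f s).*2).
Proof. by move=> Hf; apply: rcomp_ext (rcomp_add Hf Hf) => s _; rewrite addnn. Qed.
Let rcomp_idiff n f g : rcomp n f -> rcomp n g -> rcomp n (fun s => idiff (f s) (g s)).
Proof.
move=> Hf Hg; have He : rcomp n (fun s => nat_of_bool (g s - f s == 0)%N).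
  by apply: rcomp_eq0; apply: rcomp_sub.
apply: rcomp_add; apply: rcomp_mul => //.
- by apply: rcomp_double; apply: rcomp_sub.
- by apply: rcomp_sub => //; exact: rcomp_const.
- by apply: rcomp_S; apply: rcomp_double; apply: rcomp_pred; apply: rcomp_sub.
Qed.

Lemma computable_addz C {eC : Enc C} (f g : C -> int) :
  computable f -> computable g -> computable (fun c => f c + g c).
Proof.
apply: (@computable_raw2 _ _ _ _ _ _ _ _
  (fun x y => idiff (ipos x + ipos y)%N (ineg x + ineg y)%N) (fun x y => x + y)).
  by apply: rcomp_idiff; apply: rcomp_add; (apply: rcomp_ipos || apply: rcomp_ineg);
    apply: rcomp_proj.
move=> x y; rewrite idiffE -[x in RHS]iposE -[y in RHS]iposE.
by congr int_code; rewrite !PoszD opprD addrACA.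
Qed.

Lemma computable_oppz C {eC : Enc C} (f : C -> int) :
  computable f -> computable (fun c => - f c).
Proof.
apply: (@computable_comp _ _ _ _ _ _ (fun x => - x)).
apply: (@computable_raw _ _ _ _ (fun x => idiff (ineg x) (ipos x))).
  by apply: rcomp_idiff; (apply: rcomp_ipos || apply: rcomp_ineg); apply: rcomp_proj.
by move=> x; rewrite idiffE -[x in RHS]iposE opprB.
Qed.
End IntCode.

Section SiteCode.
Variable d : nat.
Global Instance enc_site : Enc (Zd d) := @Zd_code d.

Definition coords (g : Zd d) : seq int := [seq g ord0 i | i <- enum 'I_d].

Lemma enc_site_inj : injective (enc : Zd d -> nat).
Proof.
move=> g h /(can_inj CodeSeq.codeK)/eq_in_map E; apply/rowP => i.
by apply: int_code_inj; apply: E; rewrite mem_enum.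
Qed.

Lemma enc_coords g : enc g = enc (coords g).
Proof. by rewrite /enc /enc_site /enc_seq /Zd_code /coords -map_comp. Qed.

Lemma computable_to_coords C {eC : Enc C} (f : C -> Zd d) :
  computable f -> computable (fun c => coords (f c)).
Proof. by move=> [A HA]; exists A => c; rewrite -enc_coords. Qed.

Lemma computable_of_coords C {eC : Enc C} (f : C -> Zd d) :
  computable (fun c => coords (f c)) -> computable f.
Proof. by move=> [A HA]; exists A => c; rewrite enc_coords. Qed.

Lemma nth_coords g (i : 'I_d) : nth 0 (coords g) i = g ord0 i.
Proof. by rewrite (nth_map i) ?size_enum_ord // nth_ord_enum. Qed.

Lemma coordsE (F : Zd d -> Zd d -> Zd d) (op : int -> int -> int) g h :
    (forall i, F g h ord0 i = op (g ord0 i) (h ord0 i)) ->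
  coords (F g h) = [seq op (nth 0 (coords g) i) (nth 0 (coords h) i) | i <- iota 0 d].
Proof.
move=> FE; rewrite /coords -val_enum_ord -map_comp; apply: eq_map => i /=.
by rewrite FE -!/(coords _) !nth_coords.
Qed.

Lemma computable_add_site C {eC : Enc C} (f g : C -> Zd d) :
  computable f -> computable g -> computable (fun c => f c + g c).
Proof.
move=> Hf Hg; apply: computable_of_coords.
apply: (@computable_ext _ _ _ _ (fun c =>
  [seq nth 0 (coords (f c)) i + nth 0 (coords (g c)) i | i <- iota 0 d])).
  by move=> c; rewrite -(coordsE (F := +%R) (op := +%R)) // => i; rewrite mxE.
apply: (@computable_map _ _ _ _ _ _ (fun c i => nth 0 (coords (f c)) i + nth 0 (coords (g c)) i));
  last exact: computable_const.
apply: computable_addz; apply: computable_nth; comp; apply: computable_to_coords; comp.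
Qed.

Lemma computable_opp_site C {eC : Enc C} (f : C -> Zd d) :
  computable f -> computable (fun c => - f c).
Proof.
move=> Hf; apply: computable_of_coords.
apply: (@computable_ext _ _ _ _ (fun c => [seq - nth 0 (coords (f c)) i | i <- iota 0 d])).
  move=> c; rewrite -(coordsE (F := fun g _ => - g) (op := fun x _ => - x) (h := 0)) // => i.
  by rewrite mxE.
apply: (@computable_map _ _ _ _ _ _ (fun c i => - nth 0 (coords (f c)) i));
  last exact: computable_const.
apply: computable_oppz; by apply: computable_nth; comp; apply: computable_to_coords; comp.
Qed.

Lemma leq_mem_code (x : nat) s : x \in s -> (x <= code s)%N.
Proof. by move=> xs; have /allP/(_ x xs)/ltnW := CodeSeq.ltn_code s. Qed.

Lemma norm_enc (g : Zd d) : (norm g <= enc g)%N.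
Proof.
apply/normP => i; apply: (@leq_trans (int_code (g ord0 i))).
  by case: (g ord0 i) => m /=; lia.
by apply: leq_mem_code; apply/mapP; exists i => //; rewrite mem_enum.
Qed.
End SiteCode.

Section Algorithm.
Variables (d n p : nat).
Local Notation F := 'F_p.
Local Notation W := 'rV[F]_n.
Local Notation Mx := 'M[F]_n.
Local Notation G := (Zd d).
Local Notation conf := (seq (G * W)).

Global Instance enc_vec : Enc W := @enc_fin W.
Global Instance enc_mx : Enc Mx := @enc_fin Mx.

(* [(O, (X, c))]: the offsets, the exceptional columns and the generic column. *)
Definition data : Type := seq G * (seq (G * seq Mx) * seq Mx).

Definition column (D : data) (h : G) : seq Mx :=
  foldr (fun q acc => if q.1 == h then q.2 else acc) D.2.2 D.2.1.
Definition step1 (D : data) (a : G * W) : conf :=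
  [seq (a.1 + nth 0 D.1 i, a.2 *m nth 0 (column D a.1) i) | i <- iota 0 (size D.1)].
Definition step (D : data) (L : conf) : conf := flatten [seq step1 D a | a <- L].
(** A list stands for the sum of its [delta]s. Sites may repeat, so values are summed, and zero
    cannot be tested entry by entry. *)
Definition val_at (L : conf) (g : G) : W :=
  foldr (fun a s => if a.1 == g then a.2 + s else s) 0 L.
Definition zerob (L : conf) : bool := all (fun a => val_at L a.1 == 0) L.
Definition scale_conf (c : F) (L : conf) : conf := [seq (a.1, c *: a.2) | a <- L].
Definition generic (D : data) : data := (D.1, ([::], D.2.2)).
Definition candidate (s : seq (G * Mx)) : data := (map fst s, ([::], map snd s)).
Definition units : seq G := [seq bx b | b <- enum {: box d 1}].
(** The outer [foldr] is [undup], spelled out for the computability of folds; repetitions would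
    matter when sites serve as offsets. *)
Definition ball (m : nat) : seq G :=
  foldr (fun g s => if g \in s then s else g :: s) [::]
    (iter m (fun s => flatten [seq [seq g + u | u <- units] | g <- s]) [:: 0]).
Definition assigns (B : Type) (bs : seq B) (L : seq G) : seq (seq (G * B)) :=
  foldr (fun g acc => flatten [seq [seq (g, b) :: s | s <- acc] | b <- bs]) [:: [::]] L.
Definition pow (D : data) (i : nat) (L : conf) : conf := iter i (step D) L.
(** The scalar [c] lets one test serve twice: [-1] compares two powers, and [0] asks whether the
    first one vanishes. *)
Definition check1 (D : data) (i j : nat) (c : F) (a : G * W) : bool :=
  zerob (pow D i [:: a] ++ scale_conf c (pow D j [:: a])).
(* The code [enc D] bounds the norms of all the sites in [D]; beyond the radius below, [D] acts on a
   site through its generic column only. *)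
Definition check_radius (D : data) (i j : nat) : nat := iter (i + j).+1 (addn (enc D)) (enc D).
Definition check (D : data) (i j : nat) (c : F) : bool :=
  all (fun h => all (fun v => check1 D i j c (h, v)) (enum {: W})) (ball (check_radius D i j).+1).
Definition right_inv_test (D : data) (s : seq (G * Mx)) (v : W) : bool :=
  zerob (step (generic D) (step (candidate s) [:: (0, v)]) ++ [:: (0, - v)]).
Definition crit_test (D : data) (s : seq (G * Mx)) (L : conf) : bool :=
  zerob L || has (fun g => val_at (step (candidate s) (step D L)) g != 0) (ball (enc D)).
(** The outer search runs over the uniform operators [Y] of radius [3 * N * enc D], the bound of
    [inverse_bound]; the inner one over the configurations of the ball where the perturbation
    lives. *)
Definition surj_test (N : nat) (D : data) : bool :=
  has (fun s => all (right_inv_test D s) (enum {: W}) &&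
                all (crit_test D s) (assigns (enum {: W}) (ball (enc D))))
      (assigns (enum {: Mx}) (ball (iter (3 * N) (addn (enc D)) 0))).

Lemma computable_in_seq C (T : eqType) {eC : Enc C} {eT : Enc T} (f : C -> T) (s : C -> seq T) :
  injective (enc : T -> nat) -> computable f -> computable s -> computable (fun c => f c \in s c).
Proof.
move=> ei Hf Hs; apply: (@computable_ext _ _ _ _ (fun c => has (fun x => x == f c) (s c))).
  by move=> c; rewrite has_pred1.
apply: computable_has => //; apply: computable_eq => //; comp.
Qed.

Lemma computable_add_nat C {eC : Enc C} (f g : C -> nat) :
  computable f -> computable g -> computable (fun c => f c + g c)%N.
Proof.
apply: (@computable_raw2 _ _ _ _ _ _ _ _ addn addn) => //.
by apply: rcomp_add; apply: rcomp_proj.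
Qed.

Lemma computable_mul_nat C {eC : Enc C} (f g : C -> nat) :
  computable f -> computable g -> computable (fun c => f c * g c)%N.
Proof.
apply: (@computable_raw2 _ _ _ _ _ _ _ _ muln muln) => //.
by apply: rcomp_mul; apply: rcomp_proj.
Qed.

Lemma computable_S C {eC : Enc C} (f : C -> nat) : computable f -> computable (fun c => (f c).+1).
Proof.
exact: (computable_comp (computable_raw (F := succn) (f := succn) rcomp_succ (fun=> erefl))).
Qed.

Lemma computable_add_vec C {eC : Enc C} (v w : C -> W) :
  computable v -> computable w -> computable (fun c => v c + w c).
Proof. exact: (computable_finfun2 (fun v w : W => v + w)). Qed.

Lemma computable_mul_vec C {eC : Enc C} (v : C -> W) (a : C -> Mx) :
  computable v -> computable a -> computable (fun c => v c *m a c).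
Proof. exact: (computable_finfun2 (fun (v : W) (a : Mx) => v *m a)). Qed.

Lemma enc_vec_inj : injective (enc : W -> nat).
Proof. by move=> v w /val_inj; apply: enum_rank_inj. Qed.

Lemma computable_column C {eC : Enc C} (D : C -> data) (g : C -> G) : computable D ->
  computable g -> computable (fun c => column (D c) (g c)).
Proof.
apply: (computable_app2 (h := column)); rewrite /column; comp.
by apply: computable_eq; [exact: enc_site_inj | comp | comp].
Qed.

Lemma computable_step C {eC : Enc C} (D : C -> data) (L : C -> conf) : computable D ->
  computable L -> computable (fun c => step (D c) (L c)).
Proof.
apply: (computable_app2 (h := step)); rewrite /step /step1; comp.
  by apply: computable_add_site; comp.
by apply: computable_mul_vec; comp; apply: computable_column; comp.
Qed.

Lemma computable_val_at C {eC : Enc C} (L : C -> conf) (g : C -> G) : computable L ->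
  computable g -> computable (fun c => val_at (L c) (g c)).
Proof.
apply: (computable_app2 (h := val_at)); rewrite /val_at; comp.
  by apply: computable_eq; [exact: enc_site_inj | comp | comp].
by apply: computable_add_vec; comp.
Qed.

Lemma computable_zerob C {eC : Enc C} (L : C -> conf) : computable L ->
  computable (fun c => zerob (L c)).
Proof.
apply: (@computable_comp _ _ _ _ _ _ zerob); rewrite /zerob; comp.
by apply: computable_eq; [exact: enc_vec_inj | apply: computable_val_at; comp | comp].
Qed.

Lemma computable_scale_conf C {eC : Enc C} (a : F) (L : C -> conf) : computable L ->
  computable (fun c => scale_conf a (L c)).
Proof.
move=> HL; rewrite /scale_conf; comp.
by apply: (computable_finfun (fun v : W => a *: v)); comp.
Qed.

Lemma computable_generic C {eC : Enc C} (D : C -> data) : computable D ->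
  computable (fun c => generic (D c)).
Proof. by move=> HD; rewrite /generic; comp. Qed.

Lemma computable_candidate C {eC : Enc C} (s : C -> seq (G * Mx)) : computable s ->
  computable (fun c => candidate (s c)).
Proof.
move=> HD; rewrite /candidate; comp.
  by apply: (computable_fst (f := fun q : C * (G * Mx) => q.2)); comp.
by apply: (computable_snd (f := fun q : C * (G * Mx) => q.2)); comp.
Qed.

Lemma computable_ball C {eC : Enc C} (i : C -> nat) : computable i ->
  computable (fun c => ball (i c)).
Proof.
move=> Hi; rewrite /ball; comp.
- by apply: computable_in_seq; [exact: enc_site_inj | comp | comp].
- by apply: computable_add_site; comp.
Qed.

Lemma computable_assigns C {eC : Enc C} B {eB : Enc B} (bs : seq B) (l : C -> seq G) :
  computable l -> computable (fun c => assigns bs (l c)).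
Proof. by move=> Hl; rewrite /assigns; comp. Qed.

Lemma computable_pow C {eC : Enc C} (D : C -> data) (i : C -> nat) (L : C ->
  conf) : computable D -> computable i -> computable L ->
  computable (fun c => pow (D c) (i c) (L c)).
Proof. by move=> HD Hi HL; rewrite /pow; comp; apply: computable_step; comp. Qed.

Lemma computable_check_radius C {eC : Enc C} (D : C -> data) (i : C -> nat) (j : C ->
  nat) : computable D -> computable i -> computable j ->
  computable (fun c => check_radius (D c) (i c) (j c)).
Proof.
move=> HD Hi Hj; rewrite /check_radius; comp.
  by apply: computable_S; apply: computable_add_nat; comp.
by apply: computable_add_nat; comp.
Qed.

Lemma computable_check C {eC : Enc C} (D : C -> data) (i : C -> nat) (j : C ->
  nat) (a : F) : computable D -> computable i -> computable j ->
  computable (fun c => check (D c) (i c) (j c) a).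
Proof.
move=> HD Hi Hj; rewrite /check; comp.
  apply: computable_zerob; rewrite /check1; comp; first by apply: computable_pow; comp.
  by apply: computable_scale_conf; apply: computable_pow; comp.
by apply: computable_ball; apply: computable_S; apply: computable_check_radius.
Qed.

Lemma computable_surj_test C {eC : Enc C} (N : nat) (D : C -> data) : computable D ->
  computable (fun c => surj_test N (D c)).
Proof.
move=> HD; rewrite /surj_test; comp.
- apply: computable_zerob; comp.
    apply: computable_step; first by apply: computable_generic; comp.
    by apply: computable_step; [apply: computable_candidate|]; comp.
  by apply: (computable_finfun (fun v : W => - v)); comp.
- rewrite /crit_test; comp; first by apply: computable_zerob; comp.
    apply: computable_eq; [exact: enc_vec_inj | | by comp].
    apply: computable_val_at; last by comp.
    apply: computable_step; first by apply: computable_candidate; comp.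
    by apply: computable_step; comp.
  by apply: computable_ball; comp.
- by apply: computable_assigns; apply: computable_ball; comp.
- apply: computable_assigns; apply: computable_ball; comp.
  by apply: computable_add_nat; comp.
Qed.

End Algorithm.

(** * Correctness of the algorithms *)

Section Spec.
Variables (d n p : nat).
Local Notation F := 'F_p.
Local Notation W := 'rV[F]_n.
Local Notation Mx := 'M[F]_n.
Local Notation G := (Zd d).
Local Notation cfg := (G -> W).
Local Notation conf := (seq (G * W)).
Local Notation data := (data d n p).
Implicit Types (D : data) (L : conf).

Definition conf_fun L : cfg := \sum_(a <- L) delta a.1 a.2.
Definition data_op D : cfg -> cfg := colop D.1 (fun h i => nth 0 (column D h) i).

Lemma conf_fun_cat L L' : conf_fun (L ++ L') = conf_fun L + conf_fun L'.
Proof. exact: big_cat. Qed.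

Lemma conf_fun1 a : conf_fun [:: a] = delta a.1 a.2.
Proof. exact: big_seq1. Qed.

Lemma deltaZ (c : F) h (v : W) : delta h (c *: v) = c *: delta h v :> cfg.
Proof. by apply/funext => g; rewrite cfgZE /delta; case: eqP; rewrite ?scaler0. Qed.

Lemma conf_fun_scale c L : conf_fun (scale_conf c L) = c *: conf_fun L.
Proof. by rewrite /conf_fun big_map scaler_sumr; apply: eq_bigr => a _; rewrite deltaZ. Qed.

Lemma val_atE L g : val_at L g = conf_fun L g.
Proof.
rewrite /conf_fun cfg_sumE; elim: L => [|a L IHL] /=; first by rewrite big_nil.
by rewrite big_cons IHL /delta eq_sym; case: eqP; rewrite ?add0r.
Qed.

Lemma zerobP L : reflect (conf_fun L = 0) (zerob L).
Proof.
apply: (iffP allP) => [H|L0 a _]; last by rewrite val_atE L0.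
apply/funext => g; have [/mapP[a aL ->]|gL] := boolP (g \in map fst L).
  by rewrite -val_atE; apply/eqP/H.
rewrite /conf_fun cfg_sumE big_seq big1 // => a aL; rewrite /delta; case: eqP => // ga.
by case/negP: gL; rewrite ga map_f.
Qed.

Lemma addf_data_op D : additive_map (data_op D). Proof. exact: addf_colop. Qed.

Lemma conf_fun_step D L : conf_fun (step D L) = data_op D (conf_fun L).
Proof.
rewrite /step {2}/conf_fun (addf_sum _ _ _ (addf_data_op D)) /conf_fun big_flatten big_map.
apply: eq_bigr => a _; rewrite /data_op colop_delta big_map.
by rewrite -(big_mkord xpredT (fun i => delta (a.1 + nth 0 D.1 i) (a.2 *m nth 0 (column D a.1) i)))
  /index_iota subn0.
Qed.

Lemma conf_fun_pow D i L : conf_fun (pow D i L) = iter i (data_op D) (conf_fun L).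
Proof. by elim: i => //= i IHi; rewrite conf_fun_step IHi. Qed.

Lemma enc_ge_offset D (i : nat) : (i < size D.1)%N -> (norm (nth 0%R D.1 i) <= enc D)%N.
Proof.
move=> iD; apply: leq_trans (norm_enc _) _; apply: (@leq_trans (enc D.1)).
  by apply: leq_mem_code; apply: map_f; apply: mem_nth.
by apply: leq_mem_code; rewrite mem_head.
Qed.

Lemma enc_ge_site D h : h \in map fst D.2.1 -> (norm h <= enc D)%N.
Proof.
move=> /mapP[q qD ->]; apply: leq_trans (norm_enc _) _; apply: (@leq_trans (enc q)).
  by apply: leq_mem_code; rewrite mem_head.
apply: (@leq_trans (enc D.2.1)); first by apply: leq_mem_code; apply: map_f.
apply: (@leq_trans (enc D.2)); first by apply: leq_mem_code; rewrite mem_head.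
by apply: leq_mem_code; rewrite !inE eqxx orbT.
Qed.

Lemma data_op_local D : local (enc D) (data_op D).
Proof. by apply: colop_local => i; apply: enc_ge_offset. Qed.

Lemma generic_local D : local (enc D) (data_op (generic D)).
Proof. by apply: colop_local => i; apply: enc_ge_offset. Qed.

Lemma generic_equiv D : equiv (data_op (generic D)).
Proof. exact: (@colop_equiv d n p D.1 (fun i => nth 0 D.2.2 i)). Qed.

Lemma column_generic D h : h \notin map fst D.2.1 -> column D h = D.2.2.
Proof.
rewrite /column; elim: D.2.1 => //= q X IHX; rewrite inE negb_or => /andP[hq hX].
by rewrite eq_sym (negPf hq) IHX.
Qed.

Lemma data_op_vanish D x : vanish (enc D) x -> data_op D x = data_op (generic D) x.
Proof.
move=> xv; apply: eq_colop => h xh i; rewrite [in LHS]column_generic //.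
by apply: contra xh => /enc_ge_site/xv ->.
Qed.

Lemma foldr_undup (T : eqType) (s : seq T) :
  foldr (fun g s => if g \in s then s else g :: s) [::] s = undup s.
Proof. by elim: s => //= x s ->; rewrite mem_undup. Qed.

Lemma ball_uniq m : uniq (ball d m).
Proof. by rewrite /ball foldr_undup undup_uniq. Qed.

Lemma mem_ball m g : (g \in ball d m) = (norm g <= m)%N.
Proof.
rewrite /ball foldr_undup mem_undup; elim: m g => [|m IHm] g.
  rewrite inE leqn0; apply/eqP/eqP => [->|/norm_eq0 //]; exact: norm0.
rewrite iterS; apply/flattenP/idP => [[s /mapP[h hm ->] /mapP[u /mapP[b _ ->] ->]]|gm].
  rewrite IHm in hm; apply: leq_trans (normD _ _) _; rewrite -[m.+1]addn1.
  exact: leq_add hm (norm_bx b).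
pose u : G := \row_i Num.sg (g ord0 i).
have [b bu] : exists b : box d 1, bx b = u.
  by apply: bx_onto; apply/normP => i; rewrite mxE; case: (ltrgt0P (g ord0 i)) => a0;
    [rewrite gtr0_sg | rewrite ltr0_sg | rewrite a0 sgr0].
exists [seq (g - u) + w | w <- units d].
  apply: map_f; rewrite IHm; apply/normP => i; rewrite !mxE.
  by have /normP/(_ i) := gm; move: (g ord0 i) => a; case: (ltrgt0P a) => a0 am;
    [rewrite gtr0_sg // | rewrite ltr0_sg // | rewrite a0 sgr0]; lia.
by apply/mapP; exists u; rewrite ?subrK // -bu map_f // mem_enum.
Qed.

Lemma assignsP (B : eqType) (bs : seq B) (l : seq G) (f : G -> B) :
  (forall g, f g \in bs) -> [seq (g, f g) | g <- l] \in assigns bs l.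
Proof.
move=> fbs; elim: l => [|g l IHl] /=; first by rewrite mem_head.
by apply/flattenP; eexists; [apply: map_f (fbs g) | apply: map_f IHl].
Qed.

Lemma assigns_sites (B : eqType) (bs : seq B) (l : seq G) s :
  s \in assigns bs l -> map fst s = l.
Proof.
elim: l s => [|g l IHl] s /=; first by rewrite inE => /eqP ->.
by move=> /flattenP[t /mapP[b _ ->] /mapP[s' s'l ->]] /=; rewrite IHl.
Qed.

Lemma conf_fun_supp m L : all (fun a => norm a.1 <= m)%N L -> supp m (conf_fun L).
Proof.
move=> /allP Lm; rewrite /conf_fun big_seq; apply: supp_sum => a aL.
by apply: supp_le (@supp_delta d n p a.1 a.2) _; apply: Lm.
Qed.

Lemma conf_fun_assign m x : supp m x -> conf_fun [seq (g, x g) | g <- ball d m] = x.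
Proof.
move=> xm; apply/funext => g; rewrite /conf_fun big_map cfg_sumE.
have [gm|gm] := boolP (g \in ball d m).
  rewrite (bigD1_seq g) ?ball_uniq //= {1}/delta eqxx big1 ?addr0 // => h hg.
  by rewrite /delta eq_sym (negPf hg).
rewrite xm ?ltnNge -?mem_ball // big_seq big1 // => h hm; rewrite /delta.
by case: eqP => // gh; rewrite gh hm in gm.
Qed.

Lemma iter_addn k a r : iter k (addn r) a = (a + k * r)%N.
Proof. by elim: k => [|k IHk] /=; rewrite ?addn0 // IHk mulSn; lia. Qed.

Section Correct.
Hypotheses (d_gt0 : (0 < d)%N) (p_pr : prime p).

(** By locality it suffices to treat [delta]s. Beyond the radius [R] powers up to [i + j] only see
    the equivariant generic part, so the site [k] of norm [R.+1] represents all far sites: hence the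
    extra unit in the ball tested. *)
Lemma checkP D i j c : reflect (forall x,
  iter i (data_op D) x + c *: iter j (data_op D) x = 0) (check D i j c).
Proof.
have test h v : check1 D i j c (h, v) =
    (iter i (data_op D) (delta h v) + c *: iter j (data_op D) (delta h v) == 0).
  by apply/zerobP/eqP; rewrite conf_fun_cat conf_fun_scale !conf_fun_pow conf_fun1.
set R := check_radius D i j.
have RE : R = (enc D + (i + j).+1 * enc D)%N by rewrite /R /check_radius iter_addn.
apply: (iffP allP) => [H x|H h hR]; last by apply/allP => v _; rewrite test H eqxx.
have aop m : additive_map (iter m (data_op D)) := addf_iter m (addf_data_op D).
apply: (@addf_ext d n p ((i + j) * enc D) (fun x => iter i (data_op D) x + c *: iter j (data_op D)
  x) (fun=> 0)) => //.
- by move=> y z; rewrite !aop scalerDr addrACA.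
- by move=> y z; rewrite addr0.
- have lop m : local (m * enc D) (iter m (data_op D)) by apply: local_iter; apply: data_op_local.
  move=> y g yg; rewrite cfgDE cfgZE !(lop _ y g) ?scaler0 ?addr0 // => h hg; apply: yg.
    by apply: leq_trans hg _; rewrite leq_mul2r leq_addl orbT.
  by apply: leq_trans hg _; rewrite leq_mul2r leq_addr orbT.
move=> h v; have test_box k : (norm k <= R.+1)%N ->
    iter i (data_op D) (delta k v) + c *: iter j (data_op D) (delta k v) = 0.
  move=> kR; apply/eqP; rewrite -test; have := H k; rewrite mem_ball => /(_ kR)/allP.
  by apply; rewrite mem_enum.
have [hR|hR] := leqP (norm h) R.+1; first exact: test_box.
pose k : G := const_mx R.+1%:Z; have nk : norm k = R.+1 by apply: norm_const.
have far m l : (m <= i + j)%N -> (R < norm l)%N ->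
    iter m (data_op D) (delta l v) = iter m (data_op (generic D)) (delta l v).
  move=> mij lR; apply: (iter_far (@generic_local D) (@data_op_vanish D)).
  apply: vanish_delta; apply: leq_trans lR; rewrite RE ltnS leq_add2l leq_mul2r.
  by apply/orP; right; apply: leq_trans mij _.
have fe m l w := iter_equiv m l w (@generic_equiv D).
have := test_box k; rewrite nk leqnn => /(_ isT).
have ki : (R < norm k)%N by rewrite nk.
rewrite (far i k (leq_addr _ _) ki) (far j k (leq_addl _ _) ki) => E.
rewrite (far i h (leq_addr _ _) (ltnW hR)) (far j h (leq_addl _ _) (ltnW hR)).
have -> : delta h v = shift (h - k) (delta k v) by rewrite shift_delta addrC subrK.
by rewrite !fe -[LHS]/(shift (h - k) (_ + c *: _)) E.
Qed.
Lemma deltaN h (v : W) : delta h (- v) = - delta h v :> cfg.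
Proof. by rewrite -scaleN1r deltaZ scaleN1r. Qed.

Lemma right_inv_testP D s v :
  reflect (data_op (generic D) (data_op (candidate s) (delta 0 v)) = delta 0 v) (right_inv_test D
    s v).
Proof.
apply: (iffP (zerobP _)); rewrite conf_fun_cat !conf_fun_step !conf_fun1 deltaN.
  by move/eqP; rewrite subr_eq0 => /eqP.
by move=> ->; apply: subrr.
Qed.

Lemma crit_testP D s L :
  reflect (vanish (enc D) (data_op (candidate s) (data_op D (conf_fun L))) ->
    conf_fun L = 0) (crit_test D s L).
Proof.
apply: (iffP orP) => [[/zerobP-> // | /hasP[g gr yg] yv]|H].
  by case/eqP: yg; rewrite val_atE !conf_fun_step yv // -mem_ball.
have [Hg|/hasPn Hg] := boolP (has _ _); first by right.
left; apply/zerobP/H => g gr; have := Hg g; rewrite mem_ball => /(_ gr).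
by rewrite negbK val_atE !conf_fun_step => /eqP.
Qed.

Lemma candidate_equiv s : equiv (data_op (candidate s)).
Proof. exact: (@colop_equiv d n p _ (fun i => nth 0 (map snd s) i)). Qed.

Lemma candidate_graph (l : seq G) (B : G -> Mx) :
  data_op (candidate [seq (g, B g) | g <- l]) = colop l (fun _ i => B (nth 0 l i)).
Proof.
apply/funext => x; apply/funext => g; rewrite /data_op /colop /=.
have -> : map fst [seq (g, B g) | g <- l] = l by rewrite -map_comp map_id.
by apply: eq_bigr => i _; rewrite /column /= -map_comp (nth_map 0).
Qed.

Local Notation N := ((n * 2 ^ d).+1).

(** Any candidate that passes is a genuine right inverse, so [crit_surj] applies to it; the radius
    bound is used only to find one when [data_op D] is surjective. *)
Lemma surj_testP D : reflect (surj (data_op D)) (surj_test N D).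
Proof.
have aT := addf_data_op D; have aTc := addf_data_op (generic D).
have lT := @data_op_local D; have lTc := @generic_local D; have eTc := @generic_equiv D.
have Tv := @data_op_vanish D.
apply: (iffP hasP) => [[s _ /andP[/allP Hinv /allP Hcrit]]|sT].
  have YK : forall u, finsupp u -> data_op (generic D) (data_op (candidate s) u) = u.
    apply: (right_inv_fin aTc eTc (addf_data_op _) (@candidate_equiv s)) => v.
    by apply/right_inv_testP/Hinv; rewrite mem_enum.
  apply: (crit_surj aT aTc lT Tv (addf_data_op (candidate s))) => // [u uf|x xr xv].
    by apply: finsupp_spread uf; apply: local_spread (@data_op_local _).
  have /Hcrit/crit_testP : [seq (g, x g) | g <- ball d (enc D)] \in
      assigns (enum {: W}) (ball d (enc D)).
    by apply: assignsP => g; rewrite mem_enum.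
  by rewrite conf_fun_assign //; apply.
have [g|B HB] := right_inv_exists aT aTc lTc eTc Tv d_gt0 p_pr sT
    (ball_uniq (3 * (N * enc D))); first by rewrite mem_ball.
set l := ball d _ in HB; pose s := [seq (g, B g) | g <- l].
have YE : data_op (candidate s) = colop l (fun _ i => B (nth 0 l i)) := candidate_graph l B.
exists s.
  have -> : iter (3 * N) (addn (enc D)) 0%N = (3 * (N * enc D))%N by rewrite iter_addn add0n mulnA.
  by apply: assignsP => g; rewrite mem_enum.
apply/andP; split; apply/allP.
  by move=> v _; apply/right_inv_testP; rewrite YE HB.
move=> L /assigns_sites LE; apply/crit_testP;
  apply: (surj_crit aT aTc lTc eTc Tv d_gt0 p_pr (addf_data_op (candidate s))) => //.
- by move=> u uf; apply: finsupp_spread uf; apply: local_spread (@data_op_local _).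
- apply: (right_inv_fin aTc eTc (addf_data_op _) (@candidate_equiv s)) => v.
  by rewrite YE HB.
- apply: conf_fun_supp; apply/allP => a aL; rewrite -mem_ball -LE; exact: map_f.
Qed.

End Correct.
End Spec.

(** * Duality *)

Section Duality.
Variables (d n p : nat).
Local Notation F := 'F_p.
Local Notation W := 'rV[F]_n.
Local Notation Mx := 'M[F]_n.
Local Notation G := (Zd d).
Local Notation cfg := (G -> W).

(* The transpose of [colop O A] for the pairing of configurations with finitely supported ones. *)
Definition rowop (O : seq G) (A : G -> nat -> Mx) (x : cfg) : cfg :=
  fun g => \sum_(i < size O) x (g + O`_i) *m (A g i)^T.

Variables (O : seq G) (A : G -> nat -> Mx).

Definition dot (v w : W) : F := (v *m w^T) ord0 ord0.

Lemma dotDl v v' w : dot (v + v') w = dot v w + dot v' w.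
Proof. by rewrite /dot mulmxDl mxE. Qed.

Lemma dot0l w : dot 0 w = 0.
Proof. by rewrite /dot mul0mx mxE. Qed.

Lemma dot_eq0 w : (forall v, dot v w = 0) -> w = 0.
Proof.
move=> H; apply/rowP => j; have := H (delta_mx 0 j).
by rewrite /dot -rowE !mxE.
Qed.

Lemma dot_rowop x g v : dot v (rowop O A x g) = \sum_(i < size O) dot (v *m A g i) (x (g + O`_i)).
Proof.
rewrite /dot linear_sum mulmx_sumr summxE; apply: eq_bigr => i _.
by rewrite /= trmx_mul trmxK mulmxA.
Qed.

Lemma dot_adj (l : cfg -> F) x :
    {morph l : y z / y + z} -> (forall h v, l (delta h v) = dot v (x h)) ->
  forall g v, l (colop O A (delta g v)) = dot v (rowop O A x g).
Proof.
move=> lD lx g v; have l0 : l 0 = 0 by apply: (addrI (l 0)); rewrite -lD !addr0.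
rewrite colop_delta (big_morph l lD l0) dot_rowop.
by apply: eq_bigr => i _; rewrite lx.
Qed.

(** If [delta g v] is the image of [y], its pairing with [x] is that of [y] with the transpose
    applied to [x], which is zero. *)
Lemma surj_rowop_inj : surj (colop O A) -> forall x, rowop O A x = 0 -> x = 0.
Proof.
move=> sT x Tx; apply/funext => g; apply: dot_eq0 => v.
have [y [[q yq] Ty]] := sT (delta g v) (finsupp_delta g v).
pose r := (\max_(i < size O) norm O`_i)%N.
(* [x] may have infinite support, so the pairing is truncated to a box containing the image of [y]
   and the site [g]. *)
pose R := maxn (q + r) (norm g).
pose l (y : cfg) := \sum_(b : box d R) dot (y (bx b)) (x (bx b)).
have lD : {morph l : y z / y + z}.
  by move=> y1 y2; rewrite /l -big_split; apply: eq_bigr => b _; rewrite cfgDE dotDl.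
have l0 : l 0 = 0 by apply: (addrI (l 0)); rewrite -lD !addr0.
have lx h w : (norm h <= R)%N -> l (delta h w) = dot w (x h).
  move=> /bx_onto[b <-]; rewrite /l (bigD1 b) //= {1}/delta eqxx big1 ?addr0 // => b' bb'.
  by rewrite /delta (inj_eq (@bx_inj d R)) (negPf bb') dot0l.
rewrite -lx ?leq_maxr // -Ty (finsupp_sum yq) (addf_sum _ _ _ (@addf_colop d n p O A)).
rewrite (big_morph l lD l0) big1 // => b _; rewrite colop_delta (big_morph l lD l0).
transitivity (dot (y (bx b)) (rowop O A x (bx b))).
  rewrite dot_rowop; apply: eq_bigr => i _; apply: lx; apply: leq_trans (leq_maxl _ _).
  apply: leq_trans (normD _ _) _; rewrite leq_add ?norm_bx //.
  exact: (@leq_bigmax _ (fun i : 'I_(size O) => norm O`_i)).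
by rewrite Tx /dot trmx0 mulmx0 mxE.
Qed.

(** * Linear functionals from Zorn's lemma *)

Section Functional.
Variables (p_pr : prime p) (I : set cfg) (u0 : cfg).
Hypotheses (I0 : I 0) (IB : forall x y, I x -> I y -> I (x - y)) (Iu0 : ~ I u0).

Let P (X : set cfg) := X = set0 \/
  [/\ (forall x, I x -> X x), (forall x y, X x -> X y -> X (x - y)) & ~ X u0].

(** Over a prime field every scalar is a multiple of 1, so subgroups are subspaces. *)
Lemma sub_closedZ (X : set cfg) : (forall x y, X x -> X y -> X (x - y)) ->
  forall (c : F) x, X x -> X (c *: x).
Proof.
move=> XB c x Xx; have X0 : X 0 by rewrite -(subrr x); apply: XB.
rewrite -[c]natr_Zp scaler_nat; elim: (c : nat) => [|m IHm]; first by rewrite mulr0n.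
by rewrite mulrSr -[X in _ + X]opprK -[- x]sub0r; apply: (XB) => //; apply: XB.
Qed.

(** A subgroup maximal among those that contain [I] and avoid [u0] is a hyperplane complementary to
    [u0]. *)
Lemma maximal_subgroup : exists H : set cfg,
  [/\ (forall x, I x -> H x), (forall x y, H x -> H y -> H (x - y)), ~ H u0 &
      forall u, exists c : F, H (u - c *: u0)].
Proof.
have [|H [PH Hmax]] := @Zorn_bigcup cfg P.
  move=> C CP Ctot; have [[X [CX X0]]|noX] := EM (exists X, C X /\ X <> set0); last first.
    left; apply/seteqP; split=> // x [X CX Xx]; apply: noX; exists X; split=> //.
    by move=> X0; rewrite X0 in Xx.
  right; split=> [x Ix|x y [Y CY Yx] [Z CZ Zy]|[Y CY Yu]].
  - by have [//|[IX _ _]] := CP X CX; exists X => //; apply: IX.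
  - have [YZ|ZY] := Ctot _ _ CY CZ.
      exists Z => //; have [Z0|[_ ZB _]] := CP Z CZ; first by rewrite Z0 in Zy.
      by apply: ZB => //; apply: YZ.
    exists Y => //; have [Y0|[_ YB _]] := CP Y CY; first by rewrite Y0 in Yx.
    by apply: YB => //; apply: ZY.
  - by have [Y0|[_ _ /(_ Yu)]] := CP Y CY; first by rewrite Y0 in Yu.
have [H0|[IH HB Hu0]] := PH.
  case: (Hmax I); last by right; split.
  by rewrite H0; split=> // /(_ _ I0).
have HZ := sub_closedZ HB; exists H; split=> // u.
have [Hu|Hu] := EM (H u); first by exists 0; rewrite scale0r subr0.
have H00 : H 0 by apply: IH.
have HN x : H x -> H (- x) by move=> Hx; rewrite -sub0r; apply: HB.
have HD x y : H x -> H y -> H (x + y) by move=> Hx Hy; rewrite -[y]opprK; apply: HB => //;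
  apply: HN.
(* [B] is [H] plus the line of [u]; being strictly larger than [H], it must contain [u0], and the
   coefficient found there is nonzero. *)
pose B : set cfg := fun x => exists c : F, H (x - c *: u).
have [c Hc] : B u0.
  apply: contrapT => Bu0; apply: (Hmax B).
    split=> [x Hx|BH]; first by exists 0; rewrite scale0r subr0.
    by apply/Hu/BH; exists 1; rewrite scale1r subrr.
  right; split=> // [x Ix|x y [c Hx] [c' Hy]]; first by exists 0; rewrite scale0r subr0; apply: IH.
  exists (c - c'); have -> : x - y - (c - c') *: u = x - c *: u - (y - c' *: u).
    by rewrite scalerBl !opprD !opprK addrACA.
  exact: HB.
have c0 : c != 0 by apply/eqP => c0; apply: Hu0; rewrite c0 scale0r subr0 in Hc.
exists c^-1; have := HN _ (HZ c^-1 _ Hc).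
by rewrite scalerBr scalerA mulVf // scale1r opprB.
Qed.

Lemma separating_functional : exists l : cfg -> F,
  [/\ {morph l : x y / x + y}, (forall x, I x -> l x = 0) & l u0 = 1].
Proof.
have [H [IH HB Hu0 /choice[l lH]]] := maximal_subgroup.
have HZ := sub_closedZ HB.
have l_uniq u c : H (u - c *: u0) -> l u = c.
  move=> Hc; apply/eqP; rewrite -subr_eq0; apply/negPn/negP => c0; apply: Hu0.
  have := HZ (l u - c)^-1 _ (HB _ _ Hc (lH u)).
  have -> : u - c *: u0 - (u - l u *: u0) = (l u - c) *: u0.
    by rewrite opprB addrC addrA subrK scalerBl.
  by rewrite scalerA mulVf // scale1r.
exists l; split=> [x y|x Ix|]; apply: l_uniq.
- have -> : x + y - (l x + l y) *: u0 = x - l x *: u0 - (0 - (y - l y *: u0)).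
    by rewrite sub0r opprK scalerDl opprD addrACA.
  apply: (HB) => //; apply: (HB) => //; exact: IH.
- by rewrite scale0r subr0; apply: IH.
- by rewrite scale1r subrr; apply: IH.
Qed.
End Functional.

(** A functional that kills the image but not [u0] is, on finite supports, the pairing with some
    configuration [x], possibly of infinite support. Then [x] lies in the kernel of the transpose,
    so it is 0, and so is the functional at [u0]. *)
Lemma rowop_inj_surj : prime p -> (forall x, rowop O A x = 0 -> x = 0) -> surj (colop O A).
Proof.
move=> p_pr inj; apply: contrapT => nsurj.
have [u0 [u0f Iu0]] : exists u0, finsupp u0 /\ ~ exists y, finsupp y /\ colop O A y = u0.
  by apply: contrapT => H; apply: nsurj => u uf; apply: contrapT => Hu; apply: H; exists u.
have aC := @addf_colop d n p O A.
have [||l [lD lI lu0]] := @separating_functional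
    (fun u => exists y, finsupp y /\ colop O A y = u) u0 _ _ Iu0.
- by exists 0; split; [exists 0%N | apply: addf0].
- move=> _ _ [y [yf <-]] [z [zf <-]]; exists (y - z).
  by split; [apply: finsuppB | rewrite addfB].
have l0 : l 0 = 0 by apply: (addrI (l 0)); rewrite -lD !addr0.
have lZ (c : F) x : l (c *: x) = c * l x.
  rewrite -[c]natr_Zp scaler_nat mulr_natl.
  by elim: (c : nat) => [|m IHm]; rewrite ?mulr0n // !mulrS lD IHm.
pose x : cfg := fun g => \row_j l (delta g (delta_mx 0 j)).
have lx g v : l (delta g v) = dot v (x g).
  have -> : delta g v = \sum_j v ord0 j *: delta g (delta_mx 0 j) :> cfg.
    apply/funext => h; rewrite cfg_sumE {1}/delta; case: eqP => hg.
      by rewrite [LHS]row_sum_delta; apply: eq_bigr => j _; rewrite cfgZE /delta hg eqxx.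
    by rewrite big1 // => j _; rewrite cfgZE /delta; case: eqP; rewrite ?scaler0.
  rewrite (big_morph l lD l0) /dot mxE; apply: eq_bigr => j _.
  by rewrite lZ !mxE.
have x0 : x = 0.
  apply: inj; apply/funext => g; apply: dot_eq0 => v.
  rewrite -(dot_adj lD lx); apply: lI; exists (delta g v); split=> //.
  exact: finsupp_delta.
case: u0f => q u0q; move: lu0; rewrite (finsupp_sum u0q) (big_morph l lD l0) big1.
  by move/esym/eqP; rewrite oner_eq0.
by move=> b _; rewrite lx x0 /dot trmx0 mulmx0 mxE.
Qed.
End Duality.

(** * Coordinates *)

Lemma elementary_coordinates (V : finZmodType) (p : nat) (v0 : V) :
    prime p -> v0 != 0 -> (forall v : V, v *+ p = 0) ->
  exists n (e : V -> 'rV['F_p]_n), {morph e : x y / x + y} /\ bijective e.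
Proof.
move=> p_pr v0_neq0 Vp.
have abV : (p.-abelem [set: V])%g.
  rewrite abelemE // zmod_abelian; apply/exponentP => x _.
  by rewrite zmodXgE Vp.
have ntV : ([set: V] != 1)%g.
  apply/eqP => V1; have : v0 \in [set: V] by rewrite inE.
  by rewrite V1 inE; apply/negP.
exists _, (abelem_rV abV ntV); split=> [x y|].
  by rewrite -zmodMgE abelem_rV_M ?inE.
by exists (rVabelem abV ntV) => x; rewrite ?rVabelemK ?abelem_rV_K ?inE.
Qed.

(** The cardinal of [V] kills [v0], hence is zero in [k]; so the characteristic is positive. *)
Lemma finLmod_char (k : fieldType) (V : finLmodType k) (v0 : V) : v0 != 0 ->
  exists2 p, prime p & forall v : V, v *+ p = 0.
Proof.
move=> v0_neq0.
have : (#|V|%:R == 0 :> k).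
  have : v0 *+ #|V| = 0.
    have := order_dvdG (finset.in_setT v0); rewrite cardsT => /dvdnP[m ->].
    have o : v0 *+ #[v0]%g = 0 := expg_order v0.
    by rewrite mulnC mulrnA o mul0rn.
  by move/eqP; rewrite -scaler_nat scaler_eq0 (negPf v0_neq0) orbF.
move=> /natf0_pchar[|p pk]; first by apply/card_gt0P; exists v0.
exists p => [|v]; first exact: pcharf_prime pk.
by rewrite -scaler_nat (pcharf0 pk) scale0r.
Qed.

(** * Data of a linear NUCA *)

Section Link.
Variables (d : nat) (k : fieldType) (V : finLmodType k) (p n : nat).
Local Notation F := 'F_p.
Local Notation W := 'rV[F]_n.
Local Notation Mx := 'M[F]_n.
Local Notation G := (Zd d).
Local Notation cfg := (G -> W).
Local Notation config := (config d V).
Local Notation data := (data d n p).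
Variables (e : V -> W) (e' : W -> V).
Hypotheses (eD : {morph e : x y / x + y}) (eK : cancel e e') (e'K : cancel e' e).

Global Instance enc_V : Enc V := @enc_fin V.
Global Instance enc_I m : Enc 'I_m := @enc_fin 'I_m.

Definition basis_rank (j : 'I_n) : nat := enum_rank (e' (delta_mx 0 j)).
Definition rowmx (j : 'I_n) (v : V) : Mx := \matrix_(i, c) (if i == j then e v ord0 c else 0).
(* [l] lists the values of the map along [enum V]. *)
Definition table_mx (l : seq V) : Mx :=
  foldr (fun j M => rowmx j (nth 0 l (basis_rank j)) + M) 0 (enum 'I_n).

Lemma e0 : e 0 = 0.
Proof. by apply: (addrI (e 0)); rewrite -eD !addr0. Qed.

Lemma row_table_mx l j : row j (table_mx l) = e (nth 0 l (basis_rank j)).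
Proof.
rewrite /table_mx -[X in row j X]/(foldr _ _ _).
have -> : foldr (fun j M => rowmx j (nth 0 l (basis_rank j)) + M) 0 (enum 'I_n) =
    \sum_(i <- enum 'I_n) rowmx i (nth 0 l (basis_rank i)).
  by elim: (enum _) => [|i s IHs]; rewrite ?big_nil ?big_cons //= IHs.
rewrite big_enum /=; apply/rowP => c;
  rewrite mxE summxE (bigD1 j) //= mxE eqxx big1 ?addr0 // => i ij.
by rewrite mxE eq_sym (negPf ij).
Qed.

Lemma e'D : {morph e' : x y / x + y}.
Proof. by move=> x y; apply: (can_inj eK); rewrite eD !e'K. Qed.

(** In coordinates an additive map is linear over the prime field, so its values at the vectors
    [e' (delta_mx 0 j)], read off the table, determine it. *)
Lemma table_mxE (phi : V -> V) : {morph phi : x y / x + y} ->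
  forall v, e (phi v) = e v *m table_mx [seq phi u | u <- enum V].
Proof.
move=> phiD v; pose g w := e (phi (e' w)).
have gD : {morph g : x y / x + y} by move=> x y; rewrite /g e'D phiD eD.
have g0 : g 0 = 0 by apply: (addrI (g 0)); rewrite -gD !addr0.
have gZ (c : F) w : g (c *: w) = c *: g w.
  rewrite -[c]natr_Zp !scaler_nat.
  by elim: (c : nat) => [|m IHm]; rewrite ?mulr0n // !mulrS gD IHm.
rewrite -[in LHS](eK v) -/(g _) [e v in LHS]row_sum_delta (big_morph g gD g0) mulmx_sum_row.
apply: eq_bigr => j _; rewrite gZ row_table_mx (nth_map 0) ?nth_enum_rank //.
by rewrite -cardE; apply: ltn_ord.
Qed.

Definition inp : Type := seq G * (seq (G * seq (seq V)) * seq (seq V)).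

Definition row_tables (I : inp) (h : G) : seq (seq V) :=
  foldr (fun q acc => if q.1 == h then q.2 else acc) I.2.2 I.2.1.

(** A NUCA is given by rows, attached to the target [g], which reads [g + m]. By columns, the source
    [h] contributes to [h - m] through the local map of that target: hence the negated offsets, and
    exceptional columns at the sites of [E + M]. *)
Definition primal (I : inp) : data :=
  ([seq - m | m <- I.1],
   ([seq (h, [seq table_mx (nth [::] (row_tables I (h - nth 0 I.1 i)) i) | i <- iota 0 (size I.1)])
    | h <- flatten [seq [seq q.1 + m | m <- I.1] | q <- I.2.1]],
    [seq table_mx t | t <- I.2.2])).

(** For the transposed operator the rows become columns: offsets and exceptional sites stay, and
    only the matrices are transposed. *)
Definition dual (I : inp) : data :=
  (I.1, ([seq (q.1, [seq (table_mx t)^T | t <- q.2]) | q <- I.2.1],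
    [seq (table_mx t)^T | t <- I.2.2])).

Lemma computable_table_mx C {eC : Enc C} (l : C -> seq V) : computable l ->
  computable (fun c => table_mx (l c)).
Proof.
move=> Hl; rewrite /table_mx; comp.
apply: (computable_finfun2 (fun A B : Mx => A + B)); comp.
apply: (computable_finfun2 rowmx); comp.
by apply: (computable_finfun basis_rank); comp.
Qed.

Lemma computable_row_tables C {eC : Enc C} (I : C -> inp) (h : C -> G) :
  computable I -> computable h -> computable (fun c => row_tables (I c) (h c)).
Proof.
apply: (computable_app2 (h := row_tables)); rewrite /row_tables; comp.
by apply: computable_eq; [exact: enc_site_inj | comp | comp].
Qed.

Lemma computable_primal : computable primal.
Proof.
rewrite /primal; comp.
- by apply: computable_opp_site; comp.
- apply: computable_table_mx; comp; apply: computable_row_tables; comp.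
  by apply: computable_add_site; comp; apply: computable_opp_site; comp.
- by apply: computable_add_site; comp.
- by apply: computable_table_mx; comp.
Qed.

Lemma computable_dual : computable dual.
Proof.
rewrite /dual; comp.
- by apply: (computable_finfun (fun A : Mx => A^T)); apply: computable_table_mx; comp.
- by apply: (computable_finfun (fun A : Mx => A^T)); apply: computable_table_mx; comp.
Qed.

Definition conv (x : config) : cfg := fun g => e (x g).
Definition unconv (x : cfg) : config := fun g => e' (x g).

Lemma convK : cancel conv unconv. Proof. by move=> x; apply/funext => g; apply: eK. Qed.
Lemma unconvK : cancel unconv conv. Proof. by move=> x; apply/funext => g; apply: e'K. Qed.

Section Semantics.
Variables (M E : {fset G}) (s : G -> locmap V M) (lM : seq M) (lE : seq G) (c : locmap V M).
Hypotheses (lM_enum : perm_eq lM (enum {: M})) (lE_E : perm_eq lE E).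
Hypothesis sc : forall g, g \notin E -> s g =1 c.

Definition table (f : locmap V M) :
  seq (seq V) := [seq [seq f (single m v) | v <- enum V] | m <- lM].
Definition spec_inp : inp := ([seq val m | m <- lM], ([seq (g, table (s g)) | g <- lE], table c)).

Lemma row_tables_spec g : row_tables spec_inp g = table (s g).
Proof.
rewrite /row_tables /=.
have [gE|gE] := boolP (g \in lE).
  elim: lE gE => //= h l IHl; rewrite inE eq_sym; case: eqP => [->|_] //=.
have -> : table (s g) = table c.
  apply: eq_map => m; apply: eq_map => v; apply: sc.
  by rewrite -(perm_mem lE_E).
elim: lE gE => //= h l IHl; rewrite inE negb_or eq_sym => /andP[/negPf -> gl].
exact: IHl.
Qed.

Definition smx g (i : nat) : Mx := table_mx (nth [::] (table (s g)) i).

Lemma nuca_sum x g : nuca s x g = \sum_(m <- lM) s g (single m (x (g + val m))).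
Proof.
rewrite /nuca (perm_big _ lM_enum) big_enum /= -linear_sum; congr (s g _).
apply/ffunP => m; rewrite ffunE sum_ffunE (bigD1 m) //= ffunE eqxx big1 ?addr0 => [|m' mm'].
  by rewrite /act opprK.
by rewrite ffunE eq_sym (negPf mm').
Qed.

Lemma singleD (m : M) (v w : V) : single m (v + w) = single m v + single m w.
Proof. by apply/ffunP => m'; rewrite !ffunE; case: eqP; rewrite ?addr0. Qed.

Lemma conv_nuca x g :
  conv (nuca s x) g = \sum_(i < size lM) conv x (g + nth 0 [seq val m | m <- lM] i) *m smx g i.
Proof.
rewrite /conv nuca_sum (big_morph e eD e0) /smx /table.
case: lM => [|m0 l]; first by rewrite big_nil big_ord0.
rewrite (big_nth m0) big_mkord; apply: eq_bigr => i _.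
set m := nth m0 _ i.
have phiD : {morph (fun v => s g (single m v)) : v w / v + w}.
  by move=> v w; rewrite singleD linearD.
rewrite (table_mxE phiD); congr (e (x (g + _)) *m table_mx _).
  by rewrite (nth_map m0).
by rewrite (nth_map m0).
Qed.

Lemma data_op_primal x : data_op (primal spec_inp) (conv x) = conv (nuca s x).
Proof.
apply/funext => g; rewrite conv_nuca /data_op /colop /= !size_map.
apply: eq_bigr => i _.
have -> : nth 0 [seq - m | m <- [seq val m | m <- lM]] i = - nth 0 [seq val m | m <- lM] i.
  by rewrite (nth_map 0) ?size_map.
rewrite opprK; congr (_ *m _); set h := g + _.
have gh : h - nth 0 [seq val m | m <- lM] i = g by rewrite /h addrK.
have tabE (l : seq G) (f : G -> seq Mx) (b : seq Mx) :
    column ([seq - m | m <- spec_inp.1], ([seq (h', f h') | h' <- l],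
      b)) h = if h \in l then f h else b.
  rewrite /column /=; elim: l => //= h' l ->; rewrite inE eq_sym.
  by case: eqP => [->|].
have iM : (i < size spec_inp.1)%N by rewrite size_map.
rewrite [column _ _]tabE; case: ifP => [_|/negbT hS].
  rewrite (nth_map 0%N) ?size_iota // nth_iota // add0n gh row_tables_spec //.
have gE : g \notin E.
  apply: contra hS => gE; apply/flattenP; exists [seq g + m | m <- spec_inp.1].
    by apply/mapP; exists (g, table (s g)) => //; apply: map_f; rewrite (perm_mem lE_E).
  by apply: map_f; apply: mem_nth.
rewrite (nth_map [::]) ?size_map // /smx; congr (table_mx (nth _ _ _)).
by apply: eq_map => m; apply: eq_map => v; rewrite sc.
Qed.

Lemma rowop_dual x :
  rowop (dual spec_inp).1 (fun h i => nth 0 (column (dual spec_inp) h) i) (conv x) = conv (nuca s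
    x).
Proof.
apply/funext => g; rewrite conv_nuca /rowop /= size_map.
apply: eq_bigr => i _; congr (_ *m _); rewrite /smx -row_tables_spec.
have iM : (i < size lM)%N by [].
have -> : column (dual spec_inp) g = [seq (table_mx t)^T | t <- row_tables spec_inp g].
  by rewrite /column /row_tables /=; elim: lE => //= h l ->; case: ifP.
by rewrite (nth_map [::]) ?trmxK // row_tables_spec size_map.
Qed.
End Semantics.
End Link.

(** * Decision procedures *)

Lemma iter_idem (U : Type) (f : U -> U) N : iter (2 * N) f =1 iter N f ->
  forall m, iter (m.+1 * N) f =1 iter N f.
Proof.
move=> fN; elim=> [|m IHm] x; first by rewrite mul1n.
by rewrite mulSn iterD IHm -iterD addnn -mul2n fN.
Qed.

Section Tests.
Variables (d n p : nat).
Hypotheses (d_gt0 : (0 < d)%N) (p_pr : prime p).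
Local Notation data := (data d n p).
Local Notation W := 'rV['F_p]_n.
Local Notation cfg := (Zd d -> W).
Implicit Type D : data.

Definition evp_test D : bool := check (generic D) (2 * per_const d n p) (per_const d n p) (-1).
Definition idem_test D (N : nat) : bool := (N != 0%N) && check D (2 * N) N (-1).

Lemma check_eqP D i j : reflect (iter i (data_op D) =1 iter j (data_op D)) (check D i j (-1)).
Proof.
apply: (iffP (checkP d_gt0 D i j (-1))) => H x.
  by apply/eqP; rewrite -subr_eq0 -scaleN1r H.
by rewrite H scaleN1r subrr.
Qed.

Lemma evp_testP D : reflect (exists i j,
  (i < j)%N /\ iter i (data_op D) =1 iter j (data_op D)) (evp_test D).
Proof.
have aT := addf_data_op D; have aTc := addf_data_op (generic D).
have lT := @data_op_local _ _ _ D; have lTc := @generic_local _ _ _ D;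
  have eTc := @generic_equiv _ _ _ D.
have Tv := @data_op_vanish _ _ _ D.
apply: (iffP (check_eqP _ _ _)).
  exact: (evp_near aT lT lTc Tv p_pr (per_const_gt0 d n p_pr)).
by move=> [i [j [ij Tij]]]; apply: (evp_uniform aTc lTc eTc Tv d_gt0 p_pr ij Tij).
Qed.

(** The first disjunct makes the search total: it stops at 0 when no exponent is guaranteed. *)
Lemma idem_exists D : exists N, ~~ evp_test D || idem_test D N.
Proof.
case: evp_testP => [[i [j [ij Tij]]]|_]; last by exists 0%N.
by exists j`!; rewrite /idem_test -lt0n fact_gt0; apply/check_eqP/(idem_pow ij Tij).
Qed.

Definition idem_exp D : nat := ex_minn (idem_exists D).

Lemma idem_expP D : evp_test D ->
  (0 < idem_exp D)%N /\ iter (2 * idem_exp D) (data_op D) =1 iter (idem_exp D) (data_op D).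
Proof.
rewrite /idem_exp; case: ex_minnP => N + _ evp;
  rewrite evp /= /idem_test -lt0n => /andP[N0 /check_eqP TN].
by split.
Qed.

Definition nil_test D : bool := evp_test D && check D (idem_exp D) 0 0.
Definition per_test D : bool := evp_test D && check D (idem_exp D) 0 (-1).

(** If [T ^ m = 0] and [T ^ N] is idempotent, then [T ^ N = T ^ (m.+1 * N) = 0]; so one exponent [N]
    decides. *)
Lemma nil_testP D : reflect (exists2 m, (1 <= m)%N & iter m (data_op D) =1 fun=> 0) (nil_test D).
Proof.
apply: (iffP andP) => [[evp /(checkP d_gt0) T0]|[m m0 Tm]].
  have [N0 _] := idem_expP evp; exists (idem_exp D) => // x.
  by have := T0 x; rewrite scale0r addr0.
have evp : evp_test D.
  apply/evp_testP; exists m, m.+1; split=> // x; rewrite /= !Tm addf0 //; exact: addf_data_op.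
split=> //; have [N0 TN] := idem_expP evp; apply/(checkP d_gt0) => x.
rewrite scale0r addr0 -(iter_idem TN m) -(@subnK m (m.+1 * idem_exp D)).
  by rewrite iterD Tm addf0 //; apply: addf_iter; apply: addf_data_op.
by apply: leq_trans (leqnSn m) _; rewrite leq_pmulr.
Qed.

(** A periodic operator is injective, so [T ^ N] can be cancelled in [T ^ (2 N) = T ^ N]. *)
Lemma per_testP D : reflect (exists2 m, (1 <= m)%N & iter m (data_op D) =1 id) (per_test D).
Proof.
apply: (iffP andP) => [[evp /check_eqP T1]|[m m0 Tm]].
  by have [N0 _] := idem_expP evp; exists (idem_exp D).
have evp : evp_test D by apply/evp_testP; exists 0%N, m; split=> // x; rewrite Tm.
split=> //; have [N0 TN] := idem_expP evp; apply/check_eqP => x.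
have inj y z : data_op D y = data_op D z -> y = z.
  by case: m m0 Tm => // m _ Tm E; rewrite -[y]Tm -[z]Tm !iterSr E.
have inj_iter i y z : iter i (data_op D) y = iter i (data_op D) z -> y = z.
  by elim: i => //= i IHi /inj.
by apply: (inj_iter (idem_exp D)); rewrite -iterD addnn -mul2n TN.
Qed.

Lemma computable_evp_test : computable evp_test.
Proof.
rewrite /evp_test; apply: computable_check; comp; exact: computable_generic (@computable_id _ _).
Qed.

Lemma computable_idem_exp : computable idem_exp.
Proof.
apply: computable_search; comp; rewrite /idem_test.
  by apply: (computable_comp computable_evp_test); comp.
comp; first by apply: computable_eq; [exact: (fun x y => id) | comp | comp].
by apply: computable_check; comp; apply: computable_mul_nat; comp.
Qed.

Lemma computable_nil_test : computable nil_test.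
Proof.
rewrite /nil_test; comp; first exact: computable_evp_test.
by apply: computable_check; comp; exact: computable_idem_exp.
Qed.

Lemma computable_per_test : computable per_test.
Proof.
rewrite /per_test; comp; first exact: computable_evp_test.
by apply: computable_check; comp; exact: computable_idem_exp.
Qed.
End Tests.

(** * Decidability *)

(* The code of the data of a NUCA is a list of length 3, unlike that of a nested pair. *)
Definition enc_triple T1 T2 T3 {e1 : Enc T1} {e2 : Enc T2} {e3 : Enc T3} : Enc (T1 * (T2 * T3)) :=
  fun t => CodeSeq.code [:: enc t.1; enc t.2.1; enc t.2.2].

Lemma computable_triple T1 T2 T3 U {e1 : Enc T1} {e2 : Enc T2} {e3 : Enc T3} {eU : Enc U}
    (f : T1 * (T2 * T3) -> U) : computable f -> @computable _ _ (@enc_triple _ _ _ e1 e2 e3) _ f.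
Proof.
move=> Hf; pose F m := cons_code (head_code m) (cons_code (cons_code (head_code (behead_code m))
  (cons_code (head_code (behead_code (behead_code m))) 0)) 0)%N.
apply: (@computable_comp _ _ _ (@enc_triple _ _ _ e1 e2 e3) _ _ f id Hf).
apply: (@computable_raw _ _ (@enc_triple _ _ _ e1 e2 e3) _ F).
  by rewrite /F; do ![apply: rcomp_cons | apply: rcomp_head | apply: rcomp_behead];
    (exact: rcomp_proj || exact: rcomp_const).
by move=> t; rewrite /F [enc t in LHS]/enc_triple !behead_codeE !head_codeE.
Qed.

Section Transfer.
Variables (d : nat) (k : fieldType) (V : finLmodType k) (p n : nat).
Hypotheses (d_gt0 : (0 < d)%N) (p_pr : prime p).
Local Notation F := 'F_p.
Local Notation W := 'rV[F]_n.
Local Notation G := (Zd d).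
Local Notation cfg := (G -> W).
Local Notation config := (config d V).
Variables (e : V -> W) (e' : W -> V).
Hypotheses (eD : {morph e : x y / x + y}) (eK : cancel e e') (e'K : cancel e' e).
Variable tau : config -> config.

Local Notation conv := (conv (d := d) e).
Local Notation unconv := (unconv (d := d) e').

Lemma conv_inj : injective conv.
Proof. exact: can_inj (convK eK). Qed.

Lemma convD x y : conv (fun g => x g + y g) = conv x + conv y.
Proof. by apply/funext => g; apply: eD. Qed.

Lemma conv0 : conv (fun=> 0) = 0.
Proof. by apply/funext => g; apply: e0. Qed.

Lemma asymptoticP x y : asymptotic x y <-> finsupp (conv x - conv y).
Proof.
split=> [[A xy]|[q xy]].
  exists (\max_(g <- enum_fset A) norm g)%N => g gq;
    rewrite cfgDE cfgNE -[conv x g]/(e (x g)) -[conv y g]/(e (y g)) xy ?subrr //.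
  by apply/negP => gA; move: gq;
    rewrite ltnNge (@leq_bigmax_seq _ (enum_fset A) xpredT (@norm d) g gA isT).
exists (seq_fset tt (ball d q)) => g; rewrite seq_fsetE mem_ball -ltnNge => /xy/eqP.
by rewrite cfgDE cfgNE subr_eq0 => /eqP/(can_inj eK).
Qed.

Variable D : data d n p.
Hypothesis tauE : forall x, data_op D (conv x) = conv (tau x).

Lemma conv_iter m x : conv (iter m tau x) = iter m (data_op D) (conv x).
Proof. by elim: m => //= m <-; rewrite tauE. Qed.

Lemma iter_eqP i j : iter i tau = iter j tau <-> iter i (data_op D) =1 iter j (data_op D).
Proof.
split=> [E x|E]; first by rewrite -[x](unconvK e'K) -!conv_iter E.
by apply/funext => x; apply: conv_inj; rewrite !conv_iter.
Qed.

Lemma nilpotentP : reflect (nuca_nilpotent tau) (nil_test d_gt0 p_pr D).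
Proof.
apply: (iffP (nil_testP d_gt0 p_pr D)) => -[m m0 E]; exists m => //.
  by apply/funext => x; apply: conv_inj; rewrite conv_iter E conv0.
by move=> x; rewrite -[x](unconvK e'K) -conv_iter E conv0.
Qed.

Lemma periodicP : reflect (nuca_periodic tau) (per_test d_gt0 p_pr D).
Proof.
apply: (iffP (per_testP d_gt0 p_pr D)) => -[m m0 E]; exists m => //.
  exact: (iter_eqP m 0).2.
exact: (iter_eqP m 0).1.
Qed.

Lemma eventually_periodicP : reflect (nuca_eventually_periodic tau) (evp_test D).
Proof.
apply: (iffP (evp_testP d_gt0 p_pr D)) => [[i [j [ij /iter_eqP E]]]|[m [l [m0 l0 /iter_eqP E]]]].
  (* The preperiod is [i.+1] because [i] may be 0, while a positive one is required. *)
  exists (j - i)%N, i.+1; rewrite subn_gt0 ij; split=> //.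
  by rewrite addnS subnK ?(ltnW ij) //; apply/funext => x; rewrite !iterS E.
by exists l, (m + l)%N; split=> [|x]; rewrite ?E // -[X in (X < _)%N]add0n ltn_add2r.
Qed.

(** By additivity, correcting [x] amounts to finding a finitely supported preimage of the finitely
    supported difference; the converse is the case [x = 0]. *)
Lemma post_surjectiveP : reflect (post_surjective tau) (surj_test (n * 2 ^ d).+1 D).
Proof.
apply: (iffP (surj_testP d_gt0 p_pr D)) => [sT x y yx|ps u uf].
  have [w [wf Tw]] := sT _ ((asymptoticP _ _).1 yx).
  exists (fun g => x g + unconv w g).
    apply/asymptoticP; by rewrite convD addrAC subrr add0r (unconvK e'K).
  apply: conv_inj; rewrite -tauE convD (unconvK e'K) addf_data_op Tw tauE.
  by rewrite addrC subrK.
have tau0 : conv (tau (fun=> 0)) = 0 by rewrite -tauE conv0; apply: addf0; apply: addf_data_op.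
have [|z z0 tz] := ps (fun=> 0) (unconv u).
  by apply/asymptoticP; rewrite tau0 subr0 (unconvK e'K).
exists (conv z); split; last by rewrite tauE tz (unconvK e'K).
by have := (asymptoticP _ _).1 z0; rewrite conv0 subr0.
Qed.

End Transfer.

Lemma injective_rowop (d : nat) (k : fieldType) (V : finLmodType k) (p n : nat)
    (e : V -> 'rV['F_p]_n) e' (tau : config d V -> config d V) (D : data d n p) :
    (0 < d)%N -> prime p -> {morph e : x y / x + y} -> cancel e e' -> cancel e' e ->
    (forall x, rowop D.1 (fun h i => nth 0 (column D h) i) (conv e x) = conv e (tau x)) ->
  reflect (injective tau) (surj_test (n * 2 ^ d).+1 D).
Proof.
move=> d_gt0 p_pr eD eK e'K tauE; set T := rowop _ _ in tauE.
have TD : {morph T : x y / x - y}.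
  move=> x y; apply/funext => g; rewrite cfgDE cfgNE /T /rowop -sumrB; apply: eq_bigr => i _.
  by rewrite cfgDE cfgNE mulmxBl.
apply: (iffP (surj_testP d_gt0 p_pr D)) => [sT x y E|inj].
  apply: (conv_inj (e := e) eK); apply/eqP; rewrite -subr_eq0; apply/eqP.
  by apply: (surj_rowop_inj sT); rewrite [LHS]TD !tauE E subrr.
apply: rowop_inj_surj => // x Tx; rewrite -[x](unconvK e'K); have T0 : T 0 = 0 by have := TD 0 0;
  rewrite !subrr.
rewrite (_ : unconv e' x = fun=> 0) ?conv0 //; apply: inj; apply: (conv_inj (e := e) eK).
by rewrite -!tauE (unconvK e'K) conv0 // [LHS]Tx T0.
Qed.

(** * Polynomial identities with coefficients in [k] *)

Section CayleyHamilton.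
Variables (d : nat) (k : fieldType) (V : finLmodType k) (v0 : V) (v0_neq0 : v0 != 0).
Variables (M : {fset Zd d}) (s : Zd d -> locmap V M).
Local Notation tau := (nuca s).

Lemma nucaZD (c : k) x y : tau (fun g => c *: x g + y g) = fun g => c *: tau x g + tau y g.
Proof.
apply/funext => g; rewrite /nuca -linearP; congr (s g _).
by apply/ffunP => m; rewrite !ffunE.
Qed.

Lemma nuca_sumZ I (r : seq I) (c : I -> k) (x : I -> config d V) :
  tau (fun g => \sum_(i <- r) c i *: x i g) = fun g => \sum_(i <- r) c i *: tau (x i) g.
Proof.
elim: r => [|i r IHr]; last first.
  rewrite (_ : (fun g => _) = (fun g => c i *: x i g + \sum_(i <- r) c i *: x i g)).
    by rewrite nucaZD IHr; apply/funext => g; rewrite big_cons.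
  by apply/funext => g; rewrite big_cons.
apply/funext => g; rewrite [RHS]big_nil /nuca (_ : restr M _ = 0) ?linear0 //.
by apply/ffunP => m; rewrite !ffunE /act big_nil.
Qed.

Lemma iter_nuca_sumZ m I (r : seq I) (c : I -> k) (x : I -> config d V) :
  iter m tau (fun g => \sum_(i <- r) c i *: x i g) = fun g => \sum_(i <- r) c i *: iter m tau (x
    i) g.
Proof. by elim: m => //= m ->; rewrite nuca_sumZ. Qed.

(** Modulo [P], each power of [tau] is a combination of those below the degree; only finitely many
    coefficient vectors exist, so two powers coincide. Conversely ['X^(m + l) - 'X^l] is the
    polynomial. *)
Lemma Cayley_HamiltonE : nuca_Cayley_Hamilton tau <-> nuca_eventually_periodic tau.
Proof.
split=> [[P P0 HP]|[m [l [m0 l0 E]]]]; last first.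
  pose P : {poly k} := 'X^(m + l) - 'X^l.
  have szP : size P = (m + l).+1 by rewrite size_polyDl size_polyXn // size_polyN size_polyXn ltnS
    -addn1 addnC leq_add2r.
  exists P; first by rewrite -size_poly_eq0 szP.
  apply/funext => x; apply/funext => g; rewrite /poly_op szP.
  under eq_bigr do rewrite coefB !coefXn.
  rewrite (bigD1 ord_max) //= eqxx gtn_eqF; last by rewrite -[X in (X < _)%N]add0n ltn_add2r.
  have lt : (l < (m + l).+1)%N by rewrite ltnS leq_addl.
  rewrite (bigD1 (Ordinal lt)) /=;
    last by rewrite -val_eqE /= ltn_eqF // -[X in (X < _)%N]add0n ltn_add2r.
  rewrite eqxx ltn_eqF; last by rewrite -[X in (X < _)%N]add0n ltn_add2r.
  rewrite big1 => [|i /andP[i1 i2]]; last by rewrite -!val_eqE /= in i1 i2;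
    rewrite (negPf i1) (negPf i2) subrr scale0r.
  by rewrite subr0 sub0r scale1r scaleN1r E addr0 subrr.
pose q := (size P).-1; have szP : size P = q.+1 by rewrite prednK // size_poly_gt0.
pose S i := exists c : {ffun 'I_q ->
  k}, forall x, iter i tau x = fun g => \sum_(j < q) c j *: iter j tau x g.
have lP : lead_coef P != 0 by rewrite lead_coef_eq0.
have Sq x : iter q tau x = fun g => \sum_(j < q) (- (lead_coef P)^-1 * P`_j) *: iter j tau x g.
  apply/funext => g; have := congr1 (fun f : config d V -> config d V => f x g) HP.
  rewrite /poly_op szP big_ord_recr /= -/(lead_coef P) => /eqP; rewrite addrC addr_eq0 => /eqP.
  move=> /(congr1 (fun v => (lead_coef P)^-1 *: v)); rewrite scalerA mulVf // scale1r => ->.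
  rewrite scalerN scaler_sumr -sumrN; apply: eq_bigr => j _.
  by rewrite scalerA mulNr scaleNr.
have S_all i : S i.
  have [l] := ubnP i; elim: l i => // l IHl i; rewrite ltnS => il.
  have [iq|qi] := ltnP i q.
    exists [ffun j => (j == Ordinal iq)%:R] => x; apply/funext => g.
    rewrite (bigD1 (Ordinal iq)) //= ffunE eqxx scale1r big1 ?addr0 // => j ji.
    by rewrite ffunE (negPf ji) scale0r.
  have /fin_all_exists[C HC] (j : 'I_q) : S (i - q + j)%N.
    by apply: IHl; have := ltn_ord j; lia.
  exists [ffun t => \sum_(j < q) (- (lead_coef P)^-1 * P`_j) * C j t] => x.
  rewrite -{1}(subnK qi) iterD Sq iter_nuca_sumZ; apply/funext => g.
  under eq_bigr do rewrite -iterD HC scaler_sumr.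
  rewrite exchange_big; apply: eq_bigr => t _; rewrite ffunE scaler_suml.
  by apply: eq_bigr => j _; rewrite scalerA.
have /choice[C HC] := S_all.
(* [k] is not given as a finite type, but multiplying [v0] by scalars embeds it into [V], where the
   pigeonhole principle applies. *)
pose T := {ffun 'I_q -> V}.
have [i [j [ij Cij]]] := @not_inj_card 'I_#|T|.+1 T
  (fun i => [ffun t => C i t *: v0]) (etrans (congr1 (leq _) (card_ord _)) (leqnn _)).
have E : iter i tau = iter j tau.
  apply/funext => x; rewrite !HC; apply/funext => g; apply: eq_bigr => t _; congr (_ *: _).
  have /ffunP/(_ t) := Cij; rewrite !ffunE => /eqP; rewrite -subr_eq0 -scalerBl scaler_eq0.
  by rewrite (negPf v0_neq0) orbF subr_eq0 => /eqP.
wlog {ij Cij} ij : i j E / (i < j)%N.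
  by move=> H; move: ij; rewrite neq_ltn => /orP[|]; [apply: H E|apply: H (esym E)].
exists (j - i)%N, i.+1; rewrite subn_gt0 ij; split=> //.
by rewrite addnS subnK ?(ltnW ij) //; apply/funext => x; rewrite !iterS E.
Qed.
End CayleyHamilton.

(** The zero space is treated apart: it does not force positive characteristic, so there may be no
    [p] to work with. *)
Lemma trivial_properties (d : nat) (k : fieldType) (V : finLmodType k) (tau : config d V ->
  config d V) :
    (forall v : V, v = 0) ->
  [/\ nuca_nilpotent tau, nuca_periodic tau, nuca_eventually_periodic tau,
      nuca_Cayley_Hamilton tau & injective tau /\ post_surjective tau].
Proof.
move=> V0; have cfg0 (x y : config d V) : x = y.
  by apply/funext => g; rewrite (V0 (x g)) (V0 (y g)).
split.
- by exists 1%N => //; apply/funext => x; apply: cfg0.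
- by exists 1%N => //; apply/funext => x; apply: cfg0.
- by exists 1%N, 1%N; split=> //; apply/funext => x; apply: cfg0.
- by exists 1; [exact: oner_neq0 | apply/funext => x; apply: cfg0].
- by split=> [x y _|x y _]; [apply: cfg0 | exists x; [exists fset0 | apply: cfg0]].
Qed.

Section Decide.
Variables (d : nat) (k : fieldType) (V : finLmodType k).

Lemma decidable_trivial (P : (config d V -> config d V) -> Prop) :
  (forall tau, P tau) -> LNUCAc_decidable P.
Proof.
move=> HP; have [A HA] : computable (fun _ : nat => true) by apply: computable_const.
by exists A => w tau _; split=> [_|/(_ (HP tau))//]; apply: (HA w).
Qed.

(** The test must be correct for every listing of [M] and [E], since the code of a NUCA fixes
    neither order; the triple encoding of [spec_inp] is literally the number in [is_code]. *)
Lemma decidable_of_test (P : (config d V -> config d V) -> Prop) (f : inp d V -> bool) :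
    computable f ->
    (forall (M E : {fset Zd d}) (s : Zd d ->
      locmap V M) (lM : seq M) (lE : seq (Zd d)) (c : locmap V M),
       perm_eq lM (enum {: M}) -> perm_eq lE E -> (forall g, g \notin E -> s g =1 c) ->
     reflect (P (nuca s)) (f (spec_inp s lM lE c))) ->
  LNUCAc_decidable P.
Proof.
move=> /computable_triple[A HA] fP;
  exists A => w tau [M [E [s [sE -> [lM [lE [c [lMM lEE sc ->]]]]]]]].
have := HA (spec_inp s lM lE c); rewrite /decides.
rewrite [enc (spec_inp _ _ _ _)](_ : _ = CodeSeq.code
              [:: CodeSeq.code [seq Zd_code (val m) | m <- lM];
                  CodeSeq.code [seq CodeSeq.code [:: Zd_code g; locmap_code lM (s g)]
                               | g <- lE];
                  locmap_code lM c]).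
  by case: (fP M E s lM lE c lMM lEE sc).
have tableE (f' : locmap V M) : enc (table lM f') = locmap_code lM f'.
  rewrite /enc /enc_seq /locmap_code /table -map_comp; congr CodeSeq.code.
  by apply: eq_map => m; apply: (congr1 CodeSeq.code (esym (map_comp _ _ _))).
rewrite {1}/enc /enc_triple /spec_inp /= tableE; congr (CodeSeq.code [:: _; _; _]).
  by rewrite /enc /enc_seq -map_comp.
rewrite {1}/enc {1}/enc_seq -map_comp; congr CodeSeq.code; apply: eq_map => g /=.
by rewrite {1}/enc /enc_pair /= tableE.
Qed.
End Decide.

Theorem theorem1 (d : nat) (hd : (1 <= d)%N) (k : fieldType) (V : finLmodType k) :
  LNUCAc_decidable (@nuca_nilpotent d k V) /\
  (LNUCAc_decidable (@nuca_periodic d k V) /\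
   LNUCAc_decidable (@nuca_eventually_periodic d k V)) /\
  LNUCAc_decidable (@nuca_Cayley_Hamilton d k V) /\
  LNUCAc_decidable (fun tau : config d V -> config d V => injective tau) /\
  LNUCAc_decidable (@post_surjective d k V).
Proof.
have [[v0 v0_neq0]|V0] := EM (exists v0 : V, v0 != 0); last first.
  have {}V0 v : v = 0 :> V by apply: contrapT => /eqP v0; apply: V0; exists v.
  by do ![split]; apply: decidable_trivial => tau;
    have [? ? ? ? [? ?]] := trivial_properties tau V0.
have [p p_pr Vp] := finLmod_char v0_neq0.
have [n [e [eD [e' eK e'K]]]] := elementary_coordinates p_pr v0_neq0 Vp.
have cprim := computable_primal d e e'.
have cdual := computable_dual d e e'.
do ![split].
- apply: (decidable_of_test (f := fun I => nil_test hd p_pr (primal e e' I))).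
    exact: computable_comp (computable_nil_test n hd p_pr) cprim.
  move=> M E s lM lE c lMM lEE sc; apply: (nilpotentP hd p_pr eD eK e'K) => x.
  exact: (data_op_primal eD eK e'K lMM lEE sc).
- apply: (decidable_of_test (f := fun I => per_test hd p_pr (primal e e' I))).
    exact: computable_comp (computable_per_test n hd p_pr) cprim.
  move=> M E s lM lE c lMM lEE sc; apply: (periodicP hd p_pr eK e'K) => x.
  exact: (data_op_primal eD eK e'K lMM lEE sc).
- apply: (decidable_of_test (f := fun I => evp_test (primal e e' I))).
    exact: computable_comp (computable_evp_test _ _ _) cprim.
  move=> M E s lM lE c lMM lEE sc; apply: (eventually_periodicP hd p_pr eK e'K) => x.
  exact: (data_op_primal eD eK e'K lMM lEE sc).
- apply: (decidable_of_test (f := fun I => evp_test (primal e e' I))).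
    exact: computable_comp (computable_evp_test _ _ _) cprim.
  move=> M E s lM lE c lMM lEE sc.
  apply: (iffP (eventually_periodicP hd p_pr eK e'K _)); last exact: (Cayley_HamiltonE v0_neq0 s).1.
    by move=> x; exact: (data_op_primal eD eK e'K lMM lEE sc).
  exact: (Cayley_HamiltonE v0_neq0 s).2.
- apply: (decidable_of_test (f := fun I => surj_test (n * 2 ^ d).+1 (dual e e' I))).
    by apply: computable_surj_test; exact: cdual.
  move=> M E s lM lE c lMM lEE sc; apply: (injective_rowop hd p_pr eD eK e'K) => x.
  exact: (rowop_dual eD eK e'K lMM lEE sc).
- apply: (decidable_of_test (f := fun I => surj_test (n * 2 ^ d).+1 (primal e e' I))).
    by apply: computable_surj_test; exact: cprim.
  move=> M E s lM lE c lMM lEE sc; apply: (post_surjectiveP hd p_pr eD eK e'K) => x.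
  exact: (data_op_primal eD eK e'K lMM lEE sc).
Qed.
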